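(* Let $n\geq 5$ be an integer with $n\not\equiv 2\pmod{4}$, let $\zeta_n$ be a primitive $n$-th root of unity, and let $\mathbb{K}=\mathbb{Q}(\zeta_n)$ with ring of integers $\mathcal{O}_{\mathbb{K}}$ and unit group $\mathcal{O}_{\mathbb{K}}^*$. Let $s$ be the number of distinct prime factors of $n$. Then the covering radius of the logarithmic lattice $\mathrm{Log}(\mathcal{O}_{\mathbb{K}}^* )$ with respect to the $\ell^2$ norm is less than $$\sqrt{\frac{n}{2}}\left(1-\frac{1}{\sqrt[s]{n}}\right)^{s/2}\left[(2^s-2)\sqrt{\frac{5\pi^2}{48}n+\frac{15}{2}\log^2{2}}+\sqrt{\frac{\pi^2}{6}n+6\log^2{2}}\right].$$
   Context: For a number field $\mathbb{K}$ with real embeddings $\sigma_1,\dots,\sigma_r$ and representatives $\sigma_{r+1},\dots,\sigma_{r+s'}$ of the pairs of complex-conjugate embeddings, the logarithmic embedding $\mathrm{Log}:\mathbb{K}^*\to\mathbb{R}^{r+s'}$ is $x\mapsto(\log|\sigma_1(x)|,\dots,\log|\sigma_r(x)|,\log(|\sigma_{r+1}(x)|^2),\dots,\log(|\sigma_{r+s'}(x)|^2))$. For $\mathbb{K}=\mathbb{Q}(\zeta_n)$ with $n\ge 5$, $r=0$ and $s'=\varphi(n)/2$, and $\mathrm{Log}(\mathcal{O}_{\mathbb{K}}^* )$ is a lattice of rank $\varphi(n)/2-1$ in $\mathbb{R}^{\varphi(n)/2}$ (the logarithmic lattice). The covering radius of a lattice $\Lambda\subset\mathbb{R}^m$ is $\mu(\Lambda)=\max_{x\in\mathrm{span}(\Lambda)}\min_{v\in\Lambda}\|x-v\|$,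 where $\|\cdot\|$ is the Euclidean norm. *)

(* Defs.v *)
From HB Require Import structures.
From mathcomp Require Export all_boot all_order all_algebra all_field.
From mathcomp Require Export complex.
From mathcomp Require Export all_classical all_reals all_analysis.

Set Implicit Arguments.
Unset Strict Implicit.
Unset Printing Implicit Defensive.

Import Order.TTheory GRing.Theory Num.Theory.

Local Open Scope classical_set_scope.
Local Open Scope ring_scope.

Section NumberField.
Context {K : fieldExtType rat}.

Definition ring_of_integers : set K :=
  [set x | integralOver (intr : int -> K) x].

Definition integer_units : set K :=
  [set x | [/\ x != 0, ring_of_integers x & ring_of_integers x^-1]].

Context {R : realType}.

Definition real_embedding (phi : {rmorphism K -> R[i]}) : Prop :=
  forall x, complex.Im (phi x) = 0.

(* sr enumerates the real embeddings, and sc contains exactly one member of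
   each pair of conjugate non-real embeddings, both without repetition.
   Embeddings are compared pointwise. *)
Definition embedding_system (r s : nat)
    (sr : 'I_r -> {rmorphism K -> R[i]})
    (sc : 'I_s -> {rmorphism K -> R[i]}) : Prop :=
  [/\ forall j, real_embedding (sr j),
      forall j, ~ real_embedding (sc j),
      forall phi : {rmorphism K -> R[i]}, real_embedding phi ->
        exists! j, forall x, phi x = sr j x
    & forall phi : {rmorphism K -> R[i]}, ~ real_embedding phi ->
        exists! j, (forall x, phi x = sc j x) \/
                   (forall x, phi x = conjc (sc j x))].

(* Meaningful for x != 0 only, since ln 0 = 0 by convention. *)
Definition Log (r s : nat)
    (sr : 'I_r -> {rmorphism K -> R[i]})
    (sc : 'I_s -> {rmorphism K -> R[i]}) (x : K) : 'rV[R]_(r + s) :=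
  row_mx (\row_j ln (Normc.normc (sr j x)))
         (\row_j ln (Normc.normc (sc j x) ^+ 2)).

End NumberField.

Section CoveringRadius.
Context {R : realType} {m : nat}.
Implicit Types (L : set 'rV[R]_m) (x : 'rV[R]_m).

(* The canonical norm `|x| on matrices is the sup norm. *)
Definition l2norm x : R := Num.sqrt (\sum_i x ord0 i ^+ 2).

Definition real_span L : set 'rV[R]_m :=
  [set x | exists (k : nat) (c : 'I_k -> R) (v : 'I_k -> 'rV[R]_m),
      (forall i, L (v i)) /\ x = \sum_i c i *: v i].

(* For a lattice, the infimum and the supremum are a minimum and a maximum.
   The extended-real sup is used so that an unbounded family gives +oo. *)
Definition covering_radius L : \bar R :=
  ereal_sup [set ereal_inf [set (l2norm (x - v))%:E | v in L]
            | x in real_span L].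

End CoveringRadius.

(* Main.v *)
Require Import Defs.
From HB Require Import structures.
From mathcomp Require Import all_boot all_order all_algebra all_field.
From mathcomp Require Import all_fingroup all_solvable.
From mathcomp Require Import complex ring lra zify.
From mathcomp Require Import all_classical all_reals all_analysis.

Set Implicit Arguments.
Unset Strict Implicit.
Unset Printing Implicit Defensive.

Import Order.TTheory GRing.Theory Num.Theory.
Import numFieldNormedType.Exports.

Local Open Scope classical_set_scope.
Local Open Scope ring_scope.

(** Write [w = exp (2 pi i / n)], [ell k = ln (|1 - w ^ k| ^ 2)], and let [U]
be the group of units of [Z / n].  For [u] in [U] and [k <> 0] the quotient
[(1 - zeta ^ (u k)) / (1 - zeta ^ k)] is a unit of [K], whose logarithmic
vector is [cvec (u k) - cvec k] with [cvec k = (ell (e_j k))_j], where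
[sc j zeta = w ^ e_j].

These vectors span the hyperplane of vectors with sum zero, which contains the
logarithmic lattice because units have norm [+-1].  Indeed a nonconstant vector
orthogonal to all of them yields a nonzero even function on [U] with sum zero
that is orthogonal to all translates of all [u |-> ell (u k)].  The space of
such functions is translation invariant, so it contains a nontrivial
character; by Fourier inversion and the series of [ln |1 - w ^ k|], the inverse
character [X] satisfies [L(1, X) = 0], which is impossible (3-4-1 inequality if
[X] is not real, Monsky's Lambert series argument if it is).  When [n] is a
prime power, the distribution relation for [ell] shows that [k = 1] suffices.

Randomized rounding of the coefficients of a combination of lattice vectors
[b_i] finds a lattice point at squared distance at most a quarter of the sum of
the [|b_i| ^ 2].  Since [|cvec k| ^ 2 <= 3 n] by a Riemann sum bound for the
integral of [ln ^ 2 (2 sin)], and at most [s' = phi(n) / 2] generators are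
needed, the square of the covering radius is at most [3 n s'], and at most
[3 n s' / 2] for prime powers.  AM-GM on the primes dividing [n] bounds
[sqrt s'] by the first two factors of the claim. *)

(** * Real inequalities *)

(** The constants shape the proof. Rounding along differences of two [cvec] costs at most [12 n / 4]
    per generator. For [s >= 2] this is enough, since the bracket is then at least the square root
    of [4 (5 pi^2 / 48) n >= 15 n / 4]. For [s = 1] the bracket offers little more than
    [pi^2 n / 6], barely above [3 n / 2], so a factor 2 has to be saved: all differences are taken
    with one fixed vector, and their cross terms add up to minus twice a square. This forces the
    family [k = 1], which may span too little when [n] has several prime factors, because Euler
    factors [1 - X(p)] of imprimitive characters can vanish. Letting [k] run through all of [Z / n]
    repairs this: the Fourier transform on [Z / n] recombines the vanishing sums into [L(1, X)] for
    [X] as a character modulo [n] itself, whatever its conductor. The error of the partial sums is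
    [O(1 / N)], so [L(1, X) = 0] is expressed by partial sums alone and both nonvanishing arguments
    are finite estimates. *)

Section RealAnalysis.
Context {R : realType}.
Implicit Types (x y t : R).

Lemma scale_mulE x y : x *: y = x * y. Proof. by []. Qed.

Lemma ger0_derive_le (f df : R -> R) a b : a <= b ->
  (forall x, a <= x <= b -> is_derive x 1 f (df x)) ->
  (forall x, a < x < b -> 0 <= df x) -> f a <= f b.
Proof.
rewrite le_eqVlt => /predU1P[-> //|ab] fd df0.
have [x xab|x|c cab] := @MVT R f df a b ab.
- by apply: fd; move: xab; rewrite in_itv/= => /andP[/ltW-> /ltW->].
- have : {within `[a, b], continuous f}.
    apply: derivable_within_continuous => z.
    by rewrite in_itv/= => /fd [].
  exact.
move=> e; rewrite -subr_ge0 e mulr_ge0 ?subr_ge0 ?(ltW ab)//.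
by apply: df0; move: cab; rewrite in_itv.
Qed.

(** Concavity through two mean values: below the chord, the slopes would satisfy
    [cos c1 < 2 / pi < cos c2] for some [c1 < c2], whereas [cos] decreases. *)
Lemma sin_ge_jordan x : 0 <= x <= pi / 2 -> 2 / pi * x <= sin x.
Proof.
move=> /andP[x0 xpi]; have pi0 := @pi_gt0 R.
move: x0; rewrite le_eqVlt => /predU1P[<-|x0]; first by rewrite mulr0 sin0.
move: xpi; rewrite le_eqVlt => /predU1P[->|xpi].
  by rewrite sin_pihalf le_eqVlt; apply/orP; left; apply/eqP; field; lra.
rewrite leNgt; apply/negP => lt.
have cs a b : {within `[a, b], continuous (@sin R)}.
  by apply: derivable_within_continuous => z _; exact: derivable_sin.
have [c1] := MVT x0 (fun z _ => is_derive_sin z) (cs _ _).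
rewrite in_itv/= sin0 !subr0 => /andP[c10 c1x] e1.
have [c2] := MVT xpi (fun z _ => is_derive_sin z) (cs _ _).
rewrite in_itv/= sin_pihalf => /andP[xc2 c2p] e2.
have c12 : cos c2 < cos c1.
  by rewrite ltr_cos ?in_itv/=; try (apply/andP; split); lra.
have h1 : cos c1 < 2 / pi by rewrite -(ltr_pM2r x0) -e1.
have h2 : 2 / pi < cos c2.
  rewrite -(@ltr_pM2r _ (pi / 2 - x)) ?subr_gt0// -e2.
  have -> : 2 / pi * (pi / 2 - x) = 1 - 2 / pi * x by field; lra.
  by rewrite ltrD2l ltrN2.
lra.
Qed.

Lemma sin_le_id x : 0 <= x -> sin x <= x.
Proof.
move=> x0.
have := @ger0_derive_le (fun t => t - sin t) (fun t => 1 - cos t) 0 x x0.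
rewrite sin0 !subr0 subr_ge0; by apply.
Qed.

(** This is [sin x <= x] at [pi / 6]. The value [1 / 2] is the positive root of [2 c ^ 2 + c - 1],
    which comes from [cos (pi / 3) = sin (pi / 6)]. *)
Lemma pi_ge3 : 3 <= pi :> R.
Proof.
have pi0 := @pi_gt0 R.
have s6 : sin (pi / 6) = 1 / 2 :> R.
  set c := sin (pi / 6 : R).
  have e1 : cos (pi / 6 *+ 2) = sin (pi / 6) :> R.
    rewrite -cosBpihalf -cosN; congr cos; rewrite mulr2n; lra.
  have e2 : cos (pi / 6 *+ 2) = 1 - 2 * c ^+ 2 :> R.
    rewrite cos_mulr2n cos2sin2 -/c mulr2n; ring.
  have c0 : 0 < c by apply: sin_gt0_pi; apply/andP; split; lra.
  have /eqP : (c + 1) * (2 * c - 1) = 0.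
    have -> : (c + 1) * (2 * c - 1) = c - (1 - 2 * c ^+ 2) by ring.
    by rewrite -e2 e1 subrr.
  rewrite mulf_eq0 => /orP[] /eqP; lra.
have := @sin_le_id (pi / 6); rewrite s6 divr_ge0// ?(ltW pi0)// => /(_ isT); lra.
Qed.

Lemma ln2_sqr_le : ln 2 ^+ 2 <= 1 / 2 :> R.
Proof.
(* [12 / 17] lies just below [1 / sqrt 2], as [2 * 144 < 289], and the quadratic Taylor bound at
   [6 / 17], squared, already exceeds 2. *)
have h : ln 2 <= 12 / 17 :> R.
  rewrite -ler_expR lnK ?posrE//.
  have e : expR (12 / 17) = expR (6 / 17) ^+ 2 :> R.
    by rewrite expr2 -expRD; congr expR; lra.
  have : 1 + (6 / 17) + (6 / 17) ^+2 / 2  <= expR (6 / 17) :> R.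
    pose f (t : R) := expR t - (1 + t + t ^+ 2 / 2).
    suff : 0 <= f (6 / 17) by rewrite /f; lra.
    have -> : 0 = f 0 by rewrite /f expR0 expr0n/=; lra.
    apply: (@ger0_derive_le f (fun t => expR t - (1 + t))); first lra.
      move=> x _; rewrite /f; apply: is_derive_eq.
      by rewrite !scale_mulE; field.
    by move=> x _; rewrite subr_ge0 expR_ge1Dx.
  rewrite e; set z := expR _ => hz.
  have : (1 + 6 / 17 + (6 / 17) ^+ 2 / 2) ^+ 2 <= z ^+ 2.
    by rewrite lerXn2r ?nnegrE ?expR_ge0//; lra.
  lra.
have h0 : 0 <= ln 2 :> R by apply: ln_ge0; lra.
nra.
Qed.

(* [x ln^2 x - 2 x ln x + 2 x] is an antiderivative of [ln^2], which
   decreases on [(0, 1)]; the limit at [0] is avoided by letting the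
   telescoping start at the junk value [ln 0 = 0]. *)
Lemma sum_ln_sqr_le (M : R) (q : nat) : 0 < M -> q%:R <= M ->
  \sum_(1 <= c < q.+1) ln (c%:R / M) ^+ 2 <= 2 * M.
Proof.
move=> M0 qM.
pose F x := x * ln x ^+ 2 - 2 * (x * ln x) + 2 * x.
have Fd x : 0 < x -> is_derive x 1 F (ln x ^+ 2).
  move=> x0; have := is_derive1_ln x0 => dl.
  rewrite /F; apply: is_derive_eq.
  rewrite !scale_mulE; field; lra.
have F0 : F 0 = 0 by rewrite /F ln0// !(mul0r, mulr0, subr0, addr0).
have step x y : 0 < x -> x <= y -> y <= 1 -> (y - x) * ln y ^+ 2 <= F y - F x.
  move=> x0 xy y1.
  have := @ger0_derive_le (fun t => F t - t * ln y ^+ 2)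
    (fun t => ln t ^+ 2 - ln y ^+ 2) x y xy.
  suff -> : ((y - x) * ln y ^+ 2 <= F y - F x) =
    (F x - x * ln y ^+ 2 <= F y - y * ln y ^+ 2).
    apply.
      move=> t /andP[xt _]; have := Fd t (lt_le_trans x0 xt) => dF.
      apply: is_derive_eq; rewrite !scale_mulE; ring.
    move=> t /andP[xt ty]; have t0 := lt_trans x0 xt.
    rewrite subr_ge0 -ler_sqrt; last exact: sqr_ge0.
    rewrite !sqrtr_sqr !ler0_norm; first last.
    - by apply: ln_le0; lra.
    - by apply: ln_le0; lra.
    by rewrite lerN2 ler_ln ?posrE//; lra.
  by apply/idP/idP; rewrite mulrBl; lra.
have Fle2 y : 0 < y -> y <= 1 -> F y <= 2.
  move=> y0 y1; have -> : 2 = F 1 by rewrite /F ln1; lra.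
  apply: (@ger0_derive_le F (fun t => ln t ^+ 2)) => // t; last by rewrite sqr_ge0.
  by move=> /andP[yt _]; apply: Fd; lra.
have H k : (k <= q)%N ->
    \sum_(1 <= c < k.+1) ln (c%:R / M) ^+ 2 <= M * F (k%:R / M).
  elim: k => [_|k IH kq]; first by rewrite big_geq// mul0r F0 mulr0.
  have k1M : k.+1%:R / M <= 1.
    by rewrite ler_pdivrMr// mul1r (le_trans _ qM)// ler_nat.
  have k0 : 0 < k.+1%:R / M by rewrite divr_gt0// ltr0n.
  rewrite big_nat_recr//=; apply: le_trans (lerD (IH (ltnW kq)) (lexx _)) _.
  suff : ln (k.+1%:R / M) ^+ 2 <= M * (F (k.+1%:R / M) - F (k%:R / M)).
    by rewrite mulrBr; lra.
  case: k k1M k0 {IH kq} => [|k] k1M k0.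
    rewrite mul0r F0 subr0; set y := 1 / M in k1M k0 *.
    have -> : ln y ^+ 2 = M * (y * ln y ^+ 2).
      by rewrite mulrA /y [M * _]mulrC div1r mulVf ?mul1r// gt_eqF.
    rewrite ler_pM2l//.
    have := ln_le0 k1M; rewrite /F => l0.
    by have := mulr_ge0 (ltW k0) (_ : 0 <= - ln y); rewrite oppr_ge0 l0 => /(_ isT); lra.
  have := step (k.+1%:R / M) (k.+2%:R / M).
  have -> : k.+2%:R / M - k.+1%:R / M = M^-1.
    by rewrite -mulrBl -natrB// subSnn mul1r.
  move=> /(_ _ _ k1M) st; rewrite -ler_pdivrMl//; apply: st.
    by rewrite divr_gt0// ltr0n.
  by rewrite ler_pM2r ?invr_gt0// ler_nat.
apply: le_trans (H q (leqnn q)) _; rewrite [2 * M]mulrC ler_pM2l//.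
case: q qM {H} => [|q] qM; first by rewrite mul0r F0.
by apply: Fle2; [rewrite divr_gt0// ltr0n|rewrite ler_pdivrMr// mul1r].
Qed.

(* With [x = c / m], [2 sin (pi x) >= 4 min (x, 1 - x)], so that
   [ln^2 (2 sin (pi x))] is at most [ln^2 2], or [ln^2 (4 x)] when [4 x < 1]
   or [ln^2 (4 (1 - x))] when [4 (1 - x) < 1]. *)
Lemma sum_ln_sin_sqr_le (m : nat) : (0 < m)%N ->
  \sum_(1 <= c < m) ln (2 * sin (pi * (c%:R / m%:R))) ^+ 2 <= 3 / 2 * m%:R :> R.
Proof.
move=> m0; have m0' : 0 < m%:R :> R by rewrite ltr0n.
have pi0 := @pi_gt0 R.
pose A (c : nat) : R := if (4 * c < m)%N then ln (c%:R / (m%:R / 4)) ^+ 2 else 0.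
have A0 c : 0 <= A c by rewrite /A; case: ifP => // _; exact: sqr_ge0.
have half c : (0 < c)%N -> (2 * c <= m)%N ->
    ln (2 * sin (pi * (c%:R / m%:R))) ^+ 2 <= A c + 1 / 2 :> R.
  move=> c0 cm; set x : R := c%:R / m%:R.
  have x0 : 0 < x by rewrite divr_gt0// ltr0n.
  have x2 : x <= 1 / 2.
    by rewrite /x ler_pdivrMr// div1r ler_pdivlMl// -natrM ler_nat.
  have s4 : 4 * x <= 2 * sin (pi * x).
    have := @sin_ge_jordan (pi * x).
    have -> : 2 / pi * (pi * x) = 2 * x by field; lra.
    have -> : 0 <= pi * x <= pi / 2 by apply/andP; split; nra.
    by move=> /(_ isT); lra.
  have s2 : 2 * sin (pi * x) <= 2 by have := sin_le1 (pi * x); lra.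
  set y := 2 * _ in s4 s2 *; have y0 : 0 < y by lra.
  have [y1|y1] := leP 1 y.
    suff : ln y ^+ 2 <= ln 2 ^+ 2 by have := ln2_sqr_le; have := A0 c; lra.
    rewrite ler_sqr ?nnegrE; [|exact: ln_ge0|by apply: ln_ge0; lra].
    by rewrite ler_ln ?posrE.
  have cm4 : (4 * c < m)%N.
    rewrite -(ltr_nat R) natrM; move: (le_lt_trans s4 y1).
    by rewrite /x mulrA ltr_pdivrMr// mul1r.
  rewrite /A cm4; apply: (@le_trans _ _ (ln (c%:R / (m%:R / 4)) ^+ 2)); last lra.
  have -> : c%:R / (m%:R / 4) = 4 * x :> R by rewrite /x; field; lra.
  rewrite -ler_sqrt ?sqr_ge0// !sqrtr_sqr !ler0_norm; first last.
  - by apply: ln_le0; lra.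
  - by apply: ln_le0; lra.
  by rewrite lerN2 ler_ln ?posrE//; lra.
have tm c : (0 < c < m)%N ->
    ln (2 * sin (pi * (c%:R / m%:R))) ^+ 2 <= A c + A (m - c)%N + 1 / 2 :> R.
  move=> /andP[c0 cm]; have [h|h] := leqP (2 * c) m.
    by have := half c c0 h; have := A0 (m - c)%N; lra.
  have -> : sin (pi * (c%:R / m%:R)) = sin (pi * ((m - c)%:R / m%:R)) :> R.
    rewrite natrB ?(ltnW cm)// mulrBl divff ?gt_eqF// mulrBr mulr1.
    by rewrite sinB sinpi cospi; ring.
  by have := half (m - c)%N; have := A0 c; lia || (have -> : (2 * (m - c) <= m)%N by lia);
     rewrite subn_gt0 cm => + /(_ isT isT); lra.
rewrite big_nat; apply: le_trans (ler_sum _ tm) _; rewrite -big_nat.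
(* [A] is supported on [4 c < m], so [sum_ln_sqr_le] with [M = m / 4] gives [m / 2]. The two copies
   of [A] and the constants [1 / 2] make up [3 m / 2]. *)
have SA : \sum_(1 <= c < m) A c <= m%:R / 2.
  pose q := (m.-1 %/ 4)%N.
  have -> : \sum_(1 <= c < m) A c = \sum_(1 <= c < q.+1) ln (c%:R / (m%:R / 4)) ^+ 2.
    rewrite (@big_cat_nat _ _ _ q.+1)//=; last by rewrite /q; lia.
    rewrite [X in _ + X]big1_seq ?addr0; last first.
      move=> c; rewrite mem_index_iota => /andP[_ h]; rewrite /A ifF//.
      by apply/negbTE; move: h; rewrite /q; lia.
    apply: eq_big_nat => c h; rewrite /A ifT//.
    by move: h; rewrite /q; lia.
  have := @sum_ln_sqr_le (m%:R / 4) q.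
  have -> : 0 < m%:R / 4 :> R by rewrite divr_gt0.
  have -> : q%:R <= m%:R / 4 :> R.
    by rewrite ler_pdivlMr// -natrM ler_nat /q; lia.
  by move=> /(_ isT isT); lra.
rewrite !big_split/= sumr_const_nat.
have -> : \sum_(1 <= i < m) A (m - i)%N = \sum_(1 <= c < m) A c.
  by rewrite [RHS]big_nat_rev/=; apply: eq_bigr => i _; rewrite addnC addn1 subSS.
have : (1 / 2 : R) *+ (m - 1) <= m%:R / 2.
  rewrite -[_ *+ _]mulr_natr mulrC mul1r ler_pM2r// ler_nat; lia.
lra.
Qed.

End RealAnalysis.

(** * Rounding in a lattice *)

Section Rounding.
Context {R : realType} {m : nat}.
Implicit Types (x y b : 'rV[R]_m) (L : set 'rV[R]_m).

Definition sqnorm x : R := \sum_j x ord0 j ^+ 2.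

Lemma sqnorm_ge0 x : 0 <= sqnorm x.
Proof. by apply: sumr_ge0 => j _; exact: sqr_ge0. Qed.

Lemma sqnormDZ x b t :
  sqnorm (x + t *: b) =
  sqnorm x + 2 * t * (\sum_j x ord0 j * b ord0 j) + t ^+ 2 * sqnorm b.
Proof.
rewrite /sqnorm !mulr_sumr -!big_split/=; apply: eq_bigr => j _.
by rewrite !mxE; ring.
Qed.

Lemma sqnormB_le x y : sqnorm (x - y) <= 2 * sqnorm x + 2 * sqnorm y.
Proof.
rewrite /sqnorm !mulr_sumr -!big_split/=; apply: ler_sum => j _.
by rewrite !mxE; have := sqr_ge0 (x ord0 j + y ord0 j); nra.
Qed.

(* Rounding [c] down or up with probabilities [1 - frac c] and [frac c] adds
   on average [frac c * (1 - frac c) * sqnorm b] to the squared norm of [y]. *)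
Lemma round_one y b (c : R) :
  exists z : int, sqnorm (y + (c - z%:~R) *: b) <= sqnorm y + 4^-1 * sqnorm b.
Proof.
set z := Num.floor c; set t := c - z%:~R.
have t0 : 0 <= t by rewrite subr_ge0 floor_le_tmp.
have t1 : t <= 1 by have := floorD1_gt c; rewrite /t intrD => /ltW; lra.
have [h|h] := leP (sqnorm (y + t *: b)) (sqnorm y + 4^-1 * sqnorm b).
  by exists z.
exists (z + 1); have -> : c - (z + 1)%:~R = t - 1 by rewrite intrD /t; ring.
move: h; rewrite !sqnormDZ; set p := \sum__ _; set B := sqnorm b => h.
have B0 : 0 <= B := sqnorm_ge0 b.
rewrite leNgt; apply/negP => h2.
have {}h : 0 < 2 * t * p + t ^+ 2 * B - 4^-1 * B by lra.
have {}h2 : 0 < 2 * (t - 1) * p + (t - 1) ^+ 2 * B - 4^-1 * B by lra.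
(* Weighting the two excesses by [1 - t] and [t] cancels [p] and leaves [- (t - 1 / 2) ^ 2 * B]. *)
have hm1 : 0 <= (1 - t) * (2 * t * p + t ^+ 2 * B - 4^-1 * B).
  by rewrite mulr_ge0 ?(ltW h)//; lra.
have hB : 0 <= (t - 1 / 2) ^+ 2 * B by rewrite mulr_ge0// sqr_ge0.
move: t0; rewrite le_eqVlt => /predU1P[t0|t0]; first by move: h; rewrite -t0; lra.
have := mulr_gt0 t0 h2; nra.
Qed.

Lemma lattice_rounding L : L 0 -> (forall x y, L x -> L y -> L (x - y)) ->
  forall k (c : 'I_k -> R) (b : 'I_k -> 'rV[R]_m), (forall i, L (b i)) ->
  exists2 v, L v &
    sqnorm (\sum_i c i *: b i - v) <= 4^-1 * \sum_i sqnorm (b i).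
Proof.
move=> L0 LB.
have LN x : L x -> L (- x) by move=> Lx; rewrite -sub0r; exact: LB.
have LD x y : L x -> L y -> L (x + y).
  by move=> Lx Ly; rewrite -[y]opprK; apply: LB => //; exact: LN.
have Lz x (z : int) : L x -> L (z%:~R *: x).
  move=> Lx; rewrite scaler_int.
  have Ln k : L (x *+ k) by elim: k => [|k IH]; rewrite ?mulr0n// mulrS; exact: LD.
  by case: z => k; [exact: Ln|rewrite NegzE mulrNz; exact/LN/Ln].
(* The offset [y] carries what is already rounded: each step moves one rounded term into it, and the
   bounds of [round_one] add up. *)
suff H k (c : 'I_k -> R) (b : 'I_k -> 'rV[R]_m) y : (forall i, L (b i)) ->
    exists2 v, L v &
    sqnorm (y + \sum_i c i *: b i - v) <= sqnorm y + 4^-1 * \sum_i sqnorm (b i).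
  move=> k c b Lb; have [v Lv] := H k c b 0 Lb.
  rewrite add0r; have -> : sqnorm 0 = 0.
    by rewrite /sqnorm big1// => j _; rewrite mxE expr0n.
  by rewrite add0r => h; exists v.
elim: k c b y => [|k IH] c b y Lb.
  by exists 0 => //; rewrite !big_ord0 mulr0 !addr0 subr0.
have [z hz] := round_one y (b ord0) (c ord0).
have [v Lv hv] := IH (c \o lift ord0) (b \o lift ord0)
  (y + (c ord0 - z%:~R) *: b ord0) (fun i => Lb _).
exists (v + z%:~R *: b ord0); first by apply: LD => //; exact: Lz.
rewrite !big_ord_recl mulrDr addrA; apply: le_trans (le_trans hv _); last first.
  by rewrite addrA lerD2r.
rewrite le_eqVlt; apply/orP; left; apply/eqP; congr sqnorm.
rewrite scalerBl opprD /= !addrA; set S := \sum__ _.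
by rewrite addrAC; congr (_ - _); rewrite addrAC.
Qed.
End Rounding.

(** * An upper bound for Euler's totient *)

Section TotientBound.
Context {R : realType}.

Lemma powR_ge1 (a x : R) : 1 <= a -> 0 <= x -> 1 <= a `^ x.
Proof. by move=> a1 x0; rewrite -(powRr0 a) ler_powR. Qed.

Lemma totient_primes_prod (n : nat) : (0 < n)%N ->
  (totient n)%:R = n%:R * \prod_(p <- primes n) (1 - p%:R^-1) :> R.
Proof.
move=> n0; have nE : n%:R = \prod_(p <- primes n) (p ^ logn p n)%:R :> R.
  by rewrite -natr_prod {1}(prod_prime_decomp n0) prime_decompE big_map.
rewrite totientE// nE natr_prod -big_split/= big_seq [RHS]big_seq; apply: eq_bigr => p pn.
have p0 : (0 < p)%N by move: pn; rewrite mem_primes => /and3P[/prime_gt0].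
have : (0 < logn p n)%N by rewrite logn_gt0.
case: (logn p n) => // e _; rewrite /= natrM expnS natrM mulrBr mulr1.
rewrite -[p in RHS](prednK p0) -natr1; set q := (p.-1)%:R.
have q1 : q + 1 != 0 :> R by rewrite natr1 pnatr_eq0.
rewrite (prednK p0); field; exact: q1.
Qed.

(** AM-GM is used twice: on the [1 - 1 / p], to bound their product by [(1 - mu) ^ s], and on the
    [1 / p], to bound their mean [mu] below by [n ^ (- 1 / s)], the radical of [n] being at most
    [n]. *)
Lemma totient_le_AGM (n : nat) (s := size (primes n)) : (1 < n)%N ->
  (totient n)%:R <= n%:R * (1 - (n%:R `^ (s%:R^-1))^-1) ^+ s :> R.
Proof.
move=> n1; have n0 : (0 < n)%N by exact: ltnW.
have nR0 : 0 < n%:R :> R by rewrite ltr0n.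
have s0 : (0 < s)%N.
  rewrite /s -has_predT; apply/hasP; exists (pdiv n) => //.
  by rewrite mem_primes pdiv_prime// n0 pdiv_dvd.
have sR0 : 0 < s%:R :> R by rewrite ltr0n.
rewrite totient_primes_prod// ler_pM2l//.
pose P (i : 'I_s) : nat := nth 0%N (primes n) i.
have Pp i : prime (P i).
  by have := mem_nth 0%N (ltn_ord i); rewrite -/(P i) mem_primes => /and3P[].
have P0 i : 0 < (P i)%:R^-1 :> R by rewrite invr_gt0 ltr0n prime_gt0.
have P1 i : (P i)%:R^-1 <= 1 :> R.
  by rewrite invf_le1 ?ltr0n ?prime_gt0// ler1n prime_gt0.
rewrite (big_nth 0%N) big_mkord -/s.
pose mu : R := (\sum_(i < s) (P i)%:R^-1) / s%:R.
have h1 : \prod_(i < s) (1 - (P i)%:R^-1) <= (1 - mu) ^+ s :> R.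
  have [] := @leif_AGM R 'I_s (mem 'I_s) (fun i => 1 - (P i)%:R^-1).
    by move=> i _; rewrite subr_ge0.
  by move=> + _; rewrite card_ord sumrB sumr_const card_ord mulrBl divff ?gt_eqF.
have h2 : \prod_(i < s) (P i)%:R^-1 <= mu ^+ s :> R.
  have [] := @leif_AGM R 'I_s (mem 'I_s) (fun i => (P i)%:R^-1).
    by move=> i _; exact: ltW.
  by move=> + _; rewrite card_ord.
have h3 : n%:R^-1 <= \prod_(i < s) (P i)%:R^-1 :> R.
  rewrite prodfV lef_pV2 ?posrE//; last by apply: prodr_gt0 => i _; rewrite ltr0n prime_gt0.
  rewrite -natr_prod ler_nat /P -(big_mkord xpredT (fun i => nth 0%N (primes n) i)).
  rewrite -(big_nth 0%N xpredT id) [X in (_ <= X)%N](prod_prime_decomp n0).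
  rewrite prime_decompE big_map/= big_seq [X in (_ <= X)%N]big_seq.
  apply: leq_prod => p pn; rewrite -[X in (X <= _)%N]expn1 leq_pexp2l//.
    by move: pn; rewrite mem_primes => /and3P[/prime_gt0].
  by rewrite logn_gt0.
have mu0 : 0 <= mu by rewrite divr_ge0// ?ler0n// sumr_ge0// => i _; exact: ltW.
have mu1 : mu <= 1.
  rewrite ler_pdivrMr// mul1r -[X in _ <= X%:R]card_ord -sumr_const ler_sum//.
apply: le_trans h1 _; rewrite lerXn2r ?nnegrE ?subr_ge0//.
  by rewrite invf_le1 ?powR_gt0// powR_ge1 ?ler1n ?invr_ge0.
rewrite lerD2l lerN2 -powRN.
have -> : n%:R `^ (- s%:R^-1) = n%:R^-1 `^ (s%:R^-1) :> R.
  by rewrite -(@powR_inv1 _ n%:R) ?ler0n// -powRrM mulN1r.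
have -> : mu = (mu ^+ s) `^ (s%:R^-1).
  by rewrite -powR_mulrn// -powRrM divff ?gt_eqF// powRr1.
by rewrite ge0_ler_powR ?nnegrE ?invr_ge0 ?ler0n ?exprn_ge0// (le_trans h3).
Qed.

Lemma sqrt_totient_le (n : nat) (s := size (primes n)) : (1 < n)%N ->
  Num.sqrt ((totient n)%:R / 2) <=
  Num.sqrt (n%:R / 2) * (1 - (n%:R `^ (s%:R^-1))^-1) `^ (s%:R / 2) :> R.
Proof.
move=> n1; have := totient_le_AGM n1; rewrite -/s; set a := 1 - _ => h.
have a0 : 0 <= a.
  rewrite subr_ge0 invf_le1 ?powR_gt0 ?ltr0n ?(ltnW n1)//.
  by rewrite powR_ge1 ?ler1n ?(ltnW n1) ?invr_ge0.
have -> : a `^ (s%:R / 2) = Num.sqrt (a ^+ s).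
  by rewrite powRrM powR_mulrn// powR12_sqrt// exprn_ge0.
rewrite -sqrtrM ?divr_ge0 ?ler0n// ler_wsqrtr//.
by rewrite mulrAC ler_pM2r ?invr_gt0.
Qed.
End TotientBound.

(** * Dirichlet characters and their L-values at 1 *)

Section ComplexNorm.
Context {R : realType}.
Implicit Types (z : R[i]) (x : R).
Local Open Scope complex_scope.
Local Notation nc := (@Normc.normc R).

Lemma normr_normc z : `|z| = (nc z)%:C. Proof. by []. Qed.

Lemma nc_ge0 z : 0 <= nc z.
Proof. by case: z => a b; exact: sqrtr_ge0. Qed.

Lemma nc0 : nc 0 = 0. Proof. exact: Normc.normc0. Qed.
Lemma nc1 : nc 1 = 1. Proof. exact: Normc.normc1. Qed.

Lemma ncD z1 z2 : nc (z1 + z2) <= nc z1 + nc z2.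
Proof. exact: le_normcD. Qed.

Lemma ncN z : nc (- z) = nc z. Proof. exact: normcN. Qed.

Lemma ncB z1 z2 : nc (z1 - z2) <= nc z1 + nc z2.
Proof. by rewrite -(ncN z2); exact: ncD. Qed.

Lemma ncBC z1 z2 : nc (z1 - z2) = nc (z2 - z1).
Proof. by rewrite -ncN opprB. Qed.

Lemma ncM z1 z2 : nc (z1 * z2) = nc z1 * nc z2.
Proof. exact: Normc.normcM. Qed.

Lemma ncX z k : nc (z ^+ k) = nc z ^+ k.
Proof. by elim: k => [|k IH]; rewrite ?expr0 ?nc1// !exprS ncM IH. Qed.

Lemma nc_real x : nc x%:C = `|x|.
Proof. by rewrite /= expr0n/= addr0 sqrtr_sqr. Qed.

Lemma nc_real_ge0 x : 0 <= x -> nc x%:C = x.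
Proof. by move=> x0; rewrite nc_real ger0_norm. Qed.

Lemma nc_eq0 z : (nc z == 0) = (z == 0).
Proof.
apply/eqP/eqP => [|->]; last exact: nc0.
exact: (@Normc.eq0_normc R).
Qed.

Lemma nc_sum (I : Type) (r : seq I) (P : pred I) (F : I -> R[i]) :
  nc (\sum_(i <- r | P i) F i) <= \sum_(i <- r | P i) nc (F i).
Proof.
elim/big_rec2 : _ => [|i x z _ h]; first by rewrite nc0.
by apply: le_trans (ncD _ _) _; rewrite lerD2l.
Qed.

Lemma nc_prod (I : Type) (r : seq I) (P : pred I) (F : I -> R[i]) :
  nc (\prod_(i <- r | P i) F i) = \prod_(i <- r | P i) nc (F i).
Proof. by apply: (big_morph nc ncM nc1). Qed.

Lemma nc_triangle_le z1 z2 : nc z1 - nc z2 <= nc (z1 - z2).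
Proof. by rewrite lerBlDr -{1}(subrK z2 z1) ncD. Qed.

Lemma nc_sqr z : nc z ^+ 2 = complex.Re z ^+ 2 + complex.Im z ^+ 2.
Proof. by case: z => a b; rewrite /= sqr_sqrtr// addr_ge0 ?sqr_ge0. Qed.

Lemma normr_Re_le z : `|complex.Re z| <= nc z.
Proof. by case: z => a b; rewrite /= -sqrtr_sqr ler_wsqrtr// lerDl sqr_ge0. Qed.

Lemma abel_sumE (u : nat -> R[i]) (g : nat -> R) k :
  \sum_(m < k) u m * (g m)%:C =
  (\sum_(m < k) u m) * (g k)%:C +
  \sum_(m < k) (\sum_(i < m.+1) u i) * (g m - g m.+1)%:C.
Proof.
elim: k => [|k IH]; first by rewrite !big_ord0 mul0r addr0.
rewrite !(big_ord_recr k)/= IH rmorphB /=; ring.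
Qed.

(** The decrements of [g] telescope to [g 0]. It is applied to the values of a nontrivial character,
    whose partial sums are bounded by the modulus. *)
Lemma abel_sum_le (u : nat -> R[i]) (g : nat -> R) (B : R) (N : nat) :
  (forall k, nc (\sum_(m < k) u m) <= B) ->
  (forall m, 0 <= g m) -> (forall m, g m.+1 <= g m) ->
  nc (\sum_(m < N) u m * (g m)%:C) <= B * g 0%N.
Proof.
move=> uB g0 gd; have B0 : 0 <= B by apply: le_trans (uB 0%N); exact: nc_ge0.
rewrite abel_sumE; apply: le_trans (ncD _ _) _.
have -> : B * g 0%N = B * g N + \sum_(m < N) B * (g m - g m.+1).
  elim: N => [|k IH]; first by rewrite big_ord0 addr0.
  by rewrite big_ord_recr/= IH; ring.
apply: lerD; first by rewrite ncM nc_real_ge0// ler_wpM2r.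
apply: le_trans (nc_sum _ _ _) _; apply: ler_sum => m _.
by rewrite ncM nc_real_ge0 ?subr_ge0// ler_wpM2r ?subr_ge0.
Qed.

End ComplexNorm.

Section DirichletCharacters.
Context {R : realType}.
Local Open Scope complex_scope.
Local Notation nc := (@Normc.normc R).

(** Characters are extended by zero to all of [nat], so that their series are plain sums over
    integers. *)
Definition dirichlet_char (n : nat) (X : nat -> R[i]) : Prop :=
  [/\ X 1%N = 1, forall a b, X (a * b)%N = X a * X b,
      forall a, X (a + n)%N = X a & forall a, ~~ coprime a n -> X a = 0].

(* For a nontrivial character this says that [L(1, X) = 0]. *)
Definition vanishing_L1 (X : nat -> R[i]) : Prop :=
  exists D : R, forall N : nat,
    nc (\sum_(m < N) X m.+1 * (m.+1%:R^-1)%:C) <= D / N.+1%:R.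

Lemma principal_dirichlet_char n : (1 < n)%N ->
  dirichlet_char n (fun a => (coprime a n)%:R).
Proof.
move=> n1; split=> //= [|a b|a|a].
- by rewrite coprime1n.
- by rewrite coprimeMl; case: (coprime a n); case: (coprime b n); rewrite ?mulr1 ?mulr0 ?mul0r.
- by rewrite /coprime gcdnC gcdnDr gcdnC.
- by move=> /negbTE->.
Qed.

Section OneCharacter.
Variables (n : nat) (X : nat -> R[i]).
Hypotheses (n1 : (1 < n)%N) (XD : dirichlet_char n X).

Let X1 : X 1%N = 1. Proof. by case: XD. Qed.
Let XM a b : X (a * b)%N = X a * X b. Proof. by case: XD. Qed.
Let XDn a : X (a + n)%N = X a. Proof. by case: XD. Qed.
Let Xnc a : ~~ coprime a n -> X a = 0. Proof. by case: XD => _ _ _; exact. Qed.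

Lemma dchar_exp a k : X (a ^ k)%N = X a ^+ k.
Proof. by elim: k => [|k IH]; rewrite ?expn0 ?expr0// expnS exprS XM IH. Qed.

Lemma dchar_mod a : X (a %% n)%N = X a.
Proof.
rewrite [in RHS](divn_eq a n); elim: (a %/ n)%N => [|q IH].
  by rewrite mul0n.
by rewrite mulSn -addnA addnC XDn.
Qed.

Lemma dchar_eqmod a b : a = b %[mod n] -> X a = X b.
Proof. by rewrite -(dchar_mod a) -(dchar_mod b) => ->. Qed.

Lemma dchar0 : X 0%N = 0.
Proof. by apply: Xnc; rewrite /coprime gcd0n; case: n n1 => [|[]]. Qed.

Lemma dchar_root a : coprime a n -> X a ^+ totient n = 1.
Proof.
move=> an; rewrite -dchar_exp -X1; apply: dchar_eqmod.
exact: Euler_exp_totient.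
Qed.

Lemma nc_dchar a : coprime a n -> nc (X a) = 1.
Proof.
move=> an; apply/eqP; rewrite -(@pexpr_eq1 _ _ (totient n)) ?nc_ge0//.
  by rewrite -ncX dchar_root// nc1.
by rewrite totient_gt0 ltnW.
Qed.

Lemma nc_dchar_le1 a : nc (X a) <= 1.
Proof.
by have [/nc_dchar->//|/Xnc->] := boolP (coprime a n); rewrite nc0.
Qed.

Lemma sqr_dirichlet_char : dirichlet_char n (fun a => X a ^+ 2).
Proof.
split=> [|a b|a|a /Xnc->]; first by rewrite X1 expr1n.
- by rewrite XM exprMn.
- by rewrite XDn.
- by rewrite expr0n.
Qed.

Hypothesis Xnt : exists2 a, coprime a n & X a != 1.

Lemma dchar_sum_period : \sum_(m < n) X m = 0.
Proof.
have [a an Xa] := Xnt; have n0 : (0 < n)%N by exact: ltnW.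
pose f (m : 'I_n) : 'I_n := Ordinal (ltn_pmod (a * m) n0).
have fI : injective f.
  move=> i j /(congr1 val)/= /eqP h; apply/val_inj => /=.
  wlog ij : i j h / (i <= j)%N.
    move=> H; have [|/ltnW] := leqP i j; first exact: H.
    by move=> ji; apply/esym/H => //; rewrite eq_sym.
  move: h; rewrite eq_sym eqn_mod_dvd ?leq_mul2l ?ij ?orbT// -mulnBr.
  rewrite Gauss_dvdr; last by rewrite coprime_sym.
  have [|/dvdn_leq h /h] := posnP (j - i); first by move: ij; lia.
  by have := ltn_ord j; lia.
have /eqP : \sum_(m < n) X m = X a * \sum_(m < n) X m.
  rewrite {1}(reindex_inj fI) mulr_sumr; apply: eq_bigr => i _.
  by rewrite /= dchar_mod XM.
rewrite -subr_eq0 -{1}[\sum__ _]mul1r -mulrBl mulf_eq0 subr_eq0 eq_sym (negbTE Xa).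
by move=> /eqP.
Qed.

Lemma dchar_sum_le k : nc (\sum_(m < k) X m) <= n%:R.
Proof.
have P q r : \sum_(m < q * n + r) X m = \sum_(m < r) X m.
  elim: q => [|q IH] //.
  rewrite mulSn -addnA big_split_ord/= dchar_sum_period add0r -IH.
  by apply: eq_bigr => i _; rewrite addnC XDn.
rewrite (divn_eq k n) P; apply: le_trans (nc_sum _ _ _) _.
apply: (@le_trans _ _ (\sum_(i < k %% n) 1)).
  by apply: ler_sum => i _; exact: nc_dchar_le1.
by rewrite sumr_const card_ord ler_nat ltnW// ltn_pmod// ltnW.
Qed.

Lemma dchar_sumS_le k : nc (\sum_(m < k) X m.+1) <= n%:R.
Proof.
have := dchar_sum_le k.+1; rewrite big_ord_recl dchar0 add0r.
by congr (nc _ <= _); apply: eq_bigr => i _.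
Qed.

End OneCharacter.
End DirichletCharacters.

(** * Powers [m ^ (- 1 - e)] and their tails *)

Section PowerSums.
Context {R : realType}.
Implicit Types (e x : R) (m N : nat).

Lemma ln_shift_ge (a : R) : 0 < a -> (a + 1)^-1 <= ln (1 + a^-1).
Proof.
move=> a0; have a1 : 0 < a + 1 by lra.
have -> : 1 + a^-1 = (1 + - (a + 1)^-1)^-1 by field; do ?split; lra.
have h : -1 < - (a + 1)^-1 by rewrite ltrN2 invf_lt1//; lra.
rewrite lnV ?posrE; last by rewrite -subr_gt0 in h; lra.
by rewrite lerNr; exact: le_ln1Dx.
Qed.

Lemma powR_shift e (a : R) : 0 < a ->
  a `^ (- e) = (a + 1) `^ (- e) * expR (e * ln (1 + a^-1)).
Proof.
move=> a0; have a1 : 0 < a + 1 by lra.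
rewrite /powR !gt_eqF// -expRD; congr expR.
have -> : 1 + a^-1 = (a + 1) / a by field; lra.
rewrite ln_div ?posrE//; ring.
Qed.

(** Comparison of [x ^ (- 1 - e)] with its integral in telescoping form; summed up, it bounds the
    tails in [wt_tail]. *)
Lemma powRN_diff_ge e (a : R) : 0 < e -> 0 < a ->
  e * (a + 1) `^ (- (1 + e)) <= a `^ (- e) - (a + 1) `^ (- e).
Proof.
move=> e0 a0; have a1 : 0 < a + 1 by lra.
rewrite opprD powRD; last by rewrite (gt_eqF a1) implybT.
rewrite powR_inv1 ?(ltW a1)// (powR_shift e a0).
have q0 := powR_gt0 (- e) a1; set q := (a + 1) `^ (- e) in q0 *.
have h1 := expR_ge1Dx (e * ln (1 + a^-1)).
have h2 : e * (a + 1)^-1 <= e * ln (1 + a^-1) by rewrite ler_pM2l// ln_shift_ge.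
have : q * (e * (a + 1)^-1) <= q * (expR (e * ln (1 + a^-1)) - 1).
  by rewrite ler_pM2l//; lra.
by lra.
Qed.

Lemma powRN_diff_le e (a : R) : 0 < e -> 1 <= a ->
  a `^ (- e) - (a + 1) `^ (- e) <= e / a.
Proof.
move=> e0 a1; have a0 : 0 < a by lra.
have b0 : 0 < a + 1 by lra.
have E : (a + 1) `^ (- e) = a `^ (- e) * expR (- (e * ln (1 + a^-1))).
  rewrite (powR_shift e a0) -mulrA -expRD subrr expR0 mulr1//.
have q0 : 0 <= a `^ (- e) by exact: powR_ge0.
have q1 : a `^ (- e) <= 1 by rewrite -(powRr0 a) ler_powR//; lra.
rewrite E; set q := a `^ (- e) in q0 q1 *.
have h1 := expR_ge1Dx (- (e * ln (1 + a^-1))).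
have h2 : e * ln (1 + a^-1) <= e / a.
  by rewrite ler_pM2l// le_ln1Dx// (lt_trans (ltrN10 _))// invr_gt0.
have h3 : 0 <= 1 - expR (- (e * ln (1 + a^-1))).
  rewrite subr_ge0 expR_le1 oppr_le0 mulr_ge0 ?(ltW e0)// ln_ge0//.
  by rewrite lerDl invr_ge0 ltW.
by nra.
Qed.

(** Weights of a Dirichlet series at [1 + e]: to the right of 1 the series converge absolutely and
    can be sieved. *)
Definition wt e m : R := m%:R `^ (- (1 + e)).

Lemma wt_ge0 e m : 0 <= wt e m. Proof. exact: powR_ge0. Qed.

Lemma wt1 e : wt e 1 = 1. Proof. by rewrite /wt powR1. Qed.

Lemma wtM e a b : wt e (a * b) = wt e a * wt e b.
Proof. by rewrite /wt natrM powRM ?ler0n. Qed.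

Lemma wt_le_inv e m : 0 <= e -> (0 < m)%N -> wt e m <= m%:R^-1.
Proof.
move=> e0 m0; rewrite /wt -powR_inv1 ?ler0n// ler_powR ?ler1n//; lra.
Qed.

Lemma wt_split e m : (0 < m)%N -> wt e m = m%:R^-1 * m%:R `^ (- e).
Proof.
move=> m0; rewrite /wt opprD powRD ?powR_inv1 ?ler0n//.
by rewrite pnatr_eq0 -lt0n m0 implybT.
Qed.

Lemma wt_anti e m : 0 <= e -> (0 < m)%N -> wt e m.+1 <= wt e m.
Proof.
move=> e0 m0; rewrite /wt !powRN lef_pV2 ?posrE ?powR_gt0 ?ltr0n//.
by rewrite ge0_ler_powR ?nnegrE ?ler0n ?ler_nat//; lra.
Qed.

Lemma wt_tail e M N : 0 < e -> (0 < M)%N ->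
  \sum_(M.+1 <= m < N.+1) wt e m <= M%:R `^ (- e) / e.
Proof.
move=> e0 M0; have [NM|MN] := leqP N M.
  by rewrite big_geq// divr_ge0 ?powR_ge0 ?ltW.
apply: (@le_trans _ _ ((M%:R `^ (- e) - N%:R `^ (- e)) / e)); last first.
  by rewrite ler_pM2r ?invr_gt0// lerBlDr lerDl powR_ge0.
rewrite ler_pdivlMr//.
elim: N MN => // N IH; rewrite ltnS leq_eqVlt => /predU1P[<-|MN].
  rewrite big_nat1 -[M.+1]addn1 /wt natrD mulrC.
  by apply: powRN_diff_ge; rewrite ?ltr0n.
rewrite big_nat_recr/=; last by lia.
rewrite mulrDl; apply: le_trans (lerD (IH MN) (lexx _)) _.
have := @powRN_diff_ge e N%:R e0; rewrite ltr0n (leq_trans _ MN)// => /(_ isT).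
by rewrite natr1 -/(wt e N.+1); lra.
Qed.

Lemma wt_sum_le e N : 0 < e -> \sum_(1 <= m < N.+1) wt e m <= 1 + e^-1.
Proof.
move=> e0; case: N => [|N].
  by rewrite big_geq// addr_ge0// invr_ge0 ltW.
rewrite big_ltn// wt1 lerD2l; apply: le_trans (wt_tail _ e0 _) _ => //.
by rewrite powR1 mul1r.
Qed.

Lemma powRN_small e (d : R) : 0 < e -> 0 < d ->
  exists2 M : nat, (0 < M)%N & forall k, (M <= k)%N -> k%:R `^ (- e) / e <= d.
Proof.
move=> e0 d0; pose c := (d * e)^-1 `^ e^-1.
have c0 : 0 <= c by exact: powR_ge0.
exists (Num.trunc c).+1 => // k Mk.
have ck : c <= k%:R.
  apply: ltW; apply: lt_le_trans (_ : (Num.trunc c).+1%:R <= _); last by rewrite ler_nat.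
  by have /andP[_] := truncn_itv c0.
have de0 : 0 < d * e by rewrite mulr_gt0.
rewrite ler_pdivrMr// powRN -[d * e]invrK lef_pV2 ?posrE ?invr_gt0//; last first.
  by rewrite powR_gt0// ltr0n (leq_trans _ Mk).
have -> : (d * e)^-1 = c `^ e.
  by rewrite /c -powRrM mulVf ?gt_eqF// powRr1// invr_ge0 ltW.
by rewrite ge0_ler_powR ?nnegrE ?ler0n// ltW.
Qed.

Lemma sum_inv_sqr_le N : \sum_(1 <= m < N.+1) m%:R^-1 ^+ 2 <= 2 :> R.
Proof.
have H : \sum_(1 <= m < N.+2) m%:R^-1 ^+ 2 <= 2 - N.+1%:R^-1 :> R.
  elim: N => [|N IH]; first by rewrite big_nat1 invr1 expr1n; lra.
  rewrite big_nat_recr//=; apply: le_trans (lerD IH (lexx _)) _.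
  have -> : N.+2%:R = N.+1%:R + 1 :> R by rewrite natr1.
  have : 0 < N.+1%:R :> R by rewrite ltr0n.
  set a := N.+1%:R => a0.
  have -> : 2 - (a + 1)^-1 = 2 - a^-1 + (a * (a + 1))^-1 by field; do ?split; lra.
  by rewrite lerD2l exprVn lef_pV2 ?posrE; nra.
apply: (@le_trans _ _ (\sum_(1 <= m < N.+2) m%:R^-1 ^+ 2)).
  by rewrite [leRHS]big_nat_recr//= lerDl sqr_ge0.
by apply: le_trans H _; rewrite gerBl invr_ge0 ler0n.
Qed.

Lemma sum_inv_consec_le N : \sum_(m < N) (m.+2%:R^-1 * m.+1%:R^-1) <= 1 :> R.
Proof.
have -> : \sum_(m < N) (m.+2%:R^-1 * m.+1%:R^-1) = 1 - N.+1%:R^-1 :> R.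
  elim: N => [|N IH]; first by rewrite big_ord0 invr1 subrr.
  rewrite big_ord_recr/= IH.
  have -> : N.+2%:R = N.+1%:R + 1 :> R by rewrite natr1.
  have : 0 < N.+1%:R :> R by rewrite ltr0n.
  by set a := N.+1%:R => a0; field; do ?split; lra.
by rewrite gerBl invr_ge0 ler0n.
Qed.
End PowerSums.

(** * Finite Euler products by sieving *)

Section Sieve.
Context {R : realType}.
Local Open Scope complex_scope.
Local Notation nc := (@Normc.normc R).

Lemma sum_dvd_nat (V : nmodType) (f : nat -> V) p N : (0 < p)%N ->
  \sum_(1 <= m < N.+1 | (p %| m)%N) f m =
  \sum_(1 <= k < (N %/ p).+1) f (p * k)%N.
Proof.
move=> p0; elim: N => [|N IH]; first by rewrite div0n !big_geq.
rewrite big_mkcond big_nat_recr//= -big_mkcond IH divnS//.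
case: ifP => [pN|_]; last by rewrite addr0.
rewrite add1n [RHS]big_nat_recr//=; congr (_ + f _).
by rewrite mulnC -{1}(divnK pN) divnS// pN add1n.
Qed.

Definition sieved (P : seq nat) (m : nat) : bool :=
  all (fun p => ~~ (p %| m)%N) P.

Variables (n : nat) (e : R).
Hypotheses (n1 : (1 < n)%N) (e0 : 0 < e).

Definition dsum (Z : nat -> R[i]) (A : pred nat) (N : nat) : R[i] :=
  \sum_(1 <= m < N.+1 | A m) Z m * (wt e m)%:C.

(** Inverse of the Euler product over [P]: multiplying a Dirichlet series by it removes the terms
    divisible by some prime of [P]. *)
Definition euler (Z : nat -> R[i]) (P : seq nat) : R[i] :=
  \prod_(p <- P) (1 - Z p * (wt e p)%:C).

Section OneChar.
Variable Z : nat -> R[i].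
Hypothesis ZD : dirichlet_char n Z.

Lemma nc_dterm m : nc (Z m * (wt e m)%:C) <= wt e m.
Proof.
rewrite ncM nc_real_ge0 ?wt_ge0// -[leRHS]mul1r ler_wpM2r ?wt_ge0//.
exact: nc_dchar_le1 ZD _.
Qed.

Lemma wt_le1 m : wt e m <= 1.
Proof.
have e1 : 0 < 1 + e by rewrite addr_gt0.
case: m => [|m]; first by rewrite /wt powR0// oppr_eq0 (gt_eqF e1).
apply: le_trans (wt_le_inv (ltW e0) _) _ => //.
by rewrite invf_le1 ?ltr0n// ler1n.
Qed.

Lemma nc_dterm_le1 m : nc (Z m * (wt e m)%:C) <= 1.
Proof. exact: le_trans (nc_dterm m) (wt_le1 m). Qed.

Lemma nc_dsum_le (A : pred nat) N : nc (dsum Z A N) <= 1 + e^-1.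
Proof.
apply: le_trans (nc_sum _ _ _) _; apply: le_trans (wt_sum_le N e0).
rewrite big_mkcond/=; apply: ler_sum => m _; case: ifP => _; last exact: wt_ge0.
exact: nc_dterm.
Qed.

(** The terms divisible by [p] are those at [m = p k] with [k <= N / p]; by multiplicativity they
    form the same sum, cut off earlier. *)
Lemma sieve_step P p N : prime p -> all prime P -> p \notin P ->
  dsum Z (sieved (p :: P)) N =
  dsum Z (sieved P) N - Z p * (wt e p)%:C * dsum Z (sieved P) (N %/ p).
Proof.
move=> pp Pp pP; rewrite /dsum [X in _ = X - _](bigID (fun m => p %| m)%N)/=.
set S1 := (X in _ = X + _ - _); set S3 := (X in _ = _ - X).
suff -> : S1 = S3.
  by rewrite [RHS]addrAC subrr add0r; apply: eq_bigl => m; rewrite andbC.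
rewrite /S1 /S3 mulr_sumr big_mkcondl/= sum_dvd_nat ?prime_gt0//.
rewrite [RHS]big_mkcond/=; apply: eq_bigr => k _.
have -> : sieved P (p * k) = sieved P k.
  apply: eq_in_all => q qP; rewrite Euclid_dvdM ?(allP Pp)//.
  have pq : prime q := allP Pp q qP.
  rewrite dvdn_prime2//; have [qp|//] := eqVneq (q : nat) p.
  by move: pP; rewrite -qp qP.
case: ifP => // _; have [_ ZM _ _] := ZD.
by rewrite ZM wtM rmorphM; ring.
Qed.

Lemma dsum_cauchy (A : pred nat) M N : (0 < M)%N -> (M <= N)%N ->
  nc (dsum Z A N - dsum Z A M) <= M%:R `^ (- e) / e.
Proof.
move=> M0 MN; rewrite /dsum (@big_cat_nat _ _ _ M.+1)//= [X in X - _]addrC addrK.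
apply: le_trans (nc_sum _ _ _) _; apply: le_trans (wt_tail N e0 M0).
rewrite big_mkcond/=; apply: ler_sum => m _; case: ifP => _; last exact: wt_ge0.
exact: nc_dterm.
Qed.

Lemma sieve_approx P : uniq P -> all prime P -> forall d, 0 < d ->
  exists N0, forall N, (N0 <= N)%N ->
    nc (dsum Z (sieved P) N - euler Z P * dsum Z xpredT N) <= d.
Proof.
elim: P => [|p P IH] /=.
  move=> _ _ d d0; exists 0%N => N _.
  by rewrite /euler big_nil mul1r subrr nc0 ltW.
move=> /andP[pP Pu] /andP[pp Pp] d d0.
(* [1 - z] has norm at most 2 and [z] at most 1, so errors [d / 4] and [d / 2] add up to [d]. *)
have [N1 H1] := IH Pu Pp (d / 4) (divr_gt0 d0 (ltr0n R 4)).
have [M M0 HM] := powRN_small e0 (divr_gt0 d0 (ltr0n R 2)).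
exists (maxn N1 (M * p)) => N; rewrite geq_max => /andP[N1N MpN].
rewrite sieve_step// /euler big_cons -/(euler Z P).
set z := Z p * _; set F := dsum Z (sieved P); set F1 := dsum Z xpredT N.
have -> : F N - z * F (N %/ p)%N - (1 - z) * euler Z P * F1 =
  (1 - z) * (F N - euler Z P * F1) + z * (F N - F (N %/ p)%N) by ring.
have MNp : (M <= N %/ p)%N by rewrite leq_divRL ?prime_gt0.
have h1 := H1 N N1N.
have h2 : nc (F N - F (N %/ p)%N) <= d / 2.
  apply: le_trans (dsum_cauchy _ _ (leq_div N p)) _.
    exact: leq_trans M0 MNp.
  exact: HM.
have z1 : nc z <= 1 by exact: nc_dterm_le1.
have z2 : nc (1 - z) <= 2 by apply: le_trans (ncB _ _) _; rewrite nc1; lra.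
apply: le_trans (ncD _ _) _; rewrite [nc (z * _)]ncM [nc ((1 - z) * _)]ncM.
have := ler_pM (nc_ge0 _) (nc_ge0 _) z2 h1.
have := ler_pM (nc_ge0 _) (nc_ge0 _) z1 h2.
by rewrite /F /F1; lra.
Qed.

(** Once [P] contains all primes up to [K], every sieved index other than 1 exceeds [K], so the
    deviation from 1 is a tail. *)
Lemma sieve_low P K N : (forall p, prime p -> (p <= K)%N -> p \in P) ->
  all prime P -> (0 < K)%N -> (0 < N)%N ->
  nc (dsum Z (sieved P) N - 1) <= K%:R `^ (- e) / e.
Proof.
move=> PK Pp K0 N0; have [Z1 _ _ _] := ZD.
have s1 : sieved P 1.
  by apply/allP => p /(allP Pp) pp; rewrite dvdn1; case: eqP pp => // ->.
rewrite /dsum big_ltn_cond// s1 Z1 wt1 mulr1 addrC addKr.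
apply: le_trans (nc_sum _ _ _) _.
have s2 m : (1 < m)%N -> (m <= K)%N -> ~~ sieved P m.
  move=> m1 mK; apply/negP => /allP /(_ (pdiv m)).
  rewrite pdiv_dvd => H; suff : false by [].
  apply: H; apply: PK; first exact: pdiv_prime.
  by apply: leq_trans mK; apply: pdiv_leq; lia.
have [NK|KN] := leqP N K.
  rewrite big_seq_cond big1 ?divr_ge0 ?powR_ge0 ?ltW// => m.
  rewrite mem_index_iota => /andP[/andP[h1 h2] sm].
  by have := s2 m h1 (leq_trans (ltnSE h2) NK); rewrite sm.
rewrite (@big_cat_nat _ _ _ K.+1) ?ltnS ?(ltnW KN)//=.
rewrite [X in X + _]big_seq_cond [X in X + _]big1 ?add0r; last first.
  move=> m; rewrite mem_index_iota => /andP[/andP[h1 h2] sm].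
  by have := s2 m h1 (ltnSE h2); rewrite sm.
apply: le_trans (wt_tail N e0 K0); rewrite big_mkcond/=.
by apply: ler_sum => m _; case: ifP => _; [exact: nc_dterm|exact: wt_ge0].
Qed.

(** A finite substitute for the Euler product: [1 / 4] is what remains of 1 after the tail [1 / 2]
    of [sieve_low] and an error [1 / 4] in [sieve_approx]. *)
Lemma euler_low P K : (forall p, prime p -> (p <= K)%N -> p \in P) ->
  all prime P -> uniq P -> (0 < K)%N -> K%:R `^ (- e) / e <= 1 / 2 ->
  exists N0, forall N, (N0 <= N)%N ->
    1 / 4 <= nc (euler Z P) * nc (dsum Z xpredT N).
Proof.
move=> PK Pp Pu K0 Ke; have [|N0 H] := sieve_approx Pu Pp (d := 1 / 4).
  lra.
exists N0.+1 => N N0N; have := H N (ltnW N0N).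
have := sieve_low PK Pp K0 (leq_ltn_trans (leq0n _) N0N).
have := nc_triangle_le 1 (1 - dsum Z (sieved P) N).
rewrite nc1 subKr ncBC => h1 h2 h3.
have := nc_triangle_le (dsum Z (sieved P) N)
  (dsum Z (sieved P) N - euler Z P * dsum Z xpredT N).
by rewrite subKr ncM; lra.
Qed.

Lemma dsum_shift N :
  dsum Z xpredT N = \sum_(m < N) Z m.+1 * (wt e m.+1)%:C.
Proof. by rewrite /dsum big_add1/= big_mkord. Qed.

Lemma dsum_nontrivial_le N : (exists2 a, coprime a n & Z a != 1) ->
  nc (dsum Z xpredT N) <= n%:R.
Proof.
move=> Znt; rewrite dsum_shift.
have := @abel_sum_le R (fun m => Z m.+1) (fun m => wt e m.+1) n%:R N.
rewrite wt1 mulr1; apply => [k|m|m]; first exact: dchar_sumS_le.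
- exact: wt_ge0.
- by apply: wt_anti => //; exact: ltW.
Qed.

(* Abel summation against [m ^ (- e)], whose increments are [O(e / m)]. *)
Lemma dsum_vanishing_le (D : R) N :
  (forall N, nc (\sum_(m < N) Z m.+1 * (m.+1%:R^-1)%:C) <= D / N.+1%:R) ->
  nc (dsum Z xpredT N) <= D * e + D / N.+1%:R.
Proof.
move=> H; have D0 : 0 <= D.
  by have := le_trans (nc_ge0 _) (H 0%N); rewrite divr1.
rewrite dsum_shift.
have -> : \sum_(m < N) Z m.+1 * (wt e m.+1)%:C =
   \sum_(m < N) (Z m.+1 * (m.+1%:R^-1)%:C) * (m.+1%:R `^ (- e))%:C.
  by apply: eq_bigr => m _; rewrite wt_split// rmorphM mulrA.
rewrite (abel_sumE (fun m => Z m.+1 * (m.+1%:R^-1)%:C) (fun m => m.+1%:R `^ (- e))).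
apply: le_trans (ncD _ _) _; rewrite addrC; apply: lerD.
  apply: le_trans (nc_sum _ _ _) _.
  apply: (@le_trans _ _ (\sum_(m < N) (D * e) * (m.+2%:R^-1 * m.+1%:R^-1))); last first.
    rewrite -mulr_sumr -[leRHS]mulr1 ler_wpM2l ?mulr_ge0 ?(ltW e0)//.
    exact: sum_inv_consec_le.
  apply: ler_sum => m _; rewrite ncM.
  have h0 : m.+2%:R `^ (- e) <= m.+1%:R `^ (- e) :> R.
    rewrite !powRN lef_pV2 ?posrE ?powR_gt0 ?ltr0n//.
    by rewrite ge0_ler_powR ?nnegrE ?ler0n ?ler_nat// ltW.
  rewrite nc_real_ge0 ?subr_ge0//.
  have h1 := H m.+1; have := @powRN_diff_le R e m.+1%:R e0.
  rewrite ler1n natr1 => /(_ isT) h2.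
  apply: le_trans (ler_pM (nc_ge0 _) _ h1 h2) _; first by rewrite subr_ge0.
  by rewrite le_eqVlt; apply/orP; left; apply/eqP; ring.
rewrite ncM nc_real_ge0 ?powR_ge0// -[leRHS]mulr1.
apply: ler_pM; rewrite ?nc_ge0 ?powR_ge0//.
by have := @ler_powR R N.+1%:R _ (- e) 0; rewrite ler1n powRr0 oppr_le0 (ltW e0); apply.
Qed.

End OneChar.
End Sieve.

(** * Nonvanishing for characters that are not real *)

Section ComplexCharacter.
Context {R : realType}.
Local Open Scope complex_scope.
Local Notation nc := (@Normc.normc R).

(** AM-GM for three copies of [y1], four of [y2] and one of [y3] as nested two-term inequalities:
    [m], [q], [r] stand for the means of [y1, y3], of [y1, m] and of [q, y2]. *)
Lemma amgm8 (y1 y2 y3 m q r : R) : 0 <= y1 -> 0 <= y2 ->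
  0 <= m -> 0 <= q -> 0 <= r ->
  y1 * y3 <= m ^+ 2 -> y1 * m <= q ^+ 2 -> q * y2 <= r ^+ 2 ->
  y1 ^+ 3 * y2 ^+ 4 * y3 <= r ^+ 8.
Proof.
move=> y10 y20 m0 q0 r0 h1 h2 h3.
have h4 : y1 ^+ 3 * y3 <= q ^+ 4.
  have -> : y1 ^+ 3 * y3 = y1 ^+ 2 * (y1 * y3) by ring.
  apply: le_trans (ler_wpM2l (sqr_ge0 _) h1) _.
  by rewrite -exprMn (_ : 4 = 2 * 2)%N// exprM lerXn2r ?nnegrE ?mulr_ge0 ?sqr_ge0.
have -> : y1 ^+ 3 * y2 ^+ 4 * y3 = y1 ^+ 3 * y3 * y2 ^+ 4 by ring.
apply: le_trans (ler_wpM2r (exprn_ge0 _ y20) h4) _.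
by rewrite -exprMn (_ : 8 = 2 * 4)%N// exprM lerXn2r ?nnegrE ?mulr_ge0 ?sqr_ge0.
Qed.

(** Eight-term AM-GM for the squared factors. Their weighted mean is [1 + x ^ 2 - x (1 + a) ^ 2 / 2]
    with [a = Re z], by [3 + 4 cos u + cos 2u = 2 (1 + cos u) ^ 2]. *)
Lemma three_four_one (x : R) (z : R[i]) : 0 <= x <= 1 -> nc z = 1 ->
  (1 - x) ^+ 3 * nc (1 - z * x%:C) ^+ 4 * nc (1 - z ^+ 2 * x%:C) <=
  (1 + x ^+ 2) ^+ 4.
Proof.
case: z => a b /andP[x0 x1] z1.
have ab : a ^+ 2 + b ^+ 2 = 1 by have := nc_sqr (a +i* b); rewrite z1 expr1n.
set A := nc (1 - _ * _); set B := nc (1 - _ ^+ 2 * _).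
have A2 : A ^+ 2 = 1 - 2 * x * a + x ^+ 2.
  rewrite /A nc_sqr; simpc => /=.
  have -> : 1 - 2 * x * a + x ^+ 2 = 1 - 2 * x * a + x ^+ 2 * (a ^+ 2 + b ^+ 2).
    by rewrite ab mulr1.
  by ring.
have B2 : B ^+ 2 = 1 - 2 * x * (2 * a ^+ 2 - 1) + x ^+ 2.
  rewrite /B nc_sqr expr2; simpc => /=.
  have b2 : b * b = 1 - a ^+ 2 by rewrite -ab; ring.
  have -> : x ^+ 2 = x ^+ 2 * (a ^+ 2 + b ^+ 2) ^+ 2 by rewrite ab expr1n mulr1.
  rewrite b2; have -> : 1 - 2 * x * (2 * a ^+ 2 - 1) = 1 - 2 * x * (a ^+ 2 - b ^+ 2).
    by rewrite [b ^+ 2]expr2 b2; ring.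
  have -> : a * a - (1 - a ^+ 2) = a ^+ 2 - b ^+ 2 by rewrite [b ^+ 2]expr2 b2; ring.
  by ring.
have A0 : 0 <= A by exact: nc_ge0.
have B0 : 0 <= B by exact: nc_ge0.
pose Y1 := (1 - x) ^+ 2; pose Y2 := A ^+ 2; pose Y3 := B ^+ 2.
have Y10 : 0 <= Y1 by exact: sqr_ge0.
have Y20 : 0 <= Y2 by exact: sqr_ge0.
have Y30 : 0 <= Y3 by exact: sqr_ge0.
have amgm (u v : R) : 0 <= u -> 0 <= v -> u * v <= ((u + v) / 2) ^+ 2.
  by move=> u0 v0; have := sqr_ge0 (u - v); nra.
pose M := (Y1 + Y3) / 2; pose Q := (Y1 + M) / 2; pose S := (Q + Y2) / 2.
have M0 : 0 <= M by rewrite /M; lra.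
have Q0 : 0 <= Q by rewrite /Q; lra.
have S0 : 0 <= S by rewrite /S; lra.
have S1 : S <= 1 + x ^+ 2.
  rewrite /S /Q /M /Y1 /Y2 /Y3 A2 B2.
  by have := mulr_ge0 x0 (sqr_ge0 (1 + a)); nra.
have h1 : Y1 * Y3 <= M ^+ 2 by exact: amgm.
have h2 : Y1 * M <= Q ^+ 2 by exact: amgm.
have h3 : Q * Y2 <= S ^+ 2 by exact: amgm.
have h5 := amgm8 Y10 Y20 M0 Q0 S0 h1 h2 h3.
rewrite -(@ler_pXn2r _ 2) ?nnegrE//; first last.
- by rewrite exprn_ge0// addr_ge0// sqr_ge0.
- by rewrite !mulr_ge0 ?exprn_ge0//; lra.
have -> : ((1 - x) ^+ 3 * A ^+ 4 * B) ^+ 2 = Y1 ^+ 3 * Y2 ^+ 4 * Y3.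
  by rewrite /Y1 /Y2 /Y3; ring.
by apply: le_trans h5 _; rewrite -exprM lerXn2r ?nnegrE// addr_ge0// sqr_ge0.
Qed.

Variables (n : nat) (X : nat -> R[i]).
Hypotheses (n1 : (1 < n)%N) (XD : dirichlet_char n X).
Hypothesis Xnt2 : exists2 a, coprime a n & X a ^+ 2 != 1.

(** At [1 + e] the principal series is [O(1 / e)], that of [X] would be [O(e)], and that of the
    nontrivial [X ^ 2] is bounded. Their 3-4-1 product would be [O(e)], but [euler_low] and
    [three_four_one] keep it away from 0. *)
Lemma complex_character_nonvanishing : ~ vanishing_L1 X.
Proof.
move=> [D HD].
have D0 : 0 <= D.
  by have := le_trans (nc_ge0 _) (HD 0%N); rewrite divr1.
(* Eight lower bounds [1 / 4] from [euler_low], with multiplicities 3, 4 and 1. *)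
set d : R := (1 / 4) ^+ 8.
have d0 : 0 < d by rewrite exprn_gt0//; lra.
(* [c * e] is the product of the upper bounds: [expR 8] for the Euler factors, then [(2 / e) ^ 3],
   [(2 * D * e) ^ 4] and [n]. The choice of [e] makes it smaller than [d]. *)
pose c : R := expR 8 * (2 ^+ 3 * ((2 * D) ^+ 4 * n%:R)).
have c0 : 0 <= c by rewrite !mulr_ge0 ?expR_ge0 ?exprn_ge0 ?mulr_ge0.
pose e : R := d / (c + d + d).
have cd : 0 < c + d + d by lra.
have e0 : 0 < e by rewrite divr_gt0.
have e1 : e <= 1 by rewrite ler_pdivrMr//; lra.
have ce : c * e < d.
  rewrite /e mulrA ltr_pdivrMr//.
  have : 0 < d * d by rewrite mulr_gt0.
  by have := mulr_ge0 c0 (ltW d0); nra.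
have [K K0 HK] := powRN_small e0 (ltac:(lra) : 0 < 1 / 2 :> R).
have {}HK := HK K (leqnn K).
pose P := [seq p <- iota 0 K.+1 | prime p].
have Pp : all prime P by apply/allP => p; rewrite mem_filter => /andP[].
have Pu : uniq P by rewrite filter_uniq// iota_uniq.
have PK p : prime p -> (p <= K)%N -> p \in P.
  by move=> pp pK; rewrite mem_filter pp mem_iota.
pose X0 a : R[i] := (coprime a n)%:R.
have X0D : dirichlet_char n X0 by exact: principal_dirichlet_char.
have X2D := sqr_dirichlet_char XD.
have [N0 H0] := euler_low n1 e0 X0D PK Pp Pu K0 HK.
have [N1 H1] := euler_low n1 e0 XD PK Pp Pu K0 HK.
have [N2 H2] := euler_low n1 e0 X2D PK Pp Pu K0 HK.
pose N := maxn (Num.trunc e^-1).+1 (maxn N0 (maxn N1 N2)).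
have {}H0 := H0 N (ltac:(by rewrite /N !leq_max leqnn ?orbT)).
have {}H1 := H1 N (ltac:(by rewrite /N !leq_max leqnn ?orbT)).
have {}H2 := H2 N (ltac:(by rewrite /N !leq_max leqnn ?orbT)).
have eN : N.+1%:R^-1 <= e.
  rewrite -[e]invrK lef_pV2 ?posrE ?ltr0n ?invr_gt0//.
  have ei0 : 0 <= e^-1 by rewrite invr_ge0 ltW.
  have /andP[_ h] := truncn_itv ei0.
  by apply: le_trans (ltW h) _; rewrite ler_nat /N leqW// leq_maxl.
move: H0 H1 H2; set E0 := nc (euler e X0 P); set E1 := nc (euler e X P).
set E2 := nc (euler _ _ _); set F0 := nc (dsum e X0 _ _); set F1 := nc (dsum e X _ _).
set F2 := nc (dsum _ _ _ _) => H0 H1 H2.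
have F0b : F0 <= 2 / e.
  apply: le_trans (nc_dsum_le n1 e0 X0D _ _) _.
  by rewrite mulrDl mul1r lerD2r -[1]invr1 lef_pV2 ?posrE.
have F1b : F1 <= 2 * D * e.
  apply: le_trans (dsum_vanishing_le e0 N HD) _.
  have -> : 2 * D * e = D * e + D * e by ring.
  by rewrite lerD2l ler_wpM2l.
have F2b : F2 <= n%:R by exact: dsum_nontrivial_le.
(* Each prime contributes at most [(1 + p ^ -2) ^ 4 <= exp (4 p ^ -2)], and the inverse squares sum
   to at most 2. *)
have Eb : E0 ^+ 3 * E1 ^+ 4 * E2 <= expR 8.
  rewrite /E0 /E1 /E2 /euler !nc_prod -!prodrXl -!big_split/=.
  apply: (@le_trans _ _ (\prod_(p <- P) expR (4 * p%:R^-1 ^+ 2))); last first.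
    rewrite -expR_sum ler_expR -mulr_sumr.
    have : \sum_(p <- P) p%:R^-1 ^+ 2 <= 2 :> R; last lra.
    apply: le_trans (sum_inv_sqr_le K); rewrite big_filter big_mkcond/=.
    rewrite big_cons/= add0r /index_iota subn1/=.
    by apply: ler_sum => p _; case: ifP => // _; exact: sqr_ge0.
  rewrite big_seq [leRHS]big_seq; apply: ler_prod => p pP.
  rewrite !mulr_ge0 ?exprn_ge0 ?nc_ge0//=.
  have p0 : (0 < p)%N by rewrite prime_gt0// (allP Pp).
  have w0 := wt_ge0 e p; have w1 := wt_le1 e0 p.
  have wi := wt_le_inv (ltW e0) p0.
  apply: (@le_trans _ _ ((1 + wt e p ^+ 2) ^+ 4)); last first.
    rewrite mulrC -[4]/(4%:R) expRM_natr lerXn2r ?nnegrE ?expR_ge0 ?addr_ge0 ?sqr_ge0//.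
    by apply: le_trans (expR_ge1Dx _); rewrite lerD2l lerXn2r ?nnegrE.
  have [pn|pn] := boolP (coprime p n).
    rewrite /X0 pn mul1r.
    have -> : 1 - (wt e p)%:C = (1 - wt e p)%:C by rewrite rmorphB.
    rewrite nc_real_ge0 ?subr_ge0//; apply: three_four_one; rewrite ?w0//.
    exact: nc_dchar XD _ pn.
  have [_ _ _ Xn] := XD; have -> : X0 p = 0 by rewrite /X0 (negbTE pn).
  have e00 : 0 ^+ 2 = 0 :> R[i] by rewrite expr0n.
  rewrite Xn// e00 !mul0r subr0 nc1.
  by rewrite !expr1n !mul1r exprn_ege1// lerDl sqr_ge0.
suff : d <= c * e by rewrite leNgt ce.
have n0 := @nc_ge0 R.
apply: (@le_trans _ _ (expR 8 * ((2 / e) ^+ 3 * ((2 * D * e) ^+ 4 * n%:R)))); last first.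
  by rewrite /c le_eqVlt; apply/orP; left; apply/eqP; field; lra.
apply: (@le_trans _ _ ((E0 ^+ 3 * E1 ^+ 4 * E2) * (F0 ^+ 3 * (F1 ^+ 4 * F2)))); last first.
  apply: ler_pM => //; rewrite ?mulr_ge0 ?exprn_ge0 ?n0//.
  apply: ler_pM => //; rewrite ?mulr_ge0 ?exprn_ge0 ?n0//.
    by rewrite lerXn2r ?nnegrE ?n0// ltW// divr_gt0.
  apply: ler_pM => //; rewrite ?mulr_ge0 ?exprn_ge0 ?n0//.
  by rewrite lerXn2r ?nnegrE ?n0// mulr_ge0 ?(ltW e0)// mulr_ge0.
have -> : E0 ^+ 3 * E1 ^+ 4 * E2 * (F0 ^+ 3 * (F1 ^+ 4 * F2)) =
  (E0 * F0) ^+ 3 * ((E1 * F1) ^+ 4 * (E2 * F2)) by ring.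
have -> : d = (1 / 4) ^+ 3 * ((1 / 4) ^+ 4 * (1 / 4)) by rewrite /d; ring.
have q0 : 0 <= 1 / 4 :> R by lra.
apply: ler_pM; rewrite ?mulr_ge0 ?exprn_ge0//.
  by rewrite lerXn2r ?nnegrE ?mulr_ge0 ?n0.
apply: ler_pM; rewrite ?exprn_ge0//.
by rewrite lerXn2r ?nnegrE ?mulr_ge0 ?n0.
Qed.
End ComplexCharacter.

(** * Divisor sums of a real character *)

Section DivisorSums.
Context {R : realType}.
Variable x : nat -> R.
Hypotheses (x1 : x 1%N = 1) (xM : forall a b, x (a * b)%N = x a * x b).
Hypothesis xv : forall a, [\/ x a = 0, x a = 1 | x a = -1].

Definition dvsum (k : nat) : R := \sum_(1 <= d < k.+1 | (d %| k)%N) x d.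

Lemma dvd_sum_widen (A : pred nat) k N : (0 < k <= N)%N ->
  \sum_(1 <= d < k.+1 | (d %| k)%N && A d) x d =
  \sum_(1 <= d < N.+1 | (d %| k)%N && A d) x d.
Proof.
move=> /andP[k0 kN]; rewrite [RHS](@big_cat_nat _ _ _ k.+1)//=.
rewrite [X in _ + X]big_seq_cond [X in _ + X]big1 ?addr0// => d.
rewrite mem_index_iota => /and3P[/andP[kd _] /(dvdn_leq k0) dk _].
by move: kd; rewrite ltnNge dk.
Qed.

Lemma dvsum_mulp p k : prime p -> (0 < k)%N ->
  dvsum (p * k) =
  \sum_(1 <= d < k.+1 | (d %| k)%N && ~~ (p %| d)%N) x d + x p * dvsum k.
Proof.
move=> pp k0; have p0 := prime_gt0 pp.
rewrite /dvsum (bigID (fun d => p %| d)%N)/= addrC; congr (_ + _).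
  rewrite (@dvd_sum_widen _ k (p * k)) ?k0 ?leq_pmull//.
  apply: eq_bigl => d; have [|pd] := boolP (p %| d)%N; rewrite ?andbF ?andbT//.
  by rewrite Gauss_dvdr// coprime_sym prime_coprime.
rewrite big_mkcondl/= sum_dvd_nat// mulKn// mulr_sumr [RHS]big_mkcond/=.
apply: eq_bigr => j _; rewrite dvdn_pmul2l//; case: ifP => // _; exact: xM.
Qed.

(** Horner form of [1 + x p + ... + (x p) ^ j], the local factor of the divisor sum at [p ^ j]. *)
Fixpoint dvfactor (p j : nat) : R :=
  if j is j'.+1 then 1 + x p * dvfactor p j' else 1.

Lemma dvsum_primepow p j k : prime p -> (0 < k)%N -> ~~ (p %| k)%N ->
  dvsum (p ^ j * k) = dvfactor p j * dvsum k.
Proof.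
move=> pp k0 pk.
have pjk i : (0 < p ^ i * k)%N by rewrite muln_gt0 expn_gt0 prime_gt0.
have H i : \sum_(1 <= d < (p ^ i * k).+1 | (d %| p ^ i * k)%N && ~~ (p %| d)%N) x d =
    dvsum k.
  symmetry; rewrite /dvsum.
  have -> : \sum_(1 <= d < k.+1 | (d %| k)%N) x d =
      \sum_(1 <= d < k.+1 | (d %| k)%N && ~~ (p %| d)%N) x d.
    apply: eq_bigl => d; have [dk|//] := boolP (d %| k)%N.
    by symmetry; apply: contra pk => /dvdn_trans; apply.
  rewrite (@dvd_sum_widen _ k (p ^ i * k)) ?k0 ?leq_pmull ?expn_gt0 ?prime_gt0//.
  apply: eq_bigl => d; have [|pd] := boolP (p %| d)%N; rewrite ?andbF ?andbT//.
  by rewrite Gauss_dvdr// coprimeXr// coprime_sym prime_coprime.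
elim: j => [|j IH]; first by rewrite expn0 mul1n mul1r.
by rewrite expnS -mulnA dvsum_mulp// H IH /=; ring.
Qed.

(** For [x p = -1] the factor alternates between 1 and 0 and is 1 for even [j]; hence the special
    role of squares. *)
Lemma dvfactor_ge p j :
  0 <= dvfactor p j /\ (~~ odd j -> 1 <= dvfactor p j).
Proof.
have [e|e|e] := xv p.
- by case: j => [|j]; rewrite /= ?e ?mul0r ?addr0.
- have H i : 1 <= dvfactor p i.
    by elim: i => [|i IH] //=; rewrite e mul1r; lra.
  by split=> [|_]; [apply: le_trans (H j)|exact: H].
- have -> : dvfactor p j = (~~ odd j)%:R.
    elim: j => [|j IH] //=; rewrite IH e; case: (odd j) => /=; lra.
  by case: (odd j); split.
Qed.

Lemma dvsum1 : dvsum 1 = 1.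
Proof. by rewrite /dvsum big_mkcond big_nat1 dvdn1. Qed.

(** Induction that peels off the full power of a prime, as suits multiplicative functions. *)
Lemma pfactor_ind (Q : nat -> Prop) : Q 1%N ->
  (forall p j k, prime p -> (0 < k)%N -> ~~ (p %| k)%N -> Q k -> Q (p ^ j * k)%N) ->
  forall k, (0 < k)%N -> Q k.
Proof.
move=> Q1 Qs; elim/ltn_ind => k IH k0.
have [k1|k1] := leqP k 1; first by have -> : k = 1%N by lia.
have pp := pdiv_prime k1; set p := pdiv k in pp.
have [m pm km] := pfactor_coprime pp k0.
have m0 : (0 < m)%N by case: m km {pm} => // km; move: k0; rewrite km.
have l0 : (0 < logn p k)%N by rewrite logn_gt0 mem_primes pp k0 pdiv_dvd.
have mk : (m < k)%N.
  by rewrite km -[X in (X < _)%N]muln1 ltn_pmul2l// -(exp1n (logn p k)) ltn_exp2r// prime_gt1.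
rewrite km mulnC; apply: Qs => //; first by rewrite -prime_coprime.
exact: IH.
Qed.

Lemma dvsum_ge0 k : (0 < k)%N -> 0 <= dvsum k.
Proof.
move: k; apply: pfactor_ind; first by rewrite dvsum1.
move=> p j k pp k0 pk h; rewrite dvsum_primepow// mulr_ge0//.
by have [] := dvfactor_ge p j.
Qed.

Lemma dvsum_sqr_ge1 k : (0 < k)%N -> 1 <= dvsum (k ^ 2).
Proof.
move: k; apply: pfactor_ind; first by rewrite exp1n dvsum1.
move=> p j k pp k0 pk h; rewrite expnMn -expnM dvsum_primepow//.
- have [_ h2] := dvfactor_ge p (j * 2).
  by rewrite -[1]mulr1 ler_pM// h2// oddM andbF.
- by rewrite expn_gt0 k0.
- by rewrite Euclid_dvdX// andbT.
Qed.

(** Truncated Lambert series: writing [k = d j] turns the generating sum into geometric sums of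
    ratio [t ^ d], cut off at [N / d]. *)
Lemma dvsum_gen N (t : R) :
  \sum_(1 <= k < N.+1) dvsum k * t ^+ k =
  \sum_(1 <= d < N.+1) x d * \sum_(1 <= j < (N %/ d).+1) t ^+ (d * j).
Proof.
transitivity (\sum_(1 <= k < N.+1) \sum_(1 <= d < N.+1 | (d %| k)%N) x d * t ^+ k).
  apply: eq_big_nat => k /andP[k0 kN]; rewrite -mulr_suml; congr (_ * _).
  have := @dvd_sum_widen xpredT k N; rewrite k0 -ltnS kN => /(_ isT).
  rewrite /dvsum (eq_bigl (fun d => d %| k)%N); last by move=> d; rewrite andbT.
  by move=> ->; apply: eq_bigl => d; rewrite andbT.
rewrite (exchange_big_dep xpredT)//=; apply: eq_big_nat => d /andP[d0 _].
by rewrite sum_dvd_nat// mulr_sumr.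
Qed.

(** Only the squares [1, 4, ..., K ^ 2] are kept; each contributes at least [t ^+ (K ^ 2)]. *)
Lemma dvsum_gen_ge N K (t : R) : (K ^ 2 <= N)%N -> 0 <= t -> t <= 1 ->
  K%:R * t ^+ (K ^ 2) <= \sum_(1 <= k < N.+1) dvsum k * t ^+ k.
Proof.
move=> KN t0 t1.
have G : \sum_(1 <= i < K.+1) dvsum (i ^ 2) * t ^+ (i ^ 2) <=
   \sum_(1 <= k < N.+1) dvsum k * t ^+ k.
  have g0 k : (0 < k)%N -> 0 <= dvsum k * t ^+ k.
    by move=> k0; rewrite mulr_ge0 ?dvsum_ge0 ?exprn_ge0.
  apply: (@le_trans _ _ (\sum_(1 <= k < (K ^ 2).+1) dvsum k * t ^+ k)); last first.
    rewrite [leRHS](@big_cat_nat _ _ _ (K ^ 2).+1)//= lerDl big_seq_cond sumr_ge0// => k.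
    by rewrite mem_index_iota andbT => /andP[h _]; apply: g0; lia.
  elim: (K) => [|k IH]; first by rewrite exp0n// !big_geq.
  rewrite big_nat_recr//= [leRHS](@big_cat_nat _ _ _ (k ^ 2).+1)//=; last first.
    by rewrite ltnS leq_exp2r.
  apply: lerD => //; rewrite big_nat_recr/=; last by rewrite ltn_exp2r.
  rewrite lerDr big_seq_cond sumr_ge0// => i.
  by rewrite mem_index_iota andbT => /andP[h _]; apply: g0; lia.
apply: le_trans G.
have -> : K%:R * t ^+ (K ^ 2) = \sum_(1 <= i < K.+1) t ^+ (K ^ 2).
  by rewrite sumr_const_nat subn1 mulr_natl.
rewrite big_nat [leRHS]big_nat; apply: ler_sum => i /andP[i0 iK].
rewrite -[leLHS]mul1r; apply: ler_pM => //; first by rewrite exprn_ge0.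
  exact: dvsum_sqr_ge1.
by rewrite ler_wiXn2l// leq_exp2r.
Qed.
End DivisorSums.

(** * Monotone weights for the Lambert series *)

Section Lambert.
Context {R : realType}.
Variable r : R.
Hypotheses (r0 : 0 < r) (r1 : r < 1).
Let t := r ^+ 2.

Let t0 : 0 < t. Proof. by rewrite exprn_gt0. Qed.
Let t1 : t < 1. Proof. by rewrite expr_lt1// ltW. Qed.

Definition geo (M : nat) : R := \sum_(i < M) t ^+ i.

Lemma geoE M : 1 - t ^+ M = (1 - t) * geo M.
Proof. by rewrite -opprB subrX1 -mulNr opprB. Qed.

Lemma geoS M : geo M.+1 = 1 + t * geo M.
Proof.
rewrite /geo big_ord_recl expr0 mulr_sumr; congr (_ + _).
by apply: eq_bigr => i _; rewrite exprS.
Qed.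

Lemma geo_gt0 M : 0 < geo M.+1.
Proof.
rewrite geoS ltr_pwDl// mulr_ge0 ?(ltW t0)// sumr_ge0// => i _.
by rewrite exprn_ge0// ltW.
Qed.

(** Pairing [i] with [M - i], [t ^ i + t ^ (M - i) >= 2 r ^ M]; this is why [t] is given as the
    square of [r]. *)
Lemma geo_ge M : M.+1%:R * r ^+ M <= geo M.+1.
Proof.
have E : geo M.+1 *+ 2 = \sum_(i < M.+1) (t ^+ i + t ^+ (M - i)).
  rewrite mulr2n {2}/geo (reindex_inj rev_ord_inj)/= big_split/=.
  by congr (_ + _); apply: eq_bigr => i _; rewrite subSS.
have : M.+1%:R * r ^+ M *+ 2 <= geo M.+1 *+ 2; last first.
  by rewrite lerMn2r.
rewrite E -mulrnAr mulr_natl -[X in _ *+ X](card_ord M.+1) -sumr_const.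
apply: ler_sum => i _; rewrite /t -!exprM !(mulnC 2%N) !exprM.
have -> : r ^+ M = r ^+ i * r ^+ (M - i) by rewrite -exprD subnKC// -ltnS.
set a := r ^+ i; set b := r ^+ _; have := sqr_ge0 (a - b).
by rewrite mulr2n; nra.
Qed.

Lemma geo_prod M : M.+1%:R * M.+2%:R * t ^+ M.+1 <= geo M.+1 * geo M.+2.
Proof.
have h1 := geo_ge M; have h2 := geo_ge M.+1.
have p k : 0 <= k%:R * r ^+ k.-1 :> R by rewrite mulr_ge0 ?ler0n ?exprn_ge0// ltW.
have := ler_pM (p M.+1) (p M.+2) h1 h2; apply: le_trans => /=.
have -> : M.+1%:R * r ^+ M * (M.+2%:R * r ^+ M.+1) =
    M.+1%:R * M.+2%:R * (r ^+ (M + M.+1)) by rewrite exprD; ring.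
rewrite ler_wpM2l ?mulr_ge0 ?ler0n// /t -exprM ler_wiXn2l ?(ltW r0) ?(ltW r1)//.
lia.
Qed.

(* Monsky's weights: nonnegative and decreasing, so that [sum_m X(m+1) lamb m]
   stays bounded, whereas [sum_m X(m) t^m / (1 - t^m)] is the generating series
   of the divisor sums of [X], which are [>= 0], and [>= 1] at squares. *)
Definition lamb (m : nat) : R :=
  (m.+1%:R * (1 - t))^-1 - t ^+ m.+1 / (1 - t ^+ m.+1).

Lemma lambE m : lamb m = (1 - t)^-1 * (m.+1%:R^-1 - t ^+ m.+1 / geo m.+1).
Proof.
rewrite /lamb geoE; have := geo_gt0 m; have := t1; set g := geo _ => t1' g0.
have m0 : 0 < m.+1%:R :> R by rewrite ltr0n.
move: m0; set M := m.+1%:R; set T := t ^+ _ => m0.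
by field; rewrite !gt_eqF//; lra.
Qed.

Lemma lamb_ge0 m : 0 <= lamb m.
Proof.
rewrite lambE mulr_ge0 ?invr_ge0 ?subr_ge0 ?(ltW t1)//.
have m0 : 0 < m.+1%:R :> R by rewrite ltr0n.
rewrite ler_pdivrMr ?geo_gt0// ler_pdivlMl//.
rewrite mulr_natl -[X in _ *+ X](card_ord m.+1) -sumr_const; apply: ler_sum => i _.
by rewrite ler_wiXn2l ?(ltW t0) ?(ltW t1)// ltnW.
Qed.

(** Up to positive factors the difference is [g g' - M (M + 1) T], because [g' - t g = 1];
    [geo_prod] gives its sign. *)
Lemma lamb_anti m : lamb m.+1 <= lamb m.
Proof.
rewrite !lambE ler_pM2l ?invr_gt0 ?subr_gt0//.
have g0 := geo_gt0 m; have g0' := geo_gt0 m.+1; have gp := geo_prod m.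
have gS := geoS m.+1; move: g0 g0' gp gS.
have m0 : 0 < m.+1%:R :> R by rewrite ltr0n.
have -> : m.+2%:R = m.+1%:R + 1 :> R by rewrite natr1.
rewrite [t ^+ m.+2]exprS; move: m0; set M := m.+1%:R; set T := t ^+ _.
set g := geo m.+1; set g' := geo _ => m0 g0 g0' gp gS.
rewrite -subr_ge0.
have -> : M^-1 - T / g - ((M + 1)^-1 - t * T / g') =
   (g * g' - M * (M + 1) * T * (g' - t * g)) / (M * (M + 1) * (g * g')).
  by field; rewrite !gt_eqF//; lra.
have -> : g' - t * g = 1 by rewrite gS addrK.
by rewrite mulr1 divr_ge0 ?subr_ge0// !mulr_ge0//; lra.
Qed.

Lemma lamb0 : lamb 0 = 1.
Proof. by rewrite /lamb expr1 mul1r -{1}[_^-1]mul1r -mulrBl divff// subr_eq0 gt_eqF. Qed.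

End Lambert.

(** * Nonvanishing for real characters *)

Section RealCharacter.
Context {R : realType}.
Local Open Scope complex_scope.
Local Notation nc := (@Normc.normc R).
Variables (n : nat) (X : nat -> R[i]).
Hypotheses (n1 : (1 < n)%N) (XD : dirichlet_char n X).
Hypothesis Xnt : exists2 a, coprime a n & X a != 1.
Hypothesis X2 : forall a, coprime a n -> X a ^+ 2 = 1.

Let x a : R := complex.Re (X a).

Let Xx a : X a = (x a)%:C /\ [\/ x a = 0, x a = 1 | x a = -1].
Proof.
have [/X2 h|an] := boolP (coprime a n); last first.
  have [_ _ _ H] := XD; rewrite /x H//; split=> //; exact: Or31.
have : (X a - 1) * (X a + 1) = 0 by rewrite -subr_sqr expr1n h subrr.
move=> /eqP; rewrite mulf_eq0 subr_eq0 addr_eq0 => /orP[] /eqP e; rewrite /x e.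
  by split=> //; exact: Or32.
by split; [rewrite -[RHS]/(- 1 +i* 0) -[LHS]/(- 1 +i* - 0) oppr0|exact: Or33].
Qed.

Lemma real_character_nonvanishing : ~ vanishing_L1 X.
Proof.
move=> [D HD].
have D0 : 0 <= D.
  by have := le_trans (nc_ge0 _) (HD 0%N); rewrite divr1.
have x1 : x 1%N = 1 by rewrite /x; case: XD => ->.
have xM a b : x (a * b)%N = x a * x b.
  case: XD => _ XM _ _; have := XM a b.
  rewrite (Xx (a * b)).1 (Xx a).1 (Xx b).1 -rmorphM; exact: complexI.
have xv a := (Xx a).2.
have xle a : `|x a| <= 1.
  by have [->|->|->] := xv a; rewrite ?normr0 ?normrN ?normr1.
have Xsum N (g : nat -> R) :
    nc (\sum_(m < N) X m.+1 * (g m)%:C) = `|\sum_(m < N) x m.+1 * g m|.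
  rewrite -nc_real rmorph_sum; congr nc; apply: eq_bigr => m _.
  by rewrite rmorphM (Xx m.+1).1.
(* With this [K] the lower bound [K / 2] is [n + 3], whereas the upper bound will be at most
   [n + 1]. *)
pose K := (2 * n + 6)%N.
have Kp : (0 < K ^ 2)%N by rewrite expn_gt0 /K addn_gt0 orbT.
have K0 : 0 < (K ^ 2)%:R :> R by rewrite ltr0n.
(* Bernoulli's inequality with [g = 1 / (4 K ^ 2)] gives [t ^ (K ^ 2) = r ^ (2 K ^ 2) >= 1 / 2]. The
   constants are introduced through equations to keep them opaque. *)
have [g gE] : {g : R | g = (4 * (K ^ 2)%:R)^-1} by exists (4 * (K ^ 2)%:R)^-1.
have g0 : 0 < g by rewrite gE invr_gt0 mulr_gt0.
have g1 : g <= 1 / 4.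
  by rewrite gE invfM -[leRHS]mulr1 div1r ler_pM2l ?invr_gt0// invf_le1// ler1n.
have [r rE] : {r : R | r = 1 - g} by exists (1 - g).
have r0 : 0 < r by lra.
have r1 : r < 1 by lra.
have [t tE] : {t : R | t = r ^+ 2} by exists (r ^+ 2).
have t0 : 0 < t by rewrite tE exprn_gt0.
have t1 : t < 1 by rewrite tE expr_lt1// ltW.
have tK : 1 / 2 <= t ^+ (K ^ 2).
  have B k : 1 - k%:R * g <= r ^+ k.
    elim: k => [|k IH]; first by rewrite mul0r subr0.
    rewrite exprS -natr1; have := ler_wpM2l (ltW r0) IH; apply: le_trans.
    by rewrite rE; have := mulr_ge0 (ler0n R k) (sqr_ge0 g); nra.
  rewrite tE -exprM; apply: le_trans (B _); rewrite natrM gE.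
  have : (K ^ 2)%:R != 0 :> R by rewrite gt_eqF.
  move: ((K ^ 2)%:R : R) => k2 k20.
  by rewrite le_eqVlt; apply/orP; left; apply/eqP; field.
have [q qE] : {q : R | q = 1 - t} by exists (1 - t).
have q0 : 0 < q by lra.
have main N : (K ^ 2 <= N)%N ->
    K%:R / 2 <= n%:R + D / N.+1%:R / q + N%:R * t ^+ N.+1 / q.
  move=> KN.
  have L := dvsum_gen_ge x1 xM xv KN (ltW t0) (ltW t1).
  have KL : K%:R / 2 <= K%:R * t ^+ (K ^ 2).
    by rewrite ler_wpM2l ?ler0n//; lra.
  apply: le_trans KL (le_trans L _); rewrite dvsum_gen.
  (* Completing each finite geometric sum and rewriting it through [lamb] leaves the series of
     [X(m) / m], the [lamb] sum and a truncation error. *)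
  have -> : \sum_(1 <= d < N.+1) x d * \sum_(1 <= j < (N %/ d).+1) t ^+ (d * j) =
     (\sum_(m < N) x m.+1 * m.+1%:R^-1) / q - \sum_(m < N) x m.+1 * lamb r m
     - \sum_(m < N) x m.+1 * (t ^+ (m.+1 * (N %/ m.+1).+1) / (1 - t ^+ m.+1)).
    rewrite big_add1 big_mkord/= mulr_suml -!sumrB; apply: eq_bigr => m _.
    have tm : t ^+ m.+1 < 1 by rewrite expr_lt1// ltW.
    have -> : \sum_(1 <= j < (N %/ m.+1).+1) t ^+ (m.+1 * j) =
       (t ^+ m.+1 - t ^+ (m.+1 * (N %/ m.+1).+1)) / (1 - t ^+ m.+1).
      elim: (N %/ m.+1)%N => [|k IH].
        by rewrite big_geq// muln1 subrr mul0r.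
      rewrite big_nat_recr//= IH [(m.+1 * k.+2)%N]mulnS exprD.
      by field; lra.
    rewrite /lamb -tE -qE; have m0 : 0 < m.+1%:R :> R by rewrite ltr0n.
    by field; rewrite !gt_eqF//; lra.
  have h1 : `|\sum_(m < N) x m.+1 * m.+1%:R^-1| <= D / N.+1%:R.
    by have := HD N; rewrite (Xsum N (fun m => m.+1%:R^-1)).
  have h2 : `|\sum_(m < N) x m.+1 * lamb r m| <= n%:R.
    have := @abel_sum_le R (fun m => X m.+1) (lamb r) n%:R N.
    rewrite (Xsum N (lamb r)) (lamb0 r0 r1) mulr1; apply.
    - exact: dchar_sumS_le.
    - exact: lamb_ge0.
    - exact: lamb_anti.
  have h3 : `|\sum_(m < N) x m.+1 * (t ^+ (m.+1 * (N %/ m.+1).+1) / (1 - t ^+ m.+1))|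
      <= N%:R * t ^+ N.+1 / q.
    apply: le_trans (ler_norm_sum _ _ _) _.
    rewrite -mulrA mulr_natl -[X in _ *+ X](card_ord N) -sumr_const.
    apply: ler_sum => m _; rewrite normrM -[leRHS]mul1r; apply: ler_pM => //.
    have tm : t ^+ m.+1 < 1 by rewrite expr_lt1// ltW.
    rewrite ger0_norm; last first.
      by rewrite divr_ge0 ?exprn_ge0 ?(ltW t0) ?subr_ge0 ?(ltW tm).
    apply: ler_pM; rewrite ?exprn_ge0 ?invr_ge0 ?subr_ge0 ?(ltW t0) ?(ltW tm)//.
      by rewrite ler_wiXn2l ?(ltW t0) ?(ltW t1)// mulnC ltn_ceil.
    rewrite lef_pV2 ?posrE ?subr_gt0// qE lerD2l lerN2.
    by rewrite exprS ler_piMr ?(ltW t0)// exprn_ile1 ?ltW.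
  move: h1 h2 h3; set s1 := \sum__ _; set s2 := \sum__ _; set s3 := \sum__ _.
  clearbody s1 s2 s3; move=> h1 h2 h3.
  have h1' : s1 / q <= D / N.+1%:R / q.
    by rewrite ler_pM2r ?invr_gt0// (le_trans (ler_norm _)).
  have := ler_norm (- s2); rewrite normrN; have := ler_norm (- s3); rewrite normrN.
  by move: (_ / q) (_ / q) (_ / q) h1' h3 => u v w' h1' h3; lra.
(* Truncating at [M + M] squares the Bernoulli bound [t ^ M * (M * g) <= 1], which then beats the
   factor [M + M]. *)
have tb M : (0 < M)%N -> (M + M)%:R * t ^+ (M + M).+1 <= 2 / (M%:R * g ^+ 2).
  move=> M0; have MR : 0 < M%:R :> R by rewrite ltr0n.
  have tg : t * (1 + g) <= 1.
    rewrite tE rE; have := mulr_ge0 (ltW g0) (ltW g0); nra.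
  have B k : 1 + k%:R * g <= (1 + g) ^+ k.
    elim: k => [|k IH]; first by rewrite mul0r addr0.
    rewrite exprS -natr1; have := ler_wpM2l (_ : 0 <= 1 + g) IH.
    move=> /(_ (ltac:(lra))); apply: le_trans.
    by have := mulr_ge0 (ler0n R k) (sqr_ge0 g); nra.
  have tM : t ^+ M * (M%:R * g) <= 1.
    apply: (@le_trans _ _ ((t * (1 + g)) ^+ M)).
      rewrite exprMn ler_wpM2l ?exprn_ge0 ?(ltW t0)//.
      by apply: le_trans (B M); lra.
    by rewrite exprn_ile1// mulr_ge0 ?(ltW t0)//; lra.
  have tM0 : 0 <= t ^+ M by rewrite exprn_ge0 ?(ltW t0).
  have Mg0 : 0 < M%:R * g by rewrite mulr_gt0.
  have tM2 : t ^+ (M + M) * (M%:R * g) ^+ 2 <= 1.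
    rewrite exprD -expr2 -exprMn exprn_ile1// mulr_ge0// ltW//.
  have -> : 2 / (M%:R * g ^+ 2) = (M + M)%:R / (M%:R * g) ^+ 2.
    rewrite natrD; move: MR; set m := M%:R => MR; field; rewrite !gt_eqF//; lra.
  rewrite ler_wpM2l ?ler0n// -[leRHS]mul1r ler_pdivlMr ?exprn_gt0//.
  apply: le_trans tM2; rewrite ler_wpM2r ?exprn_ge0 ?(ltW Mg0)//.
  by rewrite exprS ler_piMl ?exprn_ge0 ?(ltW t1) ?(ltW t0).
(* [C / M] bounds the two error terms together, and [M > C] makes them at most 1. *)
pose C := D / q + 2 / g ^+ 2 / q.
have C0 : 0 <= C.
  by rewrite addr_ge0// !divr_ge0 ?exprn_ge0 ?(ltW g0) ?(ltW q0).
pose M := maxn (Num.trunc C).+1 (K ^ 2).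
have M0 : (0 < M)%N by rewrite leq_max.
have CM : C < M%:R.
  have /andP[_ h] := truncn_itv C0.
  by apply: lt_le_trans h _; rewrite ler_nat leq_maxl.
have MR : 0 < M%:R :> R by rewrite ltr0n.
have KM : (K ^ 2 <= M + M)%N by rewrite (leq_trans (leq_maxr _ _) (leq_addr _ _)).
have := main _ KM.
have e1 : D / (M + M).+1%:R / q <= D / q / M%:R.
  rewrite mulrAC ler_wpM2l ?divr_ge0 ?(ltW q0)// lef_pV2 ?posrE ?ltr0n//.
  by rewrite ler_nat -addSn leq_addl.
have e2 : (M + M)%:R * t ^+ (M + M).+1 / q <= 2 / g ^+ 2 / q / M%:R.
  have -> : 2 / g ^+ 2 / q / M%:R = 2 / (M%:R * g ^+ 2) / q.
    move: MR; set m := M%:R => MR; field; rewrite !gt_eqF//; lra.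
  by rewrite ler_pM2r ?invr_gt0// tb.
have e3 : C / M%:R <= 1 by rewrite ler_pdivrMr// mul1r ltW.
move: e3; rewrite /C mulrDl => e3.
have -> : K%:R / 2 = n%:R + 3 :> R by rewrite /K natrD natrM; lra.
move: e1 e2 e3; move: (D / _ / q) (_ * t ^+ _ / q) (D / q / _) (2 / _ / q / _).
by move: (n%:R : R) => a b c d f; lra.
Qed.

End RealCharacter.

Section Nonvanishing.
Context {R : realType}.

Theorem L1_nonvanishing (n : nat) (X : nat -> R[i]) : (1 < n)%N ->
  dirichlet_char n X -> (exists2 a, coprime a n & X a != 1) -> ~ vanishing_L1 X.
Proof.
move=> n1 XD Xnt.
have [X2|X2] := pselect (exists2 a, coprime a n & X a ^+ 2 != 1).
  exact: complex_character_nonvanishing n1 XD X2.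
apply: real_character_nonvanishing n1 XD Xnt _ => a an.
by apply/eqP/negPn/negP => h; apply: X2; exists a.
Qed.
End Nonvanishing.

(** * Logarithms of [1 - w ^ k] *)

Section UnityRoots.
Context {R : realType}.
Local Open Scope complex_scope.
Local Notation nc := (@Normc.normc R).

Definition zexp (n : nat) : R[i] :=
  cos (2 * pi / n%:R) +i* sin (2 * pi / n%:R).

Lemma zexpX n k :
  zexp n ^+ k = cos (k%:R * (2 * pi / n%:R)) +i* sin (k%:R * (2 * pi / n%:R)).
Proof.
elim: k => [|k IH]; first by rewrite expr0 mul0r cos0 sin0.
rewrite exprS IH /zexp -[k.+1%:R]natr1; set a := 2 * pi / _; rewrite mulrDl mul1r.
by rewrite cosD sinD; simpc; congr (_ +i* _); ring.
Qed.

Lemma nc_1Bzexp n k : (0 < n)%N -> (k <= n)%N ->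
  nc (1 - zexp n ^+ k) = 2 * sin (pi * (k%:R / n%:R)).
Proof.
move=> n0 kn; have nR : 0 < n%:R :> R by rewrite ltr0n.
set x := pi * _; have pi0 := @pi_gt0 R.
have x0 : 0 <= x <= pi.
  rewrite /x mulr_ge0 ?divr_ge0 ?ler0n ?(ltW pi0)//=.
  by rewrite ger_pMr// ler_pdivrMr// mul1r ler_nat.
have s0 : 0 <= sin x by exact: sin_ge0_pi.
apply/eqP; rewrite -(@eqrXn2 _ 2) ?nc_ge0 ?mulr_ge0//; apply/eqP.
rewrite nc_sqr zexpX; have -> : k%:R * (2 * pi / n%:R) = x *+ 2.
  by rewrite /x mulr2n; field; rewrite gt_eqF.
rewrite -[1]/(1 +i* 0); simpc => /=; rewrite sin_mulr2n cos_mulr2n exprMn.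
set c := cos x; set s := sin x; have cs : c ^+ 2 = 1 - s ^+ 2 := cos2sin2 x.
have -> : (1 - (c ^+ 2 *+ 2 - 1)) ^+ 2 + (- (c * s *+ 2)) ^+ 2 =
   4 * (1 - c ^+ 2) ^+ 2 + 4 * c ^+ 2 * s ^+ 2 by rewrite !mulr2n; ring.
by rewrite cs; ring.
Qed.

Lemma zexp_prim n : (0 < n)%N -> n.-primitive_root (zexp n).
Proof.
move=> n0; have nR : 0 < n%:R :> R by rewrite ltr0n.
have pi0 := @pi_gt0 R.
have zn : zexp n ^+ n = 1.
  apply/eqP; rewrite eq_sym -subr_eq0 -nc_eq0 nc_1Bzexp//.
  by rewrite (divff (lt0r_neq0 nR)) mulr1 sinpi mulr0.
have [m pm mn] := prim_order_exists n0 zn.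
have m0 := prim_order_gt0 pm; have := dvdn_leq n0 mn.
rewrite leq_eqVlt => /predU1P[e|ltmn]; first by rewrite -{1}e.
have : nc (1 - zexp n ^+ m) = 0 by rewrite (prim_expr_order pm) subrr nc0.
rewrite nc_1Bzexp ?(ltnW ltmn)// => /eqP.
rewrite mulf_eq0 pnatr_eq0/= gt_eqF// sin_gt0_pi// mulr_gt0 ?divr_gt0 ?ltr0n//=.
by rewrite gtr_pMr// ltr_pdivrMr// mul1r ltr_nat.
Qed.

(** At [z = 1] the convention [ln 0 = 0] gives 0, so that sums may run over all residues. *)
Definition lsq (z : R[i]) : R := ln (nc (1 - z) ^+ 2).

Lemma lsq1 : lsq 1 = 0.
Proof. by rewrite /lsq subrr nc0 expr0n ln0. Qed.

(** Both sides run over all [m]-th roots of unity. This transfers estimates from [zexp m] to any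
    primitive root. *)
Lemma sum_prim_roots (V : zmodType) (f : R[i] -> V) m z1 z2 :
  m.-primitive_root z1 -> m.-primitive_root z2 ->
  \sum_(c < m) f (z1 ^+ c) = \sum_(c < m) f (z2 ^+ c).
Proof.
move=> p1 p2.
have E z : \sum_(c < m) f (z ^+ c) = \sum_(y <- [seq z ^+ c | c <- index_iota 0 m]) f y.
  by rewrite big_map big_mkord.
rewrite (E z1) (E z2); apply: perm_big; have U (z : R[i]) : m.-primitive_root z ->
    uniq [seq z ^+ c | c <- index_iota 0 m].
  move=> pz; rewrite map_inj_in_uniq ?iota_uniq// => i j.
  rewrite !mem_index_iota => /= im jm /eqP.
  by rewrite (eq_prim_root_expr pz) !modn_small// => /eqP.
have memE (z x : R[i]) : m.-primitive_root z ->
    (x \in [seq z ^+ c | c <- index_iota 0 m]) = (x ^+ m == 1).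
  move=> pz; apply/mapP/eqP => [[i _ ->]|xm].
    by rewrite exprAC (prim_expr_order pz) expr1n.
  have [i ->] := prim_rootP pz xm; exists (i : nat) => //.
  by rewrite mem_index_iota/=.
by apply: uniq_perm; rewrite ?U// => x; rewrite (memE z1)// (memE z2).
Qed.

(** [lsq] is twice a logarithm, so the sum is 4 times the one bounded by [3 m / 2]. *)
Lemma sum_lsq_prim_le m z : m.-primitive_root z ->
  \sum_(c < m) lsq (z ^+ c) ^+ 2 <= 6 * m%:R.
Proof.
move=> pz; have m0 := prim_order_gt0 pz.
rewrite (sum_prim_roots (fun y => lsq y ^+ 2) pz (zexp_prim m0)).
rewrite -(big_mkord xpredT (fun c => lsq (zexp m ^+ c) ^+ 2)) big_ltn//.
rewrite expr0 lsq1 expr0n add0r.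
have := @sum_ln_sin_sqr_le R m m0; rewrite -(@ler_pM2l _ 4)// mulrA.
have -> : 4 * (3 / 2) = 6 :> R by lra.
apply: le_trans; rewrite mulr_sumr le_eqVlt; apply/orP; left; apply/eqP.
apply: eq_big_nat => c /andP[c0 cm]; rewrite /lsq nc_1Bzexp ?(ltnW cm)//.
rewrite lnXn; first by rewrite mulr2n; ring.
rewrite mulr_gt0// sin_gt0_pi// mulr_gt0 ?pi_gt0 ?divr_gt0 ?ltr0n//=.
by rewrite gtr_pMr ?pi_gt0// ltr_pdivrMr ?ltr0n// mul1r ltr_nat.
Qed.

(** [w ^ k] is primitive of order [m = n / gcd (k, n)], and the sum runs [n / m] times over its
    powers. *)
Lemma sum_lsq_le n w k : n.-primitive_root w ->
  \sum_(a < n) lsq (w ^+ (a * k)) ^+ 2 <= 6 * n%:R.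
Proof.
move=> pw; have pk := exp_prim_root pw k; set m := (n %/ gcdn k n)%N in pk.
have m0 := prim_order_gt0 pk.
have nE : n = (gcdn k n * m)%N by rewrite mulnC divnK// dvdn_gcdr.
have H d : \sum_(a < d * m) lsq (w ^+ (a * k)) ^+ 2 <= 6 * (d * m)%:R.
  elim: d => [|d IH]; first by rewrite big_ord0 mulr0.
  rewrite mulSn big_split_ord/= natrD mulrDr; apply: lerD.
    apply: le_trans (sum_lsq_prim_le pk); rewrite le_eqVlt; apply/orP; left.
    by apply/eqP/eq_bigr => a _; rewrite mulnC exprM.
  apply: le_trans IH; rewrite le_eqVlt; apply/orP; left.
  apply/eqP/eq_bigr => a _; rewrite mulnDl exprD [(m * k)%N]mulnC exprM.
  by rewrite (prim_expr_order pk) mul1r.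
by rewrite [in leRHS]nE; apply: le_trans (H _); rewrite -nE.
Qed.

Lemma is_derive_monomial (k : R) N (x : R) :
  is_derive x 1 (fun t => k / N.+1%:R * t ^+ N.+1) (k * x ^+ N).
Proof.
have -> : (fun t => k / N.+1%:R * t ^+ N.+1) = horner ((k / N.+1%:R) *: 'X^(N.+1)).
  by apply/funext => t; rewrite hornerZ hornerXn.
apply: is_derive_eq; rewrite derivZ derivXn hornerZ hornerMn hornerXn.
by rewrite -mulrA -(mulr_natl (x ^+ N)) mulKf// pnatr_eq0.
Qed.

Lemma is_derive_powsum (a : nat -> R) N (x : R) :
  is_derive x 1 (fun t => \sum_(m < N) a m / m.+1%:R * t ^+ m.+1)
    (\sum_(m < N) a m * x ^+ m).
Proof.
elim: N => [|N IH].
  rewrite big_ord0; apply: (@is_derive_eq _ _ _ _ _ _ 0) => //.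
  under eq_fun do rewrite big_ord0; exact: is_derive_cst.
rewrite big_ord_recr/=; under eq_fun do rewrite big_ord_recr/=.
by apply: is_deriveD; exact: is_derive_monomial.
Qed.

(* The derivative of the difference of both sides along the ray [t z] is
   [- Re (z (t z)^N / (1 - t z))], which is [O(t^N)]. *)
Lemma cos_series z : nc z = 1 -> z != 1 -> exists C : R, forall N,
  `|\sum_(m < N) complex.Re (z ^+ m.+1) / m.+1%:R + lsq z / 2| <= C / N.+1%:R.
Proof.
move=> z1 zn1; set c := complex.Re z.
have cs : c ^+ 2 + complex.Im z ^+ 2 = 1 by rewrite -nc_sqr z1 expr1n.
have c1 : c < 1.
  rewrite lt_neqAle; apply/andP; split; last by have := sqr_ge0 (complex.Im z); nra.
  apply: contraNneq zn1 => c1; move: cs; rewrite c1 expr1n => /eqP.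
  rewrite -subr_eq0 addrAC subrr add0r sqrf_eq0 => /eqP s0.
  by rewrite (complexE z) -/c c1 s0 mulr0 addr0.
pose p (t : R) := 1 - 2 * t * c + t ^+ 2.
(* Since [p t = (1 - t) ^ 2 + 2 t (1 - c)], it is at least [1 / 4 >= d] for [t <= 1 / 2], and at
   least [1 - c] beyond. *)
pose d := (1 - c) / 8.
have d0 : 0 < d by rewrite /d; lra.
have pd (t : R) : 0 <= t <= 1 -> d <= p t.
  move=> /andP[t0 t1]; rewrite /d /p; have [h|h] := leP t (1 / 2); last by nra.
  have cN : -1 <= c by have := sqr_ge0 (complex.Im z); nra.
  nra.
have pE (t : R) : nc (1 - t%:C * z) ^+ 2 = p t.
  rewrite nc_sqr /p; move: cs; rewrite /c; case: (z) => a b /= cs; simpc => /=.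
  have -> : 1 - 2 * t * a + t ^+ 2 = 1 - 2 * t * a + t ^+ 2 * (a ^+ 2 + b ^+ 2).
    by rewrite cs mulr1.
  by ring.
exists (Num.sqrt d)^-1 => N; set S := \sum_(m < N) _.
pose A m := complex.Re (z ^+ m.+1).
pose D (t : R) := \sum_(m < N) A m / m.+1%:R * t ^+ m.+1 + ln (p t) / 2.
pose D' (t : R) := \sum_(m < N) A m * t ^+ m + (t - c) / p t.
have D1 : D 1 = S + lsq z / 2.
  rewrite /D /S /lsq; congr (_ + ln _ / 2).
    by apply: eq_bigr => m _; rewrite expr1n mulr1.
  by rewrite -pE mul1r.
have D0 : D 0 = 0.
  rewrite /D /p mulr0 mul0r subr0 expr0n addr0 ln1 mul0r addr0 big1// => m _.
  by rewrite expr0n mulr0.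
have Dd (t : R) : 0 <= t <= 1 -> is_derive t 1 D (D' t).
  move=> t01; have p0 : 0 < p t by apply: lt_le_trans d0 (pd _ t01).
  rewrite /D /D'; apply: is_deriveD; first exact: is_derive_powsum.
  have dp : is_derive t 1 p (2 * (t - c)).
    by rewrite /p; apply: is_derive_eq; rewrite !scale_mulE; ring.
  have dl := is_derive1_ln p0.
  have dlp : is_derive t 1 (fun u => ln (p u)) ((p t)^-1 * (2 * (t - c))).
    exact: (@is_derive1_comp _ (@ln R) p).
  apply: is_derive_eq; rewrite !scale_mulE; field; lra.
have D'E (t : R) : 0 <= t <= 1 -> `|D' t| <= t ^+ N / Num.sqrt d.
  move=> t01; have p0 : 0 < p t by apply: lt_le_trans d0 (pd _ t01).
  have /andP[t0 t1] := t01.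
  have u0 : 1 - t%:C * z != 0.
    by rewrite -nc_eq0 -sqrf_eq0 pE gt_eqF.
  have E1 : \sum_(m < N) A m * t ^+ m =
      complex.Re (z * (1 - (t%:C * z) ^+ N) / (1 - t%:C * z)).
    have -> : z * (1 - (t%:C * z) ^+ N) / (1 - t%:C * z) =
        \sum_(m < N) (t ^+ m)%:C * z ^+ m.+1.
      apply: (mulIf u0); rewrite divfK// -opprB subrX1 -mulNr opprB mulrCA mulrC.
      congr (_ * _); rewrite mulr_sumr; apply: eq_bigr => m _.
      by rewrite exprMn rmorphXn exprS; ring.
    rewrite raddf_sum; apply: eq_bigr => m _; rewrite /A mulrC.
    by case: (z ^+ m.+1) => a b; simpc.
  have E2 : (c - t) / p t = complex.Re (z / (1 - t%:C * z)).
    set q := z / _; have qz : z = q * (1 - t%:C * z) by rewrite divfK.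
    apply: (mulIf (lt0r_neq0 p0)); rewrite divfK ?lt0r_neq0// -pE nc_sqr.
    have ct : c - t = c - t * (c ^+ 2 + complex.Im z ^+ 2) by rewrite cs mulr1.
    rewrite ct /c; case: q qz => q1 q2; case: (z) => a b /=; simpc => -[ea eb].
    have -> : a - t * (a ^+ 2 + b ^+ 2) = (1 - t * a) * a - (t * b) * b by ring.
    transitivity ((1 - t * a) * (q1 * (1 - t * a) + q2 * (t * b)) -
      t * b * (- (q1 * (t * b)) + q2 * (1 - t * a))); last by ring.
    by rewrite -ea -eb.
  have -> : D' t = - complex.Re (z * (t%:C * z) ^+ N / (1 - t%:C * z)).
    have e : (t - c) / p t = - ((c - t) / p t) by rewrite -mulNr opprB.
    rewrite /D' e E2 E1 -raddfB/= -mulrBl mulrBr mulr1 addrAC subrr sub0r.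
    by rewrite mulNr raddfN.
  rewrite normrN; apply: le_trans (normr_Re_le _) _.
  rewrite !ncM Normc.normcV ncX ncM z1 mulr1 mul1r nc_real_ge0//.
  rewrite ler_wpM2l ?exprn_ge0// lef_pV2 ?posrE ?sqrtr_gt0//; last first.
    by rewrite lt_neqAle nc_ge0 eq_sym nc_eq0 u0.
  by rewrite -[nc _]ger0_norm ?nc_ge0// -sqrtr_sqr ler_wsqrtr// pE pd.
have sd : 0 < Num.sqrt d by rewrite sqrtr_gt0.
have Hd (t : R) : is_derive t 1
    (fun t => (Num.sqrt d)^-1 / N.+1%:R * t ^+ N.+1) (t ^+ N / Num.sqrt d).
  by rewrite [t ^+ N / _]mulrC; exact: is_derive_monomial.
(* The bound on [D'] is integrated by monotonicity: the primitive of [t ^ N / sqrt d], plus or minus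
   [D], is nondecreasing. *)
rewrite -D1 ler_norml; apply/andP; split.
  have := @ger0_derive_le R (fun t => (Num.sqrt d)^-1 / N.+1%:R * t ^+ N.+1 + D t)
    (fun t => t ^+ N / Num.sqrt d + D' t) 0 1 ler01.
  rewrite D0 expr0n/= mulr0 expr1n addr0 mulr1 => H.
  suff h : 0 <= (Num.sqrt d)^-1 / N.+1%:R + D 1.
    by rewrite -subr_ge0 opprK addrC.
  apply: H => t t01; first by apply: is_deriveD; exact: Dd.
  have /D'E : 0 <= t <= 1 by case/andP: t01 => /ltW-> /ltW->.
  by rewrite ler_norml => /andP[]; lra.
have := @ger0_derive_le R (fun t => (Num.sqrt d)^-1 / N.+1%:R * t ^+ N.+1 - D t)
  (fun t => t ^+ N / Num.sqrt d - D' t) 0 1 ler01.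
rewrite D0 expr0n/= mulr0 expr1n subr0 mulr1 => H.
suff h : 0 <= (Num.sqrt d)^-1 / N.+1%:R - D 1 by rewrite -subr_ge0.
apply: H => t t01; first by apply: is_deriveB; exact: Dd.
have /D'E : 0 <= t <= 1 by case/andP: t01 => /ltW-> /ltW->.
by rewrite ler_norml => /andP[]; lra.
Qed.
End UnityRoots.

(** The matrices are restricted to coordinates on [W]; an eigenvector found there is carried back by
    [row_base W]. *)
Lemma common_eigenvector_in (C : numClosedFieldType) (q : nat)
    (W : 'M[C]_q) (As : seq 'M[C]_q) :
  W != 0 -> {in As &, forall A B, comm_mx A B} ->
  {in As, forall A, stablemx W A} ->
  exists2 v : 'rV_q, (v != 0) && (v <= W)%MS & all (fun A => stablemx v A) As.
Proof.
move=> W0 Acom Ast.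
have r0 : (0 < \rank W)%N by rewrite lt0n mxrank_eq0.
have [|v v0 /allP/= vP] := @common_eigenvector C _ [seq restrictmx W B | B <- As] r0.
  move=> _ _ /mapP[/= B BA ->] /mapP[/= B' BA' ->].
  rewrite /comm_mx -?conjmxM ?inE ?stablemx_row_base ?Ast//.
  by congr conjmx; exact: Acom.
exists (v *m row_base W).
  by rewrite mulmx_free_eq0 ?row_base_free// v0 mulmx_sub// eq_row_base.
apply/allP => B BA; rewrite -stablemx_restrict ?vP ?Ast//.
by apply/mapP; exists B.
Qed.

(** * Even functions on the units of [Z / n] *)

Section UnitCharacters.
Context {R : realType}.
Local Open Scope complex_scope.
Local Notation nc := (@Normc.normc R).
Variable N : nat.
Local Notation n := N.+2.
Local Notation U := {unit 'Z_n}.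
Variable w : R[i].
Hypothesis pw : n.-primitive_root w.
Implicit Types (x y k : 'Z_n) (u v t : U).

Definition wexp x : R[i] := w ^+ (x : nat).

Lemma wexp_nat m : wexp m%:R = w ^+ m.
Proof. by rewrite /wexp val_Zp_nat// (prim_expr_mod pw). Qed.

Lemma wexpD x y : wexp (x + y) = wexp x * wexp y.
Proof. by rewrite -[x]natr_Zp -[y]natr_Zp -natrD !wexp_nat exprD. Qed.

Lemma wexp0 : wexp 0 = 1. Proof. exact: expr0. Qed.

Lemma wexpMn x m : wexp (m%:R * x) = wexp x ^+ m.
Proof. by rewrite -[x]natr_Zp -natrM !wexp_nat mulnC exprM. Qed.

Lemma wexp_eq1 x : (wexp x == 1) = (x == 0).
Proof.
rewrite /wexp -(prim_order_dvd pw); apply/idP/eqP => [|->//].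
have [x0 _|x0 xn] := eqVneq (x : nat) 0%N; first exact: val_inj.
have := dvdn_leq _ xn; rewrite lt0n x0 => /(_ isT).
by rewrite leqNgt (ltn_ord x).
Qed.

Lemma nc_wexp x : nc (wexp x) = 1.
Proof.
apply/eqP; rewrite -(@pexpr_eq1 _ _ n) ?nc_ge0//.
by rewrite -ncX /wexp -exprM mulnC exprM (prim_expr_order pw) expr1n nc1.
Qed.

Lemma conj_wexp x : conjc (wexp x) = wexp (- x).
Proof.
have w0 : wexp x != 0 by rewrite -nc_eq0 nc_wexp oner_eq0.
apply: (mulfI w0); rewrite -wexpD subrr wexp0.
have := nc_wexp x; rewrite -[RHS]/1 => e; rewrite -sqr_normc normr_normc e.
by rewrite expr1n.
Qed.

Definition ell x : R := lsq (wexp x).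

Lemma ell0 : ell 0 = 0. Proof. by rewrite /ell wexp0 lsq1. Qed.

Lemma ellN x : ell (- x) = ell x.
Proof.
have w0 : wexp x != 0 by rewrite -nc_eq0 nc_wexp oner_eq0.
rewrite /ell /lsq; congr (ln (_ ^+ 2)).
rewrite -[LHS]mul1r -(nc_wexp x) -ncM mulrBr mulr1 -wexpD subrr wexp0 ncBC.
by [].
Qed.

Lemma sum_wexp x : \sum_(k : 'Z_n) wexp (k * x) = if x == 0 then n%:R else 0.
Proof.
have [->|x0] := eqVneq x 0.
  under eq_bigr do rewrite mulr0 wexp0.
  by rewrite sumr_const card_ord.
apply/eqP; set S := \sum_k _.
have : wexp x * S = S.
  rewrite /S mulr_sumr [RHS](reindex_inj (addrI 1)); apply: eq_bigr => k _.
  by rewrite mulrDl mul1r wexpD.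
move=> /eqP; rewrite -subr_eq0 -{2}[S]mul1r -mulrBl mulf_eq0 subr_eq0.
by rewrite wexp_eq1 (negbTE x0).
Qed.

Section Character.
Variable chi : U -> R[i].
Hypotheses (chi1 : chi 1%g = 1) (chiM : forall u v, chi (u * v)%g = chi u * chi v).
Hypothesis chiN : forall u v, val v = - val u -> chi v = chi u.
Hypothesis chi_sum : \sum_u chi u = 0.
Hypothesis chi_ell : forall k, \sum_u chi u * (ell (val u * k))%:C = 0.

Let chi_neq0 u : chi u != 0.
Proof.
apply/eqP => u0; have := chiM u u^-1; rewrite mulgV chi1 u0 mul0r.
by move=> /eqP; rewrite oner_eq0.
Qed.

Let chiV u : chi u^-1%g = (chi u)^-1.
Proof. by apply: (mulfI (chi_neq0 u)); rewrite -chiM mulgV chi1 mulfV. Qed.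

Let chiV_sum : \sum_u (chi u)^-1 = 0.
Proof.
rewrite (reindex_inj invg_inj)/= -[RHS]chi_sum.
by apply: eq_bigr => u _; rewrite chiV invrK.
Qed.

(** The inverse of [chi], extended by zero: the sum has at most one term. *)
Definition dchar (m : nat) : R[i] := \sum_(u | val u == m%:R) (chi u)^-1.

Lemma dchar_unit u m : val u = m%:R -> dchar m = (chi u)^-1.
Proof.
move=> um; rewrite /dchar (big_pred1 u)// => v; rewrite -um.
by apply/eqP/eqP => [/val_inj|->].
Qed.

Lemma dchar_nonunit m : ~~ coprime m n -> dchar m = 0.
Proof.
move=> mn; rewrite /dchar big_pred0// => u; apply/negbTE; apply: contra mn => /eqP um.
by have := valP u; rewrite /= um unitZpE// coprime_sym.
Qed.

Lemma coprime_unit m : coprime m n -> exists u, val u = m%:R.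
Proof.
rewrite coprime_sym -unitZpE// => mu.
by exists (FinRing.unit _ mu).
Qed.

Lemma dchar_dirichlet : dirichlet_char n dchar.
Proof.
split=> [|a b|a|a].
- by rewrite (@dchar_unit 1%g)// chi1 invr1.
- have [an|an] := boolP (coprime a n); last first.
    rewrite (dchar_nonunit an) mul0r dchar_nonunit// coprimeMl.
    by rewrite (negbTE an).
  have [bn|bn] := boolP (coprime b n); last first.
    rewrite (dchar_nonunit bn) mulr0 dchar_nonunit// coprimeMl.
    by rewrite (negbTE bn) andbF.
  have [u ua] := coprime_unit an; have [v vb] := coprime_unit bn.
  rewrite (dchar_unit ua) (dchar_unit vb) (@dchar_unit (u * v)%g).
    by rewrite chiM invfM.
  by rewrite FinRing.val_unitM ua vb natrM.
- rewrite /dchar; apply: eq_bigl => u.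
  by rewrite natrD (_ : n%:R = 0 :> 'Z_n) ?addr0// pchar_Zp.
- exact: dchar_nonunit.
Qed.

Lemma dchar_nontrivial : exists2 a, coprime a n & dchar a != 1.
Proof.
have [u u1] : exists u, chi u != 1.
  apply/existsP; rewrite -negb_forall; apply/negP => /forallP h.
  have := chi_sum; rewrite (eq_bigr (fun=> 1)); last by move=> u _; apply/eqP.
  by rewrite sumr_const => /eqP; rewrite pnatr_eq0 => /eqP/card0_eq/(_ 1%g).
exists (val u : nat).
  by rewrite coprime_sym -unitZpE// natr_Zp; exact: (valP u).
by rewrite (@dchar_unit u) ?natr_Zp// invr_eq1.
Qed.

(** Fourier transform on all of [Z / n] of the inverse of [chi] extended by zero, that is, a Gauss
    sum at each [k]. *)
Let hat k : R[i] := \sum_u (chi u)^-1 * wexp (- (k * val u)).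

Let hat_fourier m : n%:R * dchar m = \sum_k hat k * wexp k ^+ m.
Proof.
rewrite /hat; under eq_bigr do rewrite mulr_suml.
rewrite exchange_big/= /dchar mulr_sumr big_mkcond/=; apply: eq_bigr => u _.
under eq_bigr => k _ do
  rewrite -mulrA -wexpMn -wexpD addrC [m%:R * k]mulrC -mulrBr.
rewrite -mulr_sumr sum_wexp subr_eq0 eq_sym mulrC.
by case: ifP => // _; rewrite mulr0.
Qed.

Let mone : U := FinRing.unit _ (unitrN1 'Z_n).

Let hatN k : hat (- k) = hat k.
Proof.
rewrite /hat (reindex_inj (mulgI mone)); apply: eq_bigr => u _.
have e : val (mone * u)%g = - val u by rewrite FinRing.val_unitM mulN1r.
by rewrite e mulrNN (chiN e).
Qed.

(** Removes the term [k = 0], at which the series of [ln |1 - w ^ k|] diverges. *)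
Let hat0 : hat 0 = 0.
Proof.
rewrite /hat -[RHS]chiV_sum; apply: eq_bigr => u _.
by rewrite mul0r oppr0 wexp0 mulr1.
Qed.

Let hatM u k : hat (val u * k) = chi u * hat k.
Proof.
rewrite /hat mulr_sumr [RHS](reindex_inj (mulgI u)); apply: eq_bigr => v _ /=.
rewrite chiM invfM !mulrA mulfV// mul1r; congr (_ * wexp (- _)).
by congr (_ * _); rewrite mulrC.
Qed.

(** By evenness the terms at [k] and [- k] combine, leaving the real parts to which [cos_series]
    applies. *)
Let hat_fourier_Re m :
  n%:R * dchar m = \sum_k hat k * (complex.Re (wexp k ^+ m))%:C.
Proof.
have e2 : n%:R * dchar m = \sum_k hat k * wexp (- k) ^+ m.
  rewrite hat_fourier (reindex_inj oppr_inj)/=.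
  by apply: eq_bigr => k _; rewrite hatN.
have two : 2 != 0 :> R[i] by rewrite pnatr_eq0.
apply: (mulfI two); rewrite -{1}[2]/(1 + 1) mulrDl mul1r {1}hat_fourier e2.
rewrite -big_split/= mulr_sumr; apply: eq_bigr => k _.
by rewrite -mulrDr mulrCA -addcJ rmorphXn /= conj_wexp.
Qed.

(** Substituting [val u * k] for [k] pulls out [chi u]; summed over all [u], the coefficient of
    [hat k] is the sum in [chi_ell k]. Here [k] runs through all residues, not only units. *)
Let hat_ell : \sum_k hat k * (ell k)%:C = 0.
Proof.
have q0 : \sum_(u : U) (1 : R[i]) != 0.
  by rewrite sumr_const pnatr_eq0; apply/eqP => /card0_eq/(_ 1%g).
apply: (mulfI q0); rewrite mulr0 mulr_suml.
rewrite (eq_bigr (fun u => \sum_k hat k * (chi u * (ell (val u * k))%:C))).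
  rewrite exchange_big/= big1// => k _.
  by rewrite -mulr_sumr chi_ell mulr0.
move=> u _; rewrite mul1r (reindex_inj (mulrI (valP u)))/=.
by apply: eq_bigr => k _; rewrite hatM -mulrA mulrCA.
Qed.

(** Multiplied by [n], the partial sum is the combination of partial cosine sums with weights
    [hat k]. Adding [ell k / 2] to each changes nothing by [hat_ell] and makes each [O(1 / M)]. *)
Lemma dchar_vanishing : vanishing_L1 dchar.
Proof.
have H k : exists C : R, forall M, 0 <= C /\ (k != 0 ->
    `|\sum_(m < M) complex.Re (wexp k ^+ m.+1) / m.+1%:R + ell k / 2| <= C / M.+1%:R).
  have [->|k0] := eqVneq k 0; first by exists 0 => M.
  have [C HC] := cos_series (nc_wexp k) (negbT (etrans (wexp_eq1 k) (negbTE k0))).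
  exists C => M; split => [|_]; last exact: HC.
  by have := le_trans (normr_ge0 _) (HC 0%N); rewrite divr1.
have [C HC] := choice H.
exists (\sum_k nc (hat k) * C k) => M.
have n0 : n%:R != 0 :> R[i] by rewrite pnatr_eq0.
have E : n%:R * \sum_(m < M) dchar m.+1 * (m.+1%:R^-1)%:C =
    \sum_k hat k * (\sum_(m < M) complex.Re (wexp k ^+ m.+1) / m.+1%:R + ell k / 2)%:C.
  have -> : \sum_k hat k * (\sum_(m < M) complex.Re (wexp k ^+ m.+1) / m.+1%:R + ell k / 2)%:C
    = \sum_k hat k * (\sum_(m < M) complex.Re (wexp k ^+ m.+1) / m.+1%:R)%:C.
    under eq_bigr do rewrite rmorphD mulrDr.
    rewrite big_split/= [X in _ + X](eq_bigr (fun k => hat k * (ell k)%:C * (2^-1)%:C)).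
      by rewrite -mulr_suml hat_ell mul0r addr0.
    by move=> k _; rewrite rmorphM mulrA.
  rewrite mulr_sumr; under [RHS]eq_bigr do rewrite rmorph_sum mulr_sumr.
  rewrite [RHS]exchange_big/=; apply: eq_bigr => m _.
  rewrite mulrA hat_fourier_Re mulr_suml; apply: eq_bigr => k _.
  by rewrite rmorphM mulrA.
have nn : 1 <= nc n%:R.
  have -> : n%:R = (n%:R)%:C :> R[i] by rewrite rmorph_nat.
  by rewrite nc_real_ge0 ?ler0n// ler1n.
apply: (@le_trans _ _ (nc (n%:R * \sum_(m < M) dchar m.+1 * (m.+1%:R^-1)%:C))).
  by rewrite ncM ler_peMl ?nc_ge0.
rewrite E; apply: le_trans (nc_sum _ _ _) _; rewrite mulr_suml.
apply: ler_sum => k _; have [C0 Ck] := HC k M.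
have [->|k0] := eqVneq k 0.
  by rewrite hat0 mul0r nc0 mulr_ge0 ?mulr_ge0 ?invr_ge0 ?(HC 0 M).1.
by rewrite ncM nc_real -mulrA ler_wpM2l ?nc_ge0// Ck.
Qed.

Lemma no_such_character : False.
Proof.
exact: (@L1_nonvanishing R n dchar (isT : (1 < n)%N) dchar_dirichlet dchar_nontrivial
  dchar_vanishing).
Qed.
End Character.

(* A translation-invariant space of functions on the abelian group [U]
   contains a character as soon as it is nonzero. *)
Lemma even_function_eq0 (G : U -> R[i]) :
  (forall u v, val v = - val u -> G v = G u) ->
  \sum_u G u = 0 ->
  (forall k, \sum_u G u * (ell (val u * k))%:C = 0) ->
  forall u, G u = 0.
Proof.
move=> GN GS Gell u; apply/eqP; move: u; apply/forallP/negPn/negP.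
rewrite negb_forall => /existsP[u0 Gu0].
pose q := #|{: U}|.
pose mone : U := FinRing.unit _ (unitrN1 'Z_n).
(* One linear form per condition on [G]: sum zero, orthogonality to [ell (val u * k)], evenness at
   [v]. The kernel of [M] is the space of all such functions. *)
pose J : finType := option ('Z_n + U)%type.
pose L (j : J) (u : U) : R[i] := match j with
  | None => 1
  | Some (inl k) => (ell (val u * k))%:C
  | Some (inr v) => (u == v)%:R - (u == (mone * v)%g)%:R
  end.
pose M : 'M[R[i]]_(q, #|J|) := \matrix_(i, j) L (enum_val j) (enum_val i).
pose fn (v : 'rV[R[i]]_q) (u : U) : R[i] := v ord0 (enum_rank u).
have inj_val u v : (val u == val v) = (u == v) by [].
have sumE (f : 'I_q -> R[i]) : \sum_i f i = \sum_u f (enum_rank u).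
  by rewrite (reindex (@enum_rank U))//; exact/onW_bij/enum_rank_bij.
have kerP (v : 'rV_q) : (v *m M == 0) = [forall j, \sum_u fn v u * L j u == 0].
  apply/eqP/forallP => [vM j|h].
    have /rowP/(_ (enum_rank j)) := vM; rewrite !mxE => e; rewrite -[X in _ == X]e.
    apply/eqP; rewrite sumE; apply: eq_bigr => u _.
    by rewrite mxE !enum_rankK.
  apply/rowP => j; rewrite !mxE -[RHS](eqP (h (enum_val j))) sumE.
  by apply: eq_bigr => u _; rewrite mxE enum_rankK.
(* Translation by [t] as a matrix; these matrices commute and, by [stab], preserve the kernel of
   [M]. *)
pose A t : 'M[R[i]]_q := \matrix_(i, j) (enum_val i == (t * enum_val j)%g)%:R.
have fA t (v : 'rV_q) u : fn (v *m A t) u = fn v (t * u)%g.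
  rewrite /fn mxE (bigD1 (enum_rank (t * u)%g))//= mxE !enum_rankK eqxx mulr1.
  rewrite big1 ?addr0// => i iN; rewrite mxE enum_rankK.
  have -> : (enum_val i == (t * u)%g) = false.
    by apply: contraNF iN => /eqP <-; rewrite enum_valK.
  by rewrite mulr0.
have rvP (v v' : 'rV[R[i]]_q) : (forall u, fn v u = fn v' u) -> v = v'.
  by move=> h; apply/rowP => i; rewrite -(enum_valK i); exact: h.
have mulC u v : (u * v = v * u)%g by apply: val_inj; rewrite /= mulrC.
have stab (v : 'rV_q) : v *m M == 0 -> forall t, v *m A t *m M == 0.
  rewrite kerP => /forallP h t; rewrite kerP; apply/forallP => j; apply/eqP.
  rewrite (eq_bigr (fun u => fn v (t * u)%g * L j u)); last by move=> u _; rewrite fA.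
  rewrite (reindex_inj (mulgI t^-1%g))/=; case: j => [[k|v']|].
  - rewrite -[RHS](eqP (h (Some (inl (val t^-1%g * k))))); apply: eq_bigr => u _.
    by rewrite mulKVg /= mulrCA mulrA.
  - rewrite -[RHS](eqP (h (Some (inr (t * v')%g)))); apply: eq_bigr => u _.
    rewrite mulKVg /=; congr (_ * ((_ : bool)%:R - (_ : bool)%:R)).
      by apply/eqP/eqP => [<-|->]; rewrite ?mulKVg ?mulKg.
    rewrite mulgA [(mone * t)%g]mulC -mulgA.
    by apply/eqP/eqP => [<-|->]; rewrite ?mulKVg ?mulKg.
  - rewrite -[RHS](eqP (h None)); apply: eq_bigr => u _.
    by rewrite mulKVg.
have K0 : kermx M != 0.
  apply/negP => /eqP K0; pose g : 'rV[R[i]]_q := \row_i G (enum_val i).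
  have gG u : fn g u = G u by rewrite /fn mxE enum_rankK.
  have : (g <= kermx M)%MS.
    apply/sub_kermxP/eqP; rewrite kerP; apply/forallP => -[[k|v]|] /=.
    - by apply/eqP; rewrite -[RHS](Gell k); apply: eq_bigr => u _; rewrite gG.
    - under eq_bigr do rewrite gG mulrBr.
      rewrite sumrB (bigD1 v)//= eqxx mulr1 big1 ?addr0; last first.
        by move=> u /negbTE->; rewrite mulr0.
      rewrite (bigD1 (mone * v)%g)//= eqxx mulr1 big1 ?addr0; last first.
        by move=> u /negbTE->; rewrite mulr0.
      by rewrite (GN v (mone * v)%g) ?subrr//= mulN1r.
    - by under eq_bigr do rewrite gG mulr1; rewrite GS.
  rewrite K0 submx0 => /eqP g0; move: Gu0; rewrite -gG g0 /fn mxE eqxx//.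
have [||v /andP[v0 vK] /allP/= vst] := @common_eigenvector_in _ _ (kermx M) [seq A t | t : U] K0.
- move=> _ _ /mapP[/= s _ ->] /mapP[/= t _ ->].
  apply/row_matrixP => i; rewrite !rowE !mulmxA; apply: rvP => u.
  by rewrite !fA !mulgA [(s * t)%g]mulC.
- move=> _ /mapP[/= t _ ->]; apply/row_subP => i; apply/sub_kermxP/eqP.
  rewrite row_mul; apply: stab; rewrite -row_mul mulmx_ker row0//.
have eig t : exists a, forall u, fn v (t * u)%g = a * fn v u.
  have : stablemx v (A t) by apply: vst; apply/mapP; exists t; rewrite ?mem_enum.
  move=> /sub_rVP[a e]; exists a => u.
  by rewrite -fA e /fn mxE.
have [a aP] := choice eig.
have [u1 vu1] : exists u, fn v u != 0.
  apply/existsP; rewrite -negb_forall; apply: contra v0 => /forallP h.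
  by apply/eqP/rvP => u; rewrite (eqP (h u)) /fn mxE.
(* A common eigenvector satisfies [v (t u) = a t * v u], so it does not vanish at 1 and is
   proportional to the character [a]. *)
have f1 : fn v 1%g != 0.
  by apply: contraNneq vu1 => f1; rewrite -[u1]mulg1 aP f1 mulr0.
have aE t : a t = fn v t / fn v 1%g.
  by rewrite -[X in fn v X / _]mulg1 aP mulfK.
have vM : v *m M == 0 by apply/eqP/sub_kermxP.
move: vM; rewrite kerP => /forallP vM.
have aL j : \sum_u a u * L j u = 0.
  under eq_bigr do rewrite aE mulrAC.
  by rewrite -mulr_suml (eqP (vM j)) mul0r.
apply: (@no_such_character a).
- by rewrite aE mulfV.
- by move=> s t; rewrite !aE aP aE; field.
- move=> u u' e; have -> : u' = (mone * u)%g.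
    by apply: val_inj; rewrite e /= mulN1r.
  have := aL (Some (inr u)); rewrite /=.
  under eq_bigr do rewrite mulrBr.
  rewrite sumrB (bigD1 u)//= eqxx mulr1 big1 ?addr0; last first.
    by move=> t /negbTE->; rewrite mulr0.
  rewrite (bigD1 (mone * u)%g)//= eqxx mulr1 big1 ?addr0; last first.
    by move=> t /negbTE->; rewrite mulr0.
  by move=> /eqP; rewrite subr_eq0 => /eqP.
- by have := aL None; under eq_bigr do rewrite /= mulr1.
- by move=> k; exact: (aL (Some (inl k))).
Qed.
End UnitCharacters.

(** * Embeddings of cyclotomic fields *)

Section RationalCyclotomic.
Variable n : nat.
Hypothesis n0 : (0 < n)%N.

Definition ratPhi : {poly rat} := map_poly intr ('Phi_n).

Lemma size_ratPhi : size ratPhi = (totient n).+1.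
Proof.
by rewrite /ratPhi size_map_inj_poly ?size_Cyclotomic//; exact: intr_inj.
Qed.

Variables (F : fieldType) (h : {rmorphism rat -> F}).

Lemma map_ratPhi : map_poly h ratPhi = map_poly intr ('Phi_n).
Proof.
by rewrite /ratPhi -map_poly_comp; apply: eq_map_poly => z /=; rewrite rmorph_int.
Qed.

(** Among the factors [Phi_d] of [X ^ n - 1], only [d = n] can vanish at an element of exact order
    [n]. *)
Lemma ratPhi_root (v : F) : n.-primitive_root v -> root (map_poly h ratPhi) v.
Proof.
move=> pv; rewrite map_ratPhi.
have vn : root (map_poly intr ('X^n - 1 : {poly int})) v.
  rewrite rmorphB rmorph1 /= map_polyXn rootE !hornerE.
  by rewrite (prim_expr_order pv) subrr.
move: vn; rewrite -(prod_Cyclotomic n0) rmorph_prod/= rootE horner_prod.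
rewrite prodf_seq_eq0 => /hasP[d dn /= vd].
have dn' : (d %| n)%N by rewrite dvdn_divisors.
have d0 : (0 < d)%N := dvdn_gt0 n0 dn'.
suff e : d = n by rewrite rootE -e.
apply/eqP; rewrite eqn_dvd dn' (prim_order_dvd pv) -subr_eq0.
have : root (map_poly intr ('X^d - 1 : {poly int})) v.
  rewrite -(prod_Cyclotomic d0) rmorph_prod/= rootE horner_prod prodf_seq_eq0.
  by apply/hasP; exists d => //; rewrite -dvdn_divisors.
by rewrite rmorphB rmorph1 /= map_polyXn rootE !hornerE.
Qed.

(** Irreducibility of [Phi_n], taken from [algC], where it is a minimal polynomial: its gcd with [q]
    is either a multiple of [Phi_n] or constant, and the common root [v] excludes the latter. *)
Lemma ratPhi_min (v : F) (q : {poly rat}) :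
  n.-primitive_root v -> root (map_poly h q) v -> ratPhi %| q.
Proof.
move=> pv qv; have [y py] := C_prim_root_exists n0.
have [p [pE pm] pP] := minCpolyP y.
have pPhi : p = ratPhi.
  apply: (@map_inj_poly _ _ (ratr : rat -> algC)).
  - exact: fmorph_inj.
  - by rewrite rmorph0.
  rewrite -pE (minCpoly_cyclotomic py) -(Cintr_Cyclotomic py) -map_poly_comp.
  by apply: eq_map_poly => z /=; rewrite rmorph_int.
have y0 : root (map_poly ratr ratPhi) y by rewrite pP pPhi dvdpp.
have phi0 : ratPhi != 0 by rewrite -size_poly_gt0 size_ratPhi.
set g := gcdp ratPhi q; have gP : g %| ratPhi by exact: dvdp_gcdl.
have : root (map_poly ratr (ratPhi %/ g * g)) y by rewrite divpK.
rewrite rmorphM rootM => /orP[]; last first.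
  by rewrite pP pPhi => /dvdp_trans; apply; exact: dvdp_gcdr.
rewrite pP pPhi => dv; have g1 : size g == 1%N.
  have kg := divpK gP; have := dvdp_leq _ dv; have := phi0; rewrite -{1}kg mulf_eq0 negb_or.
  move=> /andP[k0 g0] /(_ k0); rewrite -{1}kg size_mul//.
  move: k0 g0; rewrite -!size_poly_gt0.
  by move: (size (ratPhi %/ g)) (size g) => a b; lia.
have : coprimep (map_poly h ratPhi) (map_poly h q) by rewrite coprimep_map.
move=> /coprimep_root /(_ (ratPhi_root pv)).
by rewrite -rootE qv.
Qed.
End RationalCyclotomic.

(** The equation is moved to [algC], where rational algebraic integers are integers. *)
Lemma integral_rat_int (K : fieldExtType rat) (q : rat) :
  integralOver (intr : int -> K) q%:A -> exists z : int, q = z%:~R.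
Proof.
move=> [p pm]; have -> : map_poly intr p = map_poly (in_alg K) (map_poly intr p).
  rewrite -map_poly_comp; apply: eq_map_poly => z.
  exact/esym/(rmorph_int (in_alg K)).
rewrite -[q%:A]/(in_alg K q) fmorph_root => qp.
have /Cint_rat_Aint : (ratr q : algC) \in Crat by exact: Crat_rat.
have -> : (ratr q : algC) \in Aint.
  apply: (@root_monic_Aint (map_poly ratr (map_poly intr p))).
  - by rewrite fmorph_root.
  - by rewrite map_monic monic_map.
  - apply/polyOverP => i; rewrite !coef_map/= rmorph_int; exact: intr_int.
move=> /(_ isT)/intrP[z e]; exists z.
have : ratr q = ratr z%:~R :> algC by rewrite e rmorph_int.
exact: fmorph_inj.
Qed.

Section CyclotomicField.
Variables (n : nat) (K : fieldExtType rat) (zeta : K).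
Hypotheses (n0 : (0 < n)%N) (pz : n.-primitive_root zeta).
Hypothesis zfull : <<1; zeta>>%VS = fullv.

Lemma cyclo_polyP (x : K) : exists2 P : {poly rat},
  (size P <= totient n)%N & x = (map_poly (in_alg K) P).[zeta].
Proof.
have /Fadjoin_polyP[p /polyOver1P[P ->] xE] : x \in <<1%VS; zeta>>%VS.
  by rewrite zfull memvf.
exists (P %% ratPhi n).
  by rewrite -ltnS -size_ratPhi ltn_modp -size_poly_gt0 size_ratPhi.
rewrite xE {1}(divp_eq P (ratPhi n)) rmorphD rmorphM /= hornerD hornerM.
by rewrite (eqP (ratPhi_root n0 (in_alg K) pz)) mulr0 add0r.
Qed.

Lemma rmorph_horner_zeta (F : fieldType) (h : {rmorphism rat -> F})
    (phi : {rmorphism K -> F}) (P : {poly rat}) :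
  phi (map_poly (in_alg K) P).[zeta] = (map_poly h P).[phi zeta].
Proof.
rewrite -horner_map -map_poly_comp; congr (_.[_]); apply: eq_map_poly => a.
by rewrite (fmorph_eq_rat h) -(fmorph_eq_rat (phi \o in_alg K)).
Qed.

Lemma rmorph_zeta_eq (F : fieldType) (phi psi : {rmorphism K -> F}) :
  phi zeta = psi zeta -> phi =1 psi.
Proof.
move=> e x; have [P _ ->] := cyclo_polyP x.
by rewrite !(rmorph_horner_zeta (phi \o in_alg K)) e.
Qed.

(** Evaluates at [v] a chosen polynomial expressing [x] in [zeta]. By [ratPhi_min] the value does
    not depend on the choice, so sums and products are respected. *)
Lemma rmorph_zeta_exists (F : fieldType) (h : {rmorphism rat -> F}) (v : F) :
  n.-primitive_root v -> exists phi : {rmorphism K -> F}, phi zeta = v.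
Proof.
move=> pv.
have [Q QE] := choice (fun x => (let: ex_intro2 P _ e := cyclo_polyP x in ex_intro _ P e)
  : exists P, x = (map_poly (in_alg K) P).[zeta]).
pose f x := (map_poly h (Q x)).[v].
have key x P : x = (map_poly (in_alg K) P).[zeta] -> f x = (map_poly h P).[v].
  move=> xE; apply/eqP; rewrite /f -subr_eq0 -hornerN -hornerD -rmorphB/= -rootE.
  have /dvdpP[k ->] : ratPhi n %| Q x - P.
    apply: (ratPhi_min n0 (h := in_alg K) pz).
    by rewrite rmorphB /= rootE hornerD hornerN -QE -xE subrr.
  by rewrite rmorphM rootM (ratPhi_root n0 h pv) orbT.
have fB : zmod_morphism f.
  move=> x y; rewrite (key (x - y) (Q x - Q y)).
    by rewrite rmorphB /= hornerD hornerN.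
  by rewrite rmorphB /= hornerD hornerN -!QE.
have fM : monoid_morphism f.
  split=> [|x y].
    by rewrite (key 1 1) rmorph1 hornerC.
  rewrite (key (x * y) (Q x * Q y)); first by rewrite rmorphM /= hornerM.
  by rewrite rmorphM /= hornerM -!QE.
pose fz := GRing.isZmodMorphism.Build K F f fB.
pose fm := GRing.isMonoidMorphism.Build K F f fM.
pose phi : {rmorphism K -> F} := HB.pack_for {rmorphism K -> F} f fz fm.
exists phi; rewrite -[LHS]/(f zeta) (key zeta 'X) ?map_polyX ?hornerX//.
Qed.
End CyclotomicField.

(** * Norms of units *)

Section CyclotomicUnits.
Context {R : realType}.
Variables (N : nat) (K : fieldExtType rat) (zeta : K).
Local Notation n := N.+2.
Local Notation U := {unit 'Z_n}.
Hypothesis pz : n.-primitive_root zeta.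
Hypothesis zfull : <<1; zeta>>%VS = fullv.
Local Notation nc := (@Normc.normc R).
Variable w : R[i].
Hypothesis pw : n.-primitive_root w.

Lemma unit_prim_root (F : fieldType) (v : F) (u : U) :
  n.-primitive_root v -> n.-primitive_root (v ^+ (val u : nat)).
Proof.
move=> pv; rewrite (prim_root_exp_coprime _ pv) coprime_sym -unitZpE//.
by rewrite natr_Zp; exact: (valP u).
Qed.

Lemma card_unitZ : #|{: U}| = totient n.
Proof. by rewrite -card_units_Zp// cardsT. Qed.

Lemma expr_unitM (F : fieldType) (v : F) (s t : U) : n.-primitive_root v ->
  v ^+ (val (s * t)%g : nat) = (v ^+ (val s : nat)) ^+ (val t : nat).
Proof. by move=> pv; rewrite -exprM -[RHS](prim_expr_mod pv). Qed.

Lemma integral_prod (x : U -> K) : (forall u, integralOver (intr : int -> K) (x u)) ->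
  integralOver (intr : int -> K) (\prod_u x u).
Proof.
move=> xi; elim/big_ind : _ => // [|y z]; first exact: integral1.
exact: integral_mul.
Qed.

Lemma integral_endo (s : {rmorphism K -> K}) x :
  integralOver (intr : int -> K) x -> integralOver (intr : int -> K) (s x).
Proof.
move=> [p pm px]; exists p => //.
have -> : map_poly intr p = map_poly s (map_poly intr p).
  by rewrite -map_poly_comp; apply: eq_map_poly => z /=; rewrite rmorph_int.
by rewrite fmorph_root.
Qed.

(** The norm is formed inside [K] with the automorphisms [zeta |-> zeta ^ u], where it is seen to be
    rational and integral with integral inverse, hence 1 or -1; [phi 1] then carries it to the
    complex numbers. *)
Lemma prod_embeddings_unit (phi : U -> {rmorphism K -> R[i]}) (x : K) :
  (forall u, phi u zeta = w ^+ (val u : nat)) -> integer_units x ->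
  \prod_u nc (phi u x) = 1.
Proof.
move=> phiE [x0 xi xVi].
have [s sE] := choice (fun u => rmorph_zeta_exists (isT : (0 < n)%N) pz zfull
  (in_alg K) (unit_prim_root u pz)).
pose Nx := \prod_u s u x.
have sN v : s v Nx = Nx.
  rewrite /Nx rmorph_prod/= [RHS](reindex_inj (mulgI v)); apply: eq_bigr => u _.
  apply: (@rmorph_zeta_eq n K zeta isT pz zfull K (s v \o s u) (s (v * u)%g)).
  by rewrite /= !sE rmorphXn sE expr_unitM.
have [P sP NP] := cyclo_polyP (isT : (0 < n)%N) pz zfull Nx.
(* [P - Nx] has size at most [totient n] but vanishes at the [totient n] conjugates of [zeta], so it
   is zero. *)
have NQ : Nx = (P`_0)%:A.
  pose Q := map_poly (in_alg K) P - Nx%:P.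
  have Q0 : Q = 0.
    apply/eqP/negPn/negP => Q0.
    have := @max_poly_roots _ Q [seq zeta ^+ (val u : nat) | u : U] Q0.
    have -> : all (root Q) [seq zeta ^+ (val u : nat) | u : U].
      apply/allP => _ /mapP[u _ ->]; rewrite /Q rootE hornerD hornerN hornerC.
      by rewrite -sE -(@rmorph_horner_zeta K zeta K (in_alg K) (s u)) -NP sN subrr.
    rewrite map_inj_uniq ?enum_uniq; last first.
      move=> u v /eqP; rewrite (eq_prim_root_expr pz) => /eqP e.
      apply/val_inj/val_inj; move: e; rewrite !modn_small//; exact: ltn_ord.
    move=> /(_ isT isT); rewrite size_map -cardE card_unitZ.
    rewrite ltnNge => /negP; apply; apply: leq_trans (size_polyD _ _) _.
    rewrite geq_max size_polyN (leq_trans (size_polyC_leq1 _)) ?totient_gt0// andbT.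
    by rewrite (leq_trans _ sP)// size_map_poly.
  have /(congr1 (fun q : {poly K} => q`_0)) : Q = 0 := Q0.
  rewrite coefB coefC eqxx coef0 coef_map/= => /eqP.
  by rewrite subr_eq0 => /eqP <-.
have Ni : integralOver (intr : int -> K) Nx.
  by apply: integral_prod => u; exact: integral_endo.
have NVi : integralOver (intr : int -> K) Nx^-1.
  have -> : Nx^-1 = \prod_u s u x^-1.
    by rewrite /Nx -prodfV; apply: eq_bigr => u _; rewrite fmorphV.
  by apply: integral_prod => u; exact: integral_endo.
set q := P`_0 in NQ.
have NVq : Nx^-1 = (q^-1)%:A.
  by rewrite NQ -[q%:A]/(in_alg K q) -fmorphV.
rewrite NQ in Ni; rewrite NVq in NVi.
have [z1 e1] := integral_rat_int Ni; have [z2 e2] := integral_rat_int NVi.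
have q0 : q != 0.
  apply/eqP => q0; have /eqP : Nx = 0 by rewrite NQ q0 scale0r.
  rewrite /Nx => /prodf_eq0[u _]; rewrite fmorph_eq0.
  by rewrite (negbTE x0).
have zz : z1 = 1 \/ z1 = -1.
  have z12 : z1 * z2 = 1.
    by apply: (@intr_inj rat); rewrite intrM -e1 -e2 mulfV.
  have /eqP : (`|z1| * `|z2|)%N = 1%N by rewrite -abszM z12.
  rewrite muln_eq1 => /andP[/eqP + _].
  by case: (z1) => [m|m] /= => [->|[->]]; [left|right].
have -> : \prod_u nc (phi u x) = nc (phi 1%g Nx).
  rewrite /Nx rmorph_prod nc_prod; apply: eq_bigr => u _; congr nc; symmetry.
  apply: (@rmorph_zeta_eq n K zeta isT pz zfull _ (phi 1%g \o s u) (phi u)).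
  by rewrite /= sE rmorphXn !phiE expr1.
have -> : phi 1%g Nx = ratr q.
  by rewrite NQ -(fmorph_eq_rat (phi 1%g \o in_alg K)).
rewrite e1 rmorph_int; have [->|->] := zz.
- by rewrite nc1.
- by rewrite rmorphN ncN nc1.
Qed.
End CyclotomicUnits.

(** * Covering radius of the logarithmic lattice *)

Lemma prod_one_sub_unity (F : fieldType) (p : nat) (h y : F) :
  p.-primitive_root h -> y != 0 -> 1 - y ^+ p = \prod_(i < p) (1 - y * h ^+ i).
Proof.
move=> ph y0; have := congr1 (horner^~ y^-1) (factor_Xn_sub_1 ph).
rewrite horner_prod !hornerE big_mkord => e.
transitivity (y ^+ p * (y^-1 ^+ p - 1)).
  by rewrite mulrBr mulr1 -exprMn mulfV// expr1n.
rewrite -e -[p in y ^+ p]card_ord -prodr_const -big_split/=.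
by apply: eq_bigr => i _; rewrite hornerXsubC mulrBr mulfV.
Qed.

(** * Distribution relation and prime powers *)

Section Distribution.
Context {R : realType}.
Local Notation nc := (@Normc.normc R).
Variable N : nat.
Local Notation n := N.+2.
Local Notation U := {unit 'Z_n}.
Variable w : R[i].
Hypothesis pw : n.-primitive_root w.

(** Logarithm of the factorization [prod_one_sub_unity]; the condition on [k] keeps every factor
    away from 0. *)
Lemma ell_distribution (p : nat) (c k : 'Z_n) : p.-primitive_root (wexp w c) ->
  p%:R * k != 0 -> ell w (p%:R * k) = \sum_(i < p) ell w (k + i%:R * c).
Proof.
move=> pc pk0; set y := wexp w k; set h := wexp w c in pc.
have y0 : y != 0 by rewrite -nc_eq0 nc_wexp ?oner_eq0.
have E := prod_one_sub_unity pc y0.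
have pE : wexp w (p%:R * k) = y ^+ p by rewrite wexpMn.
have yp : 1 - y ^+ p != 0 by rewrite subr_eq0 eq_sym -pE (wexp_eq1 pw).
have ypos : 0 < nc (1 - y ^+ p) by rewrite lt_neqAle nc_ge0 eq_sym nc_eq0 yp.
have fpos (i : 'I_p) : 0 < nc (1 - y * h ^+ i).
  rewrite lt_neqAle nc_ge0 eq_sym nc_eq0 andbT.
  by move: yp; rewrite E => /prodf_neq0; apply.
have iE (i : 'I_p) : wexp w (k + i%:R * c) = y * h ^+ i.
  by rewrite (wexpD pw) wexpMn.
rewrite /ell pE; under eq_bigr do rewrite iE.
apply: expR_inj; rewrite expR_sum /lsq.
under eq_bigr => i _ do rewrite lnK ?posrE ?exprn_gt0//.
by rewrite lnK ?posrE ?exprn_gt0// E nc_prod prodrXl.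
Qed.

(** A nonzero [k] is [p ^ j * m] with [m] prime to [p] and [j <= t]; the distribution relation
    lowers [j] until only units are left. *)
Lemma twisted_sum_prime_power (G : U -> R) (p t : nat) :
  prime p -> n = (p ^ t.+1)%N ->
  (forall u : U, \sum_(v : U) G v * ell w (val v * val u) = 0) ->
  forall k : 'Z_n, \sum_(v : U) G v * ell w (val v * k) = 0.
Proof.
move=> pp nE GU k.
have p0 := prime_gt0 pp.
have H j m : (j <= t)%N -> ~~ (p %| m)%N ->
    \sum_(v : U) G v * ell w (val v * (p ^ j * m)%:R) = 0.
  elim: j m => [|j IH] m jt pm.
    have [|u ue] := @coprime_unit N m.
      by rewrite nE coprime_sym coprimeXl// prime_coprime.
    by rewrite expn0 mul1n -ue; exact: GU.
  (* The translates [m + i * p ^ (t - j)] stay prime to [p] because [j < t]; they come from the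
     [p]-th root of unity with exponent [val v * p ^ t]. *)
  transitivity (\sum_(i < p) \sum_(v : U) G v *
      ell w (val v * (p ^ j * (m + i * p ^ (t - j)))%:R)).
    rewrite exchange_big/=; apply: eq_bigr => v _; rewrite -mulr_sumr; congr (_ * _).
    have -> : val v * (p ^ j.+1 * m)%:R = p%:R * (val v * (p ^ j * m)%:R) :> 'Z_n.
      by rewrite mulrCA -natrM mulnA -expnS.
    rewrite (@ell_distribution _ (val v * (p ^ t)%:R)).
    - apply: eq_bigr => i _; congr ell.
      rewrite mulrCA -mulrDr; congr (_ * _); rewrite -natrM -natrD mulnDr.
      by rewrite mulnCA -expnD subnKC// ltnW.
    - have -> : wexp w (val v * (p ^ t)%:R) = (w ^+ (val v : nat)) ^+ (p ^ t).
        by rewrite mulrC (wexpMn pw).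
      have -> : (p ^ t)%N = (n %/ p)%N by rewrite nE expnSr mulnK.
      apply: dvdn_prim_root; last by rewrite nE expnS dvdn_mulr.
      exact: unit_prim_root.
    - rewrite mulrCA -natrM mulnA -expnS; apply/eqP => e0.
      have : (p ^ j.+1 * m)%:R = 0 :> 'Z_n.
        by apply: (mulrI (valP v)); rewrite e0 mulr0.
      move=> /eqP; rewrite -(wexp_eq1 pw) (wexp_nat pw) -(prim_order_dvd pw) nE.
      rewrite -(subnKC jt) -addnS expnD dvdn_pmul2l ?expn_gt0 ?p0// expnS.
      by move=> /(dvdn_trans (dvdn_mulr _ (dvdnn p))); rewrite (negbTE pm).
  rewrite big1// => i _; apply: IH; first exact: ltnW.
  have tj : (0 < t - j)%N by rewrite subn_gt0.
  by rewrite dvdn_addl// dvdn_mull// -(prednK tj) expnS dvdn_mulr.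
have [->|k0] := eqVneq k 0; last first.
  have {}k0 : (0 < k)%N by rewrite lt0n; apply: contra k0 => /eqP h; apply/eqP/val_inj.
  have [m pm kE] := pfactor_coprime pp k0.
  rewrite -[k]natr_Zp [in X in X%:R]kE; under eq_bigr do rewrite mulnC.
  apply: H; last by rewrite -prime_coprime.
  rewrite -ltnS -(ltn_exp2l _ _ (prime_gt1 pp)) -nE.
  by apply: leq_ltn_trans (ltn_ord k); apply: dvdn_leq => //; apply: pfactor_dvdnn.
by rewrite big1// => v _; rewrite mulr0 ell0 mulr0.
Qed.
End Distribution.

(** * Covering radius from a spanning family *)

Section CoveringRadiusBound.
Context {R : realType} {m : nat}.
Implicit Types L : set 'rV[R]_m.

Lemma covering_radius_le L (B : R) k (b : 'I_k -> 'rV[R]_m) :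
  L 0 -> (forall x y, L x -> L y -> L (x - y)) -> (forall i, L (b i)) ->
  (forall x, real_span L x -> exists c : 'I_k -> R, x = \sum_i c i *: b i) ->
  4^-1 * \sum_i sqnorm (b i) <= B ->
  (covering_radius L <= (Num.sqrt B)%:E)%E.
Proof.
move=> L0 LB Lb span bB; apply: ge_ereal_sup => _ [x /span[c ->] <-].
have [v Lv h] := lattice_rounding L0 LB c Lb.
apply: (@le_trans _ _ (l2norm (\sum_i c i *: b i - v))%:E).
  by apply: ereal_inf_lbound; exists v.
by rewrite lee_fin ler_wsqrtr// (le_trans h).
Qed.

(** Duality: the columns of [cokermx A] are annihilated by [A], hence constant, and a vector with
    sum zero is orthogonal to constants. *)
Lemma sum0_submx k (A : 'M[R]_(k, m)) :
  (forall f : 'I_m -> R, A *m (\col_j f j) = 0 ->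
     forall j, f j = (\sum_i f i) / m%:R) ->
  forall x : 'rV[R]_m, \sum_j x ord0 j = 0 -> (x <= A)%MS.
Proof.
move=> H x x0; rewrite submxE; apply/eqP/rowP => t; rewrite !mxE.
have fE : forall j, cokermx A j t = (\sum_i cokermx A i t) / m%:R.
  apply: (H (fun j => cokermx A j t)).
  have -> : \col_j cokermx A j t = col t (cokermx A) by apply/colP => j; rewrite !mxE.
  by rewrite colE mulmxA mulmx_coker mul0mx.
under eq_bigr => j _ do rewrite fE.
by rewrite -mulr_suml x0 mul0r.
Qed.
End CoveringRadiusBound.

(** * Embeddings as units of [Z / n], and generators of the span *)

Section EmbeddingSystem.
Context {R : realType}.
Variables (N : nat) (K : fieldExtType rat) (zeta : K).
Local Notation n := N.+2.
Local Notation U := {unit 'Z_n}.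
Local Notation nc := (@Normc.normc R).
Hypothesis n2 : (2 < n)%N.
Hypothesis pz : n.-primitive_root zeta.
Hypothesis zfull : <<1; zeta>>%VS = fullv.
Let w : R[i] := zexp n.
Let pw : n.-primitive_root w. Proof. exact: zexp_prim. Qed.
Let n0 : (0 < n)%N. Proof. by []. Qed.

Definition negu (u : U) : U := (FinRing.unit _ (unitrN1 'Z_n) * u)%g.

Lemma val_negu u : val (negu u) = - val u.
Proof. by rewrite /negu FinRing.val_unitM mulN1r. Qed.

Lemma negu_neq u : negu u != u.
Proof.
apply/eqP => /(congr1 val); rewrite val_negu => e.
have : val u + val u = 0 by rewrite -{1}e addNr.
have -> : val u + val u = val u * 2%:R by rewrite mulr_natr mulr2n.
move=> /(congr1 (fun x => (val u)^-1 * x)); rewrite mulKr ?(valP u)// mulr0.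
move=> /(congr1 (fun x : 'Z_n => x : nat)); rewrite val_Zp_nat//=.
by rewrite modn_small.
Qed.

Lemma negu_eq u v : val v = - val u -> v = negu u.
Proof. by move=> e; apply: val_inj; rewrite val_negu. Qed.

(** A real root of unity has square 1, whereas the image of [zeta] has order [n > 2]. *)
Lemma embedding_nonreal (phi : {rmorphism K -> R[i]}) : ~ real_embedding phi.
Proof.
move=> h; have pphi : n.-primitive_root (phi zeta) by rewrite fmorph_primitive_root.
have : phi zeta ^+ 2 = 1.
  have z1 : nc (phi zeta) = 1.
    apply/eqP; rewrite -(@pexpr_eq1 _ _ n) ?nc_ge0//.
    by rewrite -ncX (prim_expr_order pphi) nc1.
  have := nc_sqr (phi zeta); rewrite z1 h expr0n addr0 expr1n => e.
  rewrite {1}(complexE (phi zeta)) h mulr0 addr0 -rmorphXn/= -e.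
  by rewrite rmorph1.
move=> /eqP; rewrite -(prim_order_dvd pphi) => /dvdn_leq => /(_ isT).
by rewrite leqNgt n2.
Qed.

Lemma wexp_embedding (u : U) :
  exists phi : {rmorphism K -> R[i]}, phi zeta = wexp w (val u).
Proof.
apply: (rmorph_zeta_exists n0 pz zfull (ratr : {rmorphism rat -> R[i]})).
exact: unit_prim_root.
Qed.

Lemma embedding_unit (phi : {rmorphism K -> R[i]}) :
  exists u : U, phi zeta = wexp w (val u).
Proof.
have pphi : n.-primitive_root (phi zeta) by rewrite fmorph_primitive_root.
have [i e] := prim_rootP pw (prim_expr_order pphi).
have ci : coprime i n by rewrite -(prim_root_exp_coprime _ pw) -e.
have [u ue] := coprime_unit ci; exists u.
by rewrite ue wexp_nat.
Qed.

Variables (s' : nat) (sr : 'I_0 -> {rmorphism K -> R[i]}).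
Variable sc : 'I_s' -> {rmorphism K -> R[i]}.
Hypothesis ES : embedding_system sr sc.

(** Embeddings correspond to units and conjugation to negation; [e] represents the classes of [U]
    modulo sign and [J] is the class map. *)
Lemma embedding_choices : exists (phi : U -> {rmorphism K -> R[i]})
    (e : 'I_s' -> U) (J : U -> 'I_s'),
  [/\ forall u, phi u zeta = wexp w (val u),
      forall j, phi (e j) =1 sc j,
      forall u x, phi (negu u) x = conjc (phi u x),
      forall j, J (e j) = j /\ J (negu (e j)) = j
    & forall u, u = e (J u) \/ u = negu (e (J u))].
Proof.
have [phi phiE] := choice wexp_embedding.
have [e eE] := choice (fun j => embedding_unit (sc j)).
have [_ _ _ H] := ES.
have [J JE] := choice (fun u => H (phi u) (embedding_nonreal (phi := phi u))).
have pe j : phi (e j) =1 sc j.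
  by apply: (rmorph_zeta_eq n0 pz zfull); rewrite phiE eE.
have pN u x : phi (negu u) x = conjc (phi u x).
  apply: (@rmorph_zeta_eq n K zeta n0 pz zfull _ (phi (negu u)) (conjc \o phi u)).
  by rewrite /= !phiE conj_wexp// val_negu.
have wI (u v : U) : wexp w (val u) = wexp w (val v) -> u = v.
  move=> h; apply: val_inj; apply/eqP; rewrite -subr_eq0 -(wexp_eq1 pw).
  by rewrite wexpD// h -wexpD// subrr wexp0.
exists phi, e, J; split=> // [j|u].
  split; [have [_ h] := JE (e j) | have [_ h] := JE (negu (e j))]; apply: h.
    by left => x; rewrite pe.
  by right => x; rewrite pN pe.
have [[h|h] _] := JE u; [left|right]; apply: wI; rewrite -phiE h.
  by rewrite -(pe (J u)) phiE.
by rewrite -(pe (J u)) -pN phiE.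
Qed.

Section Choices.
Variables (phi : U -> {rmorphism K -> R[i]}) (e : 'I_s' -> U) (J : U -> 'I_s').
Hypotheses (phiE : forall u, phi u zeta = wexp w (val u))
  (phie : forall j, phi (e j) =1 sc j)
  (phiN : forall u x, phi (negu u) x = conjc (phi u x))
  (Je : forall j, J (e j) = j /\ J (negu (e j)) = j)
  (eJ : forall u, u = e (J u) \/ u = negu (e (J u))).

Lemma sum_even_units (g : U -> R) : (forall u, g (negu u) = g u) ->
  \sum_u g u = 2 * \sum_j g (e j).
Proof.
move=> gN; rewrite (partition_big J xpredT)//= mulr_sumr; apply: eq_bigr => j _.
rewrite (bigD1 (e j)) ?(Je j).1//= (bigD1 (negu (e j))) /=; last first.
  by rewrite (Je j).2 eqxx negu_neq.
rewrite big1 ?addr0 ?gN; first by rewrite mulrDl mul1r.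
move=> u /andP[/andP[/eqP Ju u1] u2]; case: (eJ u) => h; rewrite Ju in h.
  by rewrite h eqxx in u1.
by rewrite h eqxx in u2.
Qed.

Lemma totient_twice : (totient n = 2 * s')%N.
Proof.
have := sum_even_units (g := fun=> 1) (fun=> erefl).
rewrite !sumr_const card_ord -[#|_|]/(#|{: U}|) card_unitZ => h.
by apply/eqP; rewrite -(eqr_nat R) h natrM.
Qed.

Lemma LogE x (j : 'I_s') : Log sr sc x ord0 j = ln (nc (sc j x) ^+ 2).
Proof.
have -> : j = rshift 0 j by apply: val_inj.
by rewrite /Log row_mxEr mxE (_ : rshift 0 j = j)//; exact: val_inj.
Qed.

Lemma Log_units0 : (Log sr sc @` integer_units) 0.
Proof.
exists 1.
  split; first exact: oner_neq0; last rewrite invr1; exact: integral1.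
apply/rowP => j; rewrite LogE mxE rmorph1 nc1 expr1n ln1//.
Qed.

Lemma nc_emb_gt0 j x : x != 0 -> 0 < nc (sc j x).
Proof. by move=> x0; rewrite lt_neqAle nc_ge0 eq_sym nc_eq0 fmorph_eq0 x0. Qed.

Lemma Log_div x y : x != 0 -> y != 0 ->
  Log sr sc (x / y) = Log sr sc x - Log sr sc y.
Proof.
move=> x0 y0; apply/rowP => j; rewrite LogE [RHS]mxE [X in _ + X]mxE !LogE.
have xp := nc_emb_gt0 j x0; have yp := nc_emb_gt0 j y0.
by rewrite fmorph_div ncM Normc.normcV expr_div_n ln_div ?posrE ?exprn_gt0.
Qed.

Lemma Log_unitsB (a b : 'rV[R]_s') : (Log sr sc @` integer_units) a ->
  (Log sr sc @` integer_units) b -> (Log sr sc @` integer_units) (a - b).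
Proof.
move=> [x [x0 xi xVi] <-] [y [y0 yi yVi] <-]; exists (x / y); last exact: Log_div.
split; first by rewrite mulf_neq0// invr_eq0.
  exact: integral_mul.
by rewrite invfM invrK mulrC; exact: integral_mul.
Qed.

Lemma Log_unit_sum0 x : integer_units x -> \sum_j Log sr sc x ord0 j = 0.
Proof.
move=> xu; have x0 : x != 0 by case: xu.
have pos u : 0 < nc (phi u x).
  by rewrite lt_neqAle nc_ge0 eq_sym nc_eq0 fmorph_eq0 x0.
have := sum_even_units (g := fun u => ln (nc (phi u x) ^+ 2)).
have -> : \sum_u ln (nc (phi u x) ^+ 2) = 0.
  apply: expR_inj; rewrite expR0 expR_sum.
  under eq_bigr => u _ do rewrite lnK ?posrE ?exprn_gt0//.
  by rewrite prodrXl (prod_embeddings_unit pz zfull phiE xu) expr1n.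
move=> h; have {h} : 0 = 2 * \sum_j ln (nc (phi (e j) x) ^+ 2).
  apply: h => u; rewrite phiN; case: (phi u x) => a b /=.
  by rewrite sqrrN.
move=> /esym/eqP; rewrite mulf_eq0 pnatr_eq0/= => /eqP h; rewrite -[RHS]h.
by apply: eq_bigr => j _; rewrite LogE phie.
Qed.

Definition zpow (k : 'Z_n) : K := zeta ^+ (k : nat).

Lemma one_sub_neq0 (k : 'Z_n) : k != 0 -> 1 - zpow k != 0.
Proof.
move=> k0; rewrite subr_eq0 eq_sym -(prim_order_dvd pz); apply: contra k0 => h.
apply/eqP/val_inj => /=; have [//|kp] := posnP (k : nat).
by have := dvdn_leq kp h; rewrite leqNgt (ltn_ord k).
Qed.

Lemma emb_one_sub j (k : 'Z_n) :
  sc j (1 - zpow k) = 1 - wexp w (val (e j) * k).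
Proof.
rewrite rmorphB rmorph1 rmorphXn -(phie j) phiE; congr (1 - _).
by rewrite -wexpMn// natr_Zp mulrC.
Qed.

(** The quotient is a geometric sum of powers of [zpow k]. *)
Lemma cyclo_ratio_integral (u : U) (k : 'Z_n) : k != 0 ->
  ring_of_integers ((1 - zpow (val u * k)) / (1 - zpow k)).
Proof.
move=> k0; have h := one_sub_neq0 k0.
have -> : zpow (val u * k) = (zpow k) ^+ (val u : nat).
  by rewrite /zpow -exprM -[RHS](prim_expr_mod pz) mulnC.
set y := zpow k in h *.
rewrite -opprB subrX1 -mulNr opprB mulrAC mulfV// mul1r.
apply: (big_ind (fun x : K => integralOver (intr : int -> K) x)) => [|a b|i _].
- by exists 'X; rewrite ?monicX// map_polyX rootX.
- exact: integral_add.
have -> : y ^+ i = zeta ^+ (k * i) by rewrite /y /zpow exprM.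
exists ('X^n - 1); first exact: monicXnsubC.
rewrite rmorphB rmorph1 /= map_polyXn rootE !hornerE -exprM mulnC exprM.
by rewrite (prim_expr_order pz) expr1n subrr.
Qed.

Lemma unit_mul_neq0 (u : U) (k : 'Z_n) : k != 0 -> val u * k != 0.
Proof.
apply: contra => /eqP h; apply/eqP.
by rewrite -[k](mulKr (valP u)) h mulr0.
Qed.

(** The inverse has the same shape, with [u^-1] and [val u * k]. *)
Lemma cyclo_ratio_unit (u : U) (k : 'Z_n) : k != 0 ->
  integer_units ((1 - zpow (val u * k)) / (1 - zpow k)).
Proof.
move=> k0; have uk0 := unit_mul_neq0 u k0; split.
- by rewrite mulf_neq0 ?invr_eq0 ?one_sub_neq0.
- exact: cyclo_ratio_integral.
- rewrite invfM invrK mulrC.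
  have := cyclo_ratio_integral u^-1%g uk0.
  by rewrite FinRing.val_unitV mulKr ?(valP u).
Qed.

Definition cvec (k : 'Z_n) : 'rV[R]_s' := \row_i ell w (val (e i) * k).

Lemma cvec_lattice (u : U) (k : 'Z_n) : k != 0 ->
  (Log sr sc @` integer_units) (cvec (val u * k) - cvec k).
Proof.
move=> k0; have uk0 := unit_mul_neq0 u k0.
exists ((1 - zpow (val u * k)) / (1 - zpow k)).
  exact: cyclo_ratio_unit.
rewrite Log_div ?one_sub_neq0//; apply/rowP => j.
rewrite [LHS]mxE [X in _ + X]mxE !LogE !emb_one_sub.
by rewrite /cvec !mxE.
Qed.

Lemma ell_negu u k : ell w (val (negu u) * k) = ell w (val u * k).
Proof. by rewrite val_negu mulNr ellN. Qed.

(** Half of the sum over [U], which is enlarged to all residues and bounded by [6 n]. *)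
Lemma sum_ell_sqr k : \sum_i ell w (val (e i) * k) ^+ 2 <= 3 * n%:R.
Proof.
have := sum_even_units (g := fun u => ell w (val u * k) ^+ 2).
move=> /(_ (fun u => congr1 (fun x => x ^+ 2) (ell_negu u k))) h.
rewrite -(@ler_pM2l _ 2)// -h.
apply: (@le_trans _ _ (\sum_(a : 'Z_n) ell w (a * k) ^+ 2)).
  have -> : \sum_(u : U) ell w (val u * k) ^+ 2 =
      \sum_(a in [set FinRing.uval u | u in [set: U]%SET]%SET) ell w (a * k) ^+ 2.
    rewrite big_imset /=; last by move=> u v _ _ uv; apply: val_inj.
    by apply: eq_bigl => u; rewrite finset.in_setT.
  by rewrite big_mkcond/=; apply: ler_sum => a _; case: ifP => // _; exact: sqr_ge0.
apply: le_trans (_ : 6 * n%:R <= _); last by rewrite mulrA; lra.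
apply: le_trans (sum_lsq_le (k : nat) pw); rewrite le_eqVlt; apply/orP; left.
apply/eqP; apply: eq_bigr => a _; congr (_ ^+ 2); rewrite /ell; congr lsq.
by rewrite -[a in LHS]natr_Zp wexpMn// /wexp -exprM mulnC.
Qed.

Lemma sqnorm_cvec k : sqnorm (cvec k) <= 3 * n%:R.
Proof.
by apply: le_trans (sum_ell_sqr k); rewrite /sqnorm; under eq_bigr do rewrite mxE.
Qed.

(** Passes from [f] on embeddings to an even function on [U]: [f] minus its mean, pulled back along
    [J], to which [even_function_eq0] applies. *)
Lemma even_function_const (f : 'I_s' -> R) :
  (forall G : U -> R, (forall u, G (negu u) = G u) -> \sum_u G u = 0 ->
     (forall j, G (e j) = f j - (\sum_i f i) / s'%:R) ->
     forall k, \sum_u G u * ell w (val u * k) = 0) ->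
  forall j, f j = (\sum_i f i) / s'%:R.
Proof.
move=> H j0; pose c := (\sum_i f i) / s'%:R.
have s0 : s'%:R != 0 :> R by rewrite pnatr_eq0 -lt0n (leq_ltn_trans _ (ltn_ord j0)).
pose G u := f (J u) - c.
have JN u : J (negu u) = J u.
  have negK v : negu (negu v) = v by apply: val_inj; rewrite !val_negu opprK.
  by case: (eJ u) => {1}->; [exact: (Je _).2|rewrite negK; exact: (Je _).1].
have GN u : G (negu u) = G u by rewrite /G JN.
have Ge j : G (e j) = f j - c by rewrite /G (Je j).1.
have GS : \sum_u G u = 0.
  rewrite (sum_even_units GN); under eq_bigr do rewrite Ge.
  by rewrite sumrB sumr_const card_ord -[c *+ _]mulr_natr /c divfK// subrr mulr0.
have h := even_function_eq0 pw (G := fun u => (G u)%:C%C).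
apply/eqP; rewrite -subr_eq0 -/c -Ge; apply/eqP.
apply: (@complexI R); rewrite h ?rmorph0//.
- by move=> u v /negu_eq ->; rewrite GN.
- by rewrite -rmorph_sum GS.
- move=> k; rewrite -[RHS](rmorph0 (real_complex R)) -(H G GN GS Ge k) rmorph_sum.
  by apply: eq_bigr => u _; rewrite rmorphM.
Qed.

(* Summing [T_k(u) = sum_v G v * ell (v u k)] over [u] gives [0], so that
   [T_k] vanishes as soon as it is constant. *)
Lemma twisted_sum_eq0 (G : U -> R) k : \sum_u G u = 0 ->
  (forall u : U, \sum_(v : U) G v * ell w (val v * (val u * k)) =
             \sum_(v : U) G v * ell w (val v * k)) ->
  \sum_(v : U) G v * ell w (val v * k) = 0.
Proof.
move=> GS h; have q0 : \sum_(u : U) (1 : R) != 0.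
  by rewrite sumr_const pnatr_eq0; apply/eqP => /card0_eq/(_ 1%g).
apply: (mulfI q0); rewrite mulr0 mulr_suml.
under eq_bigr => u _ do rewrite mul1r -(h u).
rewrite exchange_big/=.
transitivity ((\sum_u G u) * \sum_(u : U) ell w (val u * k)); last by rewrite GS mul0r.
rewrite mulr_suml.
apply: eq_bigr => v _; rewrite -mulr_sumr; congr (_ * _).
rewrite [RHS](reindex_inj (mulgI v))/=; apply: eq_bigr => u _.
by rewrite mulrA.
Qed.

Lemma even_twisted_sum (G : U -> R) k : (forall u, G (negu u) = G u) ->
  \sum_u G u * ell w (val u * k) = 2 * \sum_j G (e j) * ell w (val (e j) * k).
Proof.
move=> GN; rewrite (@sum_even_units (fun u => G u * ell w (val u * k)))// => u.
by rewrite GN ell_negu.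
Qed.

Lemma sum_ell_unit (t : U) (k : 'Z_n) :
  \sum_j ell w (val (e j) * (val t * k)) = \sum_j ell w (val (e j) * k).
Proof.
apply: (mulfI (_ : 2 != 0 :> R)); first by rewrite pnatr_eq0.
rewrite -!(@sum_even_units (fun u => ell w (val u * _)))//; last 2 first.
  by move=> v; rewrite ell_negu.
  by move=> v; rewrite ell_negu.
rewrite [RHS](reindex_inj (mulgI t))/=; apply: eq_bigr => v _.
by congr ell; rewrite mulrCA mulrA.
Qed.

(** [G] and [f] differ by the constant [c], which only meets the sums of [ell], and these are
    unchanged by a unit. *)
Lemma twisted_sum_invariant (f : 'I_s' -> R) (G : U -> R) c (u : U) (k : 'Z_n) :
  (forall u, G (negu u) = G u) -> (forall j, G (e j) = f j - c) ->
  \sum_j f j * (ell w (val (e j) * (val u * k)) - ell w (val (e j) * k)) = 0 ->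
  \sum_(v : U) G v * ell w (val v * (val u * k)) =
  \sum_(v : U) G v * ell w (val v * k).
Proof.
move=> GN Ge H; rewrite !even_twisted_sum//; congr (_ * _).
apply/eqP; rewrite -subr_eq0 -sumrB.
apply/eqP; transitivity (\sum_j (f j - c) *
    (ell w (val (e j) * (val u * k)) - ell w (val (e j) * k))).
  by apply: eq_bigr => j _; rewrite Ge mulrBr.
under eq_bigr do rewrite mulrBl.
by rewrite sumrB H -mulr_sumr sumrB sum_ell_unit subrr mulr0 subrr.
Qed.

Lemma orthogonal_all_const (f : 'I_s' -> R) :
  (forall (u : U) (k : 'Z_n),
    \sum_j f j * (ell w (val (e j) * (val u * k)) - ell w (val (e j) * k)) = 0) ->
  forall j, f j = (\sum_i f i) / s'%:R.
Proof.
move=> H; apply: even_function_const => G GN GS Ge k.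
by apply: twisted_sum_eq0 => // u; exact: (twisted_sum_invariant GN Ge).
Qed.

(** Orthogonality to differences with one fixed vector makes the twisted sum constant on the [e i],
    hence by evenness on [U], hence zero; the distribution relation extends this to all [k]. *)
Lemma orthogonal_prime_power_const (p t : nat) (j0 : 'I_s') (f : 'I_s' -> R) :
  prime p -> n = (p ^ t.+1)%N ->
  (forall i, \sum_j f j *
     (ell w (val (e j) * val (e i)) - ell w (val (e j) * val (e j0))) = 0) ->
  forall j, f j = (\sum_i f i) / s'%:R.
Proof.
move=> pp nE H; apply: even_function_const => G GN GS Ge.
apply: (twisted_sum_prime_power pw pp nE) => u.
have T0 i : \sum_(v : U) G v * ell w (val v * val (e i)) =
    \sum_(v : U) G v * ell w (val v * val (e j0)).
  have ei : val (e i) = val (e i * (e j0)^-1)%g * val (e j0).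
    by rewrite -FinRing.val_unitM mulgKV.
  by rewrite ei; apply: (twisted_sum_invariant GN Ge); rewrite -ei.
have T1 (v : U) : \sum_(v' : U) G v' * ell w (val v' * val v) =
    \sum_(v : U) G v * ell w (val v * val (e j0)).
  case: (eJ v) => ->; first exact: T0.
  rewrite -(T0 (J v)); apply: eq_bigr => v' _; congr (_ * _).
  by rewrite val_negu mulrN ellN.
apply: twisted_sum_eq0 => // v.
by rewrite -FinRing.val_unitM !T1.
Qed.

Local Notation units_lattice := (Log sr sc @` integer_units : set 'rV[R]_s').

Lemma cvec_lattice0 (u : U) (k : 'Z_n) :
  units_lattice (cvec (val u * k) - cvec k).
Proof.
have [->|] := eqVneq k 0; last exact: cvec_lattice.
by rewrite mulr0 subrr; exact: Log_units0.
Qed.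

Lemma real_span_sum0 x : real_span units_lattice x -> \sum_j x ord0 j = 0.
Proof.
move=> [k [c [v [Lv ->]]]].
under eq_bigr do rewrite summxE.
rewrite exchange_big big1//= => i _.
under eq_bigr do rewrite mxE.
by rewrite -mulr_sumr; have [y yu <-] := Lv i; rewrite (Log_unit_sum0 yu) mulr0.
Qed.

(** From the rows of [A] a maximal free subfamily is kept, so that at most [s'] vectors are rounded,
    each of squared norm at most [2 * 3 n + 2 * 3 n]. *)
Lemma covering_radius_units_le :
  (covering_radius units_lattice <= (Num.sqrt (3 * n%:R * s'%:R))%:E)%E.
Proof.
pose b (t : U * 'Z_n) := cvec (val t.1 * t.2) - cvec t.2.
pose A := \matrix_(i < #|{: U * 'Z_n}|) b (enum_val i).
apply: (@covering_radius_le _ _ _ _ _ (fun i => row (maxrankfun A i) A)).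
- exact: Log_units0.
- exact: Log_unitsB.
- by move=> i; rewrite rowK; exact: cvec_lattice0.
- move=> x /real_span_sum0 x0.
  have : (x <= A)%MS.
    apply: (sum0_submx _ x0) => f fA; apply: orthogonal_all_const => u k.
    transitivity ((A *m (\col_j f j)) (enum_rank (u, k)) ord0); last by rewrite fA mxE.
    rewrite mxE; apply: eq_bigr => j _.
    by rewrite !mxE enum_rankK mulrC.
  rewrite -(eq_maxrowsub A) => /submxP[D ->].
  exists (fun i => D ord0 i); rewrite mulmx_sum_row; apply: eq_bigr => i _.
  by rewrite row_rowsub.
- apply: (@le_trans _ _ (4^-1 * \sum_(i < \rank A) (12 * n%:R))).
    rewrite ler_pM2l ?invr_gt0//; apply: ler_sum => i _; rewrite rowK.
    apply: le_trans (sqnormB_le _ _) _.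
    have := sqnorm_cvec (val (enum_val (maxrankfun A i)).1 * (enum_val (maxrankfun A i)).2).
    by have := sqnorm_cvec (enum_val (maxrankfun A i)).2; lra.
  rewrite sumr_const card_ord -[_ *+ \rank A]mulr_natr.
  have : (\rank A)%:R <= s'%:R :> R by rewrite ler_nat rank_leq_col.
  by have : 0 <= n%:R :> R by []; move: (n%:R) ((\rank A)%:R) (s'%:R) => *; nra.
Qed.

Lemma covering_radius_units_prime_power_le (p t : nat) (j0 : 'I_s') :
  prime p -> n = (p ^ t.+1)%N ->
  (covering_radius units_lattice <= (Num.sqrt (3 / 2 * n%:R * s'%:R))%:E)%E.
Proof.
move=> pp nE; pose b i := cvec (val (e i)) - cvec (val (e j0)).
apply: (@covering_radius_le _ _ _ _ _ b).
- exact: Log_units0.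
- exact: Log_unitsB.
- move=> i; rewrite /b.
  have -> : val (e i) = val (e i * (e j0)^-1)%g * val (e j0).
    by rewrite -FinRing.val_unitM mulgKV.
  exact: cvec_lattice0.
- move=> x /real_span_sum0 x0.
  have : (x <= \matrix_i b i)%MS.
    apply: (sum0_submx _ x0) => f fA.
    apply: (orthogonal_prime_power_const (j0 := j0) pp nE) => i.
    transitivity (((\matrix_i b i) *m (\col_j f j)) i ord0); last by rewrite fA mxE.
    by rewrite mxE; apply: eq_bigr => j _; rewrite !mxE mulrC.
  move=> /submxP[D ->]; exists (fun i => D ord0 i).
  by rewrite mulmx_sum_row; apply: eq_bigr => i _; rewrite rowK.
(* [a] is symmetric with constant row sums, so the inner products of the [cvec] with the fixed one
   add up to a square. Dropping it leaves [6 n] per vector instead of [12 n]. *)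
- pose a i j := ell w (val (e j) * val (e i)).
  have aC i : \sum_j a i j = \sum_j a j0 j.
    have h i0 : \sum_j a i0 j = \sum_j ell w (val (e j) * 1).
      by rewrite -(sum_ell_unit (e i0) 1); apply: eq_bigr => j _; rewrite /a mulr1.
    exact: etrans (h i) (esym (h j0)).
  have aC' j : \sum_i a i j = \sum_j a j0 j.
    by rewrite -(aC j); apply: eq_bigr => i _; rewrite /a mulrC.
  have a2 i : \sum_j a i j ^+ 2 <= 3 * n%:R := sum_ell_sqr _.
  have bE i : sqnorm (b i) =
      \sum_j a i j ^+ 2 + \sum_j a j0 j ^+ 2 - 2 * \sum_j a i j * a j0 j.
    rewrite /sqnorm mulr_sumr -big_split -sumrB /=; apply: eq_bigr => j _.
    by rewrite !mxE /a; ring.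
  have cross : \sum_i \sum_j a i j * a j0 j = (\sum_j a j0 j) ^+ 2.
    rewrite exchange_big expr2 mulr_sumr /=; apply: eq_bigr => j _.
    by rewrite -mulr_suml aC'.
  under eq_bigr do rewrite bE.
  rewrite sumrB -mulr_sumr cross.
  have : \sum_i (\sum_j a i j ^+ 2 + \sum_j a j0 j ^+ 2) <=
      \sum_(i < s') (6 * n%:R : R).
    by apply: ler_sum => i _; have := a2 i; have := a2 j0; lra.
  rewrite sumr_const card_ord -[_ *+ s']mulr_natr.
  have := sqr_ge0 (\sum_j a j0 j).
  by move: (\sum_i _) ((\sum_j _) ^+ 2) (n%:R) (s'%:R) => *; nra.
Qed.
End Choices.
End EmbeddingSystem.

Lemma primes_size1 (n : nat) : (0 < n)%N -> size (primes n) = 1%N ->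
  exists p t, prime p /\ n = (p ^ t.+1)%N.
Proof.
move=> n0 s1; have := prod_prime_decomp n0; rewrite prime_decompE big_map.
case: (primes n) s1 (mem_primes ^~ n) => [//|p [|//]] _ /(_ p).
rewrite inE eqxx => /esym/and3P[pp _ pn]; rewrite big_seq1/= => nE.
exists p, (logn p n).-1; split=> //; rewrite prednK//.
by rewrite logn_gt0 mem_primes pp n0.
Qed.

Theorem theorem3 (R : realType) (n : nat) (K : fieldExtType rat) (zeta : K)
    (r s' : nat)
    (sr : 'I_r -> {rmorphism K -> R[i]})
    (sc : 'I_s' -> {rmorphism K -> R[i]}) :
  (5 <= n)%N ->
  n <> 2 %[mod 4] ->
  n.-primitive_root zeta ->
  <<1; zeta>>%VS = fullv ->
  embedding_system sr sc ->
  let s := size (primes n) in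
  (covering_radius (Log sr sc @` integer_units) <
   (Num.sqrt (n%:R / 2)
    * (1 - (n%:R `^ (s%:R^-1))^-1) `^ (s%:R / 2)
    * ((2 ^+ s - 2)
         * Num.sqrt (5 * pi ^+ 2 / 48 * n%:R + 15 / 2 * ln 2 ^+ 2)
       + Num.sqrt (pi ^+ 2 / 6 * n%:R + 6 * ln 2 ^+ 2)))%:E)%E.
Proof.
case: n => [|[|N]] n5 _ pz zfull ES; [by []|by []|].
cbv zeta; set s := size (primes N.+2).
have n2 : (2 < N.+2)%N by lia.
(* No embedding is real, so [r = 0]. *)
case: r sr ES => [|r] sr ES; last first.
  by have [h _ _ _] := ES; case: (embedding_nonreal n2 pz (h ord0)).
have [phi [e [J [phiE phie phiN Je eJ]]]] := embedding_choices n2 pz zfull ES.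
have s0 : 0 < Num.sqrt s'%:R :> R.
  by rewrite sqrtr_gt0 ltr0n (leq_ltn_trans _ (ltn_ord (J 1%g))).
have pref := @sqrt_totient_le R N.+2 isT.
have tE : (totient N.+2)%:R / 2 = s'%:R :> R.
  by rewrite (@totient_twice R _ n2 _ _ _ Je eJ) mulnC natrM mulfK// pnatr_eq0.
rewrite tE -/s in pref.
have ln20 : 0 < ln 2 ^+ 2 :> R by rewrite exprn_gt0// ln_gt0// ltr1n.
have pi9 : 9 <= pi ^+ 2 :> R.
  by have := @pi_ge3 R; move: (pi : R) => q; nra.
have s_gt0 : (0 < s)%N by rewrite /s lt0n size_eq0 primes_eq0.
set P := Num.sqrt _ * _ in pref *.
suff [B [B0 cB hB]] : exists B : R, [/\ 0 <= B,
   (@covering_radius R s' (Log sr sc @` integer_units) <= (Num.sqrt (B * s'%:R))%:E)%E &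
    Num.sqrt B < (2 ^+ s - 2)
         * Num.sqrt (5 * pi ^+ 2 / 48 * N.+2%:R + 15 / 2 * ln 2 ^+ 2)
       + Num.sqrt (pi ^+ 2 / 6 * N.+2%:R + 6 * ln 2 ^+ 2)].
  apply: le_lt_trans cB _; rewrite lte_fin sqrtrM// mulrC.
  apply: (@lt_le_trans _ _ (Num.sqrt s'%:R * _)); first by rewrite ltr_pM2l//; exact: hB.
  by rewrite ler_wpM2r// (le_trans _ (ltW hB))// sqrtr_ge0.
have nn0 : 0 < N.+2%:R :> R by rewrite ltr0n.
case: (eqVneq s 1%N) => [s1|s1].
  have [p [t [pp nE]]] := primes_size1 (isT : (0 < N.+2)%N) s1.
  exists (3 / 2 * N.+2%:R); split; first by move: (N.+2%:R) nn0 => q; lra.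
    exact: (covering_radius_units_prime_power_le n2 pz zfull sr phiE phie phiN Je eJ (J 1%g) pp nE).
  (* [pi ^ 2 / 6 >= 3 / 2] by [pi >= 3]; the term in [ln 2] makes the inequality strict. *)
  rewrite s1 expr1 subrr mul0r add0r ltr_sqrt; last first.
    by move: (N.+2%:R) nn0 (pi ^+ 2) pi9 (ln 2 ^+ 2) ln20 => *; nra.
  by move: (N.+2%:R) nn0 (pi ^+ 2) pi9 (ln 2 ^+ 2) ln20 => *; nra.
exists (3 * N.+2%:R); split; first by move: (N.+2%:R) nn0 => q; lra.
  exact: (covering_radius_units_le n2 pz zfull sr phiE phie phiN Je eJ).
(* Now [2 ^ s - 2 >= 2], and [4 * 5 * 9 / 48 = 15 / 4] exceeds 3. *)
have s2 : 4 <= 2 ^+ s :> R.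
  rewrite -natrX ler_nat (@leq_trans (2 ^ 2))// leq_exp2l//.
  by rewrite ltn_neqAle eq_sym s1.
set A := _ + 15 / 2 * _; set B := pi ^+ 2 / 6 * _ + _.
have A0 : 0 < A.
  by rewrite /A; move: (N.+2%:R) nn0 (pi ^+ 2) pi9 (ln 2 ^+ 2) ln20 => *; nra.
apply: (@lt_le_trans _ _ (2 * Num.sqrt A)); last first.
  rewrite -[leLHS]addr0 lerD ?sqrtr_ge0// ler_wpM2r ?sqrtr_ge0//.
  by move: (2 ^+ s) s2 => q; lra.
have -> : 2 * Num.sqrt A = Num.sqrt (4 * A).
  rewrite sqrtrM//; congr (_ * _); have -> : 4 = 2 ^+ 2 :> R by rewrite -natrX.
  by rewrite sqrtr_sqr ger0_norm.
rewrite ltr_sqrt ?mulr_gt0// /A.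
by move: (N.+2%:R) nn0 (pi ^+ 2) pi9 (ln 2 ^+ 2) ln20 => *; nra.
Qed.
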